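(* Assume that there exists a constant $\delta\in(0,1]$ such that $\mathbb{E}[M_{1,0}^{2+\delta}+M_{2,0}^{2+\delta}]<\infty$, and that there exists a constant $p>1$ such that $$\mathbb{E}\Big[\frac{Z_{1,1}^p}{m_{1,0}^p}+\frac{Z_{2,1}^p}{m_{2,0}^p}\Big]<\infty.$$ Let $\delta'\in(0,\delta)$. Then there is a constant $C>0$, not depending on $m,n,x$, such that for all integers $m,n\ge1$ and all $x\in\mathbb{R}$, $$\big|\mathbb{P}(R_{m,n}\le x)-\Phi(x)\big|\le\frac{C}{(m\wedge n)^{\delta/2}}\,\frac{1}{1+|x|^{1+\delta'}}.$$
   Context: Setting. Write $\mathbb{N}$ for the natural numbers, $m\wedge n=\min\{m,n\}$, $\ln^+x=\max\{\ln x,0\}$, and $\Phi$ for the standard normal distribution function. Let $((\xi_{1,n},\xi_{2,n})^T)_{n\ge0}$ be a sequence of i.i.d. random vectors in $\mathbb{R}^2$ (the environments; for fixed $n$, $\xi_{1,n}$ and $\xi_{2,n}$ may be dependent). For $l=1,2$, each realization of $\xi_{l,n}$ determines a probability law $p(\xi_{l,n})=\{p_k(\xi_{l,n}):k\in\mathbb{N}\}$ on the nonnegative integers. The two branching processes in random environment are $$Z_{l,0}=1,\qquad Z_{l,n+1}=\sum_{i=1}^{Z_{l,n}}X_{l,n,i},\quad n\ge0,\ l=1,2,$$ where, given the environment, the variables $X_{1,n,i},X_{2,n,i}$ ($n\ge 0$, $i\ge1$) are independent, $X_{l,n,i}$ has law $p(\xi_{l,n})$, and those of generation $n$ are independent of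 $\{Z_{1,k},Z_{2,k}:0\le k\le n\}$. $\mathbb{P}$ and $\mathbb{E}$ denote the annealed (total) probability and expectation. For $l=1,2$ put $$m_{l,n}=\sum_{k=0}^\infty k\,p_k(\xi_{l,n}),\quad M_{l,n}=\ln m_{l,n},\quad \mu_l=\mathbb{E}M_{l,0},\quad \sigma_l^2=\mathrm{Var}(M_{l,0}),\quad \rho=\frac{\mathrm{Cov}(M_{1,0},M_{2,0})}{\sigma_1\sigma_2}.$$ Standing assumptions: $0<\sigma_1,\sigma_2<\infty$; $$\mathbb{E}\Big[\tfrac{Z_{1,1}}{m_{1,0}}\ln^+Z_{1,1}+\tfrac{Z_{2,1}}{m_{2,0}}\ln^+Z_{2,1}\Big]<\infty;$$ $p_0(\xi_{1,0})=p_0(\xi_{2,0})=0$ a.s.; and either $\rho\in[-1,1)$, or $\rho=1$ and $\sigma_1\ne\sigma_2$. Define for integers $m,n\ge1$ $$V_{m,n,\rho}=\sqrt{\tfrac1n\sigma_1^2+\tfrac1m\sigma_2^2-2\rho\sigma_1\sigma_2\tfrac{m\wedge n}{mn}},\qquad R_{m,n}=\frac{\frac1n\ln Z_{1,n}-\frac1m\ln Z_{2,m}-(\mu_1-\mu_2)}{V_{m,n,\rho}}.$$ *)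

(* Defs.v *)
From HB Require Import structures.
From mathcomp Require Import all_boot all_order all_algebra.
From mathcomp Require Import all_classical all_reals all_analysis.
From mathcomp Require Import measurable_realfun.

Set Implicit Arguments.
Unset Strict Implicit.
Unset Printing Implicit Defensive.

Import Order.TTheory GRing.Theory Num.Theory.
Import numFieldNormedType.Exports.

Local Open Scope classical_set_scope.
Local Open Scope ring_scope.

(* Conventions: the index l ranges over bool, [false] standing for the first
   process (l = 1) and [true] for the second one (l = 2).  The i-th individual
   of a generation is numbered from 0. *)

Section Probability.
Context {d d' : measure_display} {T : measurableType d} {E : measurableType d'}
  {R : realType} (P : probability T R).
Local Open Scope ereal_scope.

Definition mutually_independent (X : nat -> {RV P >-> E}) : Prop :=
  forall (s : seq nat) (B : nat -> set E),
    uniq s -> (forall n, measurable (B n)) ->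
    P [set w | forall n, n \in s -> B n (X n w)] =
    \prod_(n <- s) P (X n @^-1` B n).

Definition identically_distributed (X : nat -> {RV P >-> E}) : Prop :=
  forall n (B : set E), measurable B ->
    distribution P (X n) B = distribution P (X 0%N) B.

Definition sigma_generated (X : nat -> {RV P >-> E}) : set_system T :=
  <<s \bigcup_n preimage_set_system [set: T] (X n) measurable >>.

(* [g] is a version of the conditional probability P(A | G) *)
Definition is_cond_prob (G : set_system T) (A : set T) (g : T -> \bar R) :
    Prop :=
  (forall B : set (\bar R), measurable B -> G (g @^-1` B)) /\
  (forall D, G D -> P (D `&` A) = \int[P]_(w in D) g w).

End Probability.

Definition std_normal_cdf {R : realType} (x : R) : R :=
  fine (normal_prob 0 1 `]-oo, x]).

Section BranchingPair.
Context {d : measure_display} {T : measurableType d} {R : realType}.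
Context (P : probability T R).
Context (law : R.-pker R ~> nat) (xi : nat -> {RV P >-> (R * R)%type}).
Context (X : bool -> nat -> nat -> {RV P >-> nat}).

Definition env (l : bool) (n : nat) (w : T) : R :=
  if l then (xi n w).2 else (xi n w).1.

Definition iid_environment : Prop :=
  mutually_independent xi /\ identically_distributed xi.

(* Given the whole environment, the X l n i are independent (jointly in l, n
   and i), and X l n i has law p(xi_{l,n}).  Since Z l k is a function of the
   X l n i with n < k, this contains the independence of generation n from the
   two processes up to time n. *)
Definition offspring_given_environment : Prop :=
  forall (s : seq (bool * nat * nat)) (B : bool * nat * nat -> set nat),
    uniq s ->
    is_cond_prob P (sigma_generated xi)
      [set w | forall j, j \in s -> B j (X j.1.1 j.1.2 j.2 w)]
      (fun w => \prod_(j <- s) law (env j.1.1 j.1.2 w) (B j))%E.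

Fixpoint Z (l : bool) (n : nat) (w : T) : nat :=
  if n is n'.+1 then (\sum_(i < Z l n' w) X l n' i w)%N else 1%N.

Definition mean_offspring (x : R) : \bar R :=
  (\sum_(0 <= k <oo) k%:R%:E * law x [set k])%E.

(* Meaningful where [mean_offspring] is finite. *)
Definition m (l : bool) (n : nat) (w : T) : R :=
  fine (mean_offspring (env l n w)).

Definition M (l : bool) (n : nat) (w : T) : R := ln (m l n w).

Definition mu (l : bool) : R := fine 'E_P[M l 0].

Definition sigma (l : bool) : R := Num.sqrt (fine 'V_P[M l 0]).

Definition rho : R :=
  fine (covariance P (M false 0) (M true 0)) / (sigma false * sigma true).

Definition V (k n : nat) : R :=
  Num.sqrt (n%:R^-1 * sigma false ^+ 2 + k%:R^-1 * sigma true ^+ 2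
    - 2 * rho * sigma false * sigma true * ((minn k n)%:R / (k%:R * n%:R))).

(* R_{k,n}; the first process is taken at time n, the second at time k. *)
Definition Rstat (k n : nat) (w : T) : R :=
  (n%:R^-1 * ln (Z false n w)%:R - k%:R^-1 * ln (Z true k w)%:R
    - (mu false - mu true)) / V k n.

(* Finiteness of m_{l,0} is implicit in sigma_l < oo, as ln oo = oo; it has to
   be spelled out because [m] is real-valued. *)
Definition standing_assumptions : Prop :=
  [/\ forall l, {ae P, forall w, mean_offspring (env l 0 w) < +oo}%E,
      forall l, (0 < 'V_P[M l 0] < +oo)%E,
      ('E_P[(fun w =>
          (Z false 1 w)%:R / m false 0 w * Num.max (ln (Z false 1 w)%:R) 0 +
          (Z true 1 w)%:R / m true 0 w * Num.max (ln (Z true 1 w)%:R) 0)%R]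
        < +oo)%E,
      forall l, {ae P, forall w, law (env l 0 w) [set 0%N] = 0%E} &
      (-1 <= rho < 1) \/ (rho = 1 /\ sigma false != sigma true)].

End BranchingPair.

(* Main.v *)
Require Import Defs.
From HB Require Import structures.
From mathcomp Require Import all_boot all_order all_algebra.
From mathcomp Require Import all_classical all_reals all_analysis.
From mathcomp Require Import measurable_realfun ring lra.
Import Order.TTheory GRing.Theory Num.Theory.
Import numFieldNormedType.Exports.
Local Open Scope classical_set_scope.
Local Open Scope ring_scope.
Set Implicit Arguments.
Unset Strict Implicit.
Unset Printing Implicit Defensive.

(** The logarithm of a population is a random walk plus a remainder that stays
bounded in L^2: with [W_n = Z_n / (m_0 ... m_{n-1})],
  [ln Z_n = \sum_(i < n) M_i + ln W_n].
Hence the normalised statistic is [\sum_i zeta_i + D], where, for the first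
process at time [n], the second at time [k] and the standard deviation [V],
  [zeta_i = (M_{1,i} - mu_1) 1_{i < n} / (n V) - (M_{2,i} - mu_2) 1_{i < k} / (k V)],
  [D = ln W_{1,n} / (n V) - ln W_{2,k} / (k V)].
The [zeta_i] are independent and centred, and their variances add up to one by
the choice of [V]. Since [sigma_1^2 + sigma_2^2 - 2 rho sigma_1 sigma_2 > 0]
([difference_variance_gt0]), [V^2] is at least a constant over [N], the minimum
of [k] and [n] ([variance_lower]). All weights are therefore O(N^(-1/2)), the sum
of the moments of order [2 + delta] of the [zeta_i] is O(N^(-delta/2)), and [D]
has L^2 norm O(N^(-1/2)).

The remainder depends on the [zeta_i]. What saves the argument is that freezing
[ln W] at generation [i] yields a variable that is independent of [zeta_i] and
differs from [D] by O(N^(-1/2) s^i) in L^2 for some [s < 1], which is summable.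
A Berry--Esseen theorem for sums perturbed in this way
([nonlinear_berry_esseen]) bounds the error at [x >= 0] by a multiple of
[(beta + b + b^2) / (1 + x^2)], where [beta] is the sum of the moments of order
[2 + delta] and [b] bounds both the L^2 norm of the perturbation and the total
cost of freezing it. Negative [x] follow by exchanging the signs, and
[1 / (1 + x^2)] is at most twice [1 / (1 + |x|^(1 + delta'))].

That theorem is proved by Stein's method. After truncation at one the summands
have exponential moments, and the solution of the Stein equation for the half
line beyond [x] is of size [exp (- x)] in the corresponding sense; the jump of
its derivative at [x] and the perturbation are both controlled by a
concentration inequality ([concentration]), where an exponential weight in the
test function yields the decay in [x]. The summands beyond one contribute at
most the sum of their moments of order [2 + delta] times O(1 / (1 + x^2)).

For the L^2 bound on [ln W] ([lnW_increment]), given generation [i] the ratio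
[W_{i+1} / W_i] is the mean of [Z_i] independent variables of mean one. The von
Bahr--Esseen inequality bounds its centred moment of order [p] by a multiple of
[E Z_i^(1 - p)] ([ratio_moment]), and this is geometrically small because
[E (1 / Z_i)] is at most [theta^i] with [theta < 1] ([inverse_moment],
[inverse_mean_lt1]). A ratio above [1/2] has squared logarithm at most four
times that centred power; a ratio below [1/2] is unlikely, and its logarithm is
at least [- M_i] because every individual has a descendant. *)

(** * Expectations of real random variables *)

Definition Ex d (T : measurableType d) (R : realType) (P : probability T R)
  (f : T -> R) : R := \int[P]_w f w.

Section Expectation.
Context d (T : measurableType d) (R : realType) (P : probability T R).
Implicit Types (f g : T -> R) (A : set T).
Local Notation E := (Ex P).
Local Notation mfun f := (measurable_fun [set: T] f).

Definition L1 f := P.-integrable [set: T] (EFin \o f).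

(** A class stable under all the operations applied to truncated sums, so that
integrability is settled by syntax. *)
Definition bm f := mfun f /\ exists c : R, forall w, `|f w| <= c.

Lemma bmm f : bm f -> mfun f. Proof. by case. Qed.

Lemma L1m f : L1 f -> mfun f.
Proof. by move=> /measurable_int /measurable_EFinP. Qed.

Lemma bmL1 f : bm f -> L1 f.
Proof.
move=> [mf [c fc]]; apply: measurable_bounded_integrable => //.
  by rewrite /= probability_setT ltry.
exists c; split; first exact: num_real.
by move=> r cr w _; exact: le_trans (fc w) (ltW cr).
Qed.

Lemma bmcst (c : R) : bm (fun=> c).
Proof. by split => //; exists `|c|. Qed.

Lemma bmD f g : bm f -> bm g -> bm (fun w => f w + g w).
Proof.
move=> [mf [c fc]] [mg [e ge]]; split; first exact: measurable_funD.
exists (c + e) => w; apply: (le_trans (ler_normD _ _)); exact: lerD.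
Qed.

Lemma bmN f : bm f -> bm (fun w => - f w).
Proof.
move=> [mf [c fc]]; split; first exact: measurable_funN.
by exists c => w; rewrite normrN.
Qed.

Lemma bmM f g : bm f -> bm g -> bm (fun w => f w * g w).
Proof.
move=> [mf [c fc]] [mg [e ge]]; split; first exact: measurable_funM.
by exists (c * e) => w; rewrite normrM ler_pM.
Qed.

Lemma bmX f n : bm f -> bm (fun w => f w ^+ n).
Proof.
move=> bf; elim: n => [|n IH]; first by under eq_fun do rewrite expr0; exact: bmcst.
by under eq_fun do rewrite exprS; exact: bmM.
Qed.

Lemma bm_norm f : bm f -> bm (fun w => `|f w|).
Proof.
move=> [mf [c fc]]; split; first exact: (measurableT_comp (@normr_measurable _ _)).
by exists c => w; rewrite normr_id.
Qed.

Lemma bm_exp f : bm f -> bm (fun w => expR (f w)).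
Proof.
move=> [mf [c fc]]; split; first exact: measurableT_comp.
exists (expR c) => w; rewrite ger0_norm ?expR_ge0// ler_expR.
by apply: le_trans (fc w); exact: ler_norm.
Qed.

Lemma bm_max f g : bm f -> bm g -> bm (fun w => Num.max (f w) (g w)).
Proof.
move=> [mf [c fc]] [mg [e ge]]; split; first exact: measurable_maxr.
exists (c + e) => w.
have c0 := le_trans (normr_ge0 _) (fc w).
have e0 := le_trans (normr_ge0 _) (ge w).
case: (leP (f w) (g w)) => _; first by apply: (le_trans (ge w)); rewrite lerDr.
by apply: (le_trans (fc w)); rewrite lerDl.
Qed.

Lemma bm_min f g : bm f -> bm g -> bm (fun w => Num.min (f w) (g w)).
Proof.
move=> [mf [c fc]] [mg [e ge]]; split; first exact: measurable_minr.
exists (c + e) => w.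
have c0 := le_trans (normr_ge0 _) (fc w).
have e0 := le_trans (normr_ge0 _) (ge w).
case: (leP (f w) (g w)) => _; first by apply: (le_trans (fc w)); rewrite lerDl.
by apply: (le_trans (ge w)); rewrite lerDr.
Qed.

Lemma bm_indic A : measurable A -> bm (fun w => \1_A w).
Proof.
move=> mA; split; first exact: measurable_indic.
by exists 1 => w; rewrite indicE; case: (_ \in _); rewrite ?normr1 ?normr0.
Qed.

Lemma bm_sum (I : Type) (s : seq I) (Q : pred I) (F : I -> T -> R) :
  (forall i, Q i -> bm (F i)) -> bm (fun w => \sum_(i <- s | Q i) F i w).
Proof.
move=> bF; elim: s => [|i s IH].
  by under eq_fun do rewrite big_nil; exact: bmcst.
under eq_fun do rewrite big_cons.
case: (boolP (Q i)) => // Qi; exact: bmD (bF _ Qi) IH.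
Qed.

Ltac bmt := by repeat first [ assumption | exact: bmcst | apply: bm_exp | apply: bmN
  | apply: bmX | apply: bm_norm | apply: bm_max | apply: bm_min | apply: bmM
  | apply: bmD | apply: bm_sum => ? ? | exact: bm_indic ].

Lemma L1D f g : L1 f -> L1 g -> L1 (fun w => f w + g w).
Proof. by move=> f1 g1; exact: (integrableD measurableT f1 g1). Qed.

Lemma L1Z (c : R) f : L1 f -> L1 (fun w => c * f w).
Proof. by move=> f1; exact: (integrableZl measurableT c f1). Qed.

Lemma L1N f : L1 f -> L1 (fun w => - f w).
Proof. by move=> f1; under eq_fun do rewrite -mulN1r; exact: L1Z. Qed.

Lemma L1_sum (I : Type) (s : seq I) (Q : pred I) (F : I -> T -> R) :
  (forall i, Q i -> L1 (F i)) -> L1 (fun w => \sum_(i <- s | Q i) F i w).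
Proof.
move=> bF; elim: s => [|i s IH].
  by under eq_fun do rewrite big_nil; exact/bmL1/bmcst.
under eq_fun do rewrite big_cons.
case: (boolP (Q i)) => // Qi; exact: L1D (bF _ Qi) IH.
Qed.

Lemma L1_le f g : mfun f -> (forall w, `|f w| <= g w) -> L1 g -> L1 f.
Proof.
move=> mf fg g1; apply: le_integrable g1 => //; first exact/measurable_EFinP.
move=> w _ /=; rewrite lee_fin; apply: (le_trans (fg w)); exact: ler_norm.
Qed.

Lemma L1_norm f : L1 f -> L1 (fun w => `|f w|).
Proof. exact: integrable_norm. Qed.

Lemma ExE f : L1 f -> (\int[P]_w (f w)%:E)%E = (E f)%:E.
Proof. by move=> f1; rewrite /Ex /Rintegral fineK//; exact: integrable_fin_num. Qed.

Lemma ExD f g : L1 f -> L1 g -> E (fun w => f w + g w) = E f + E g.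
Proof. by move=> f1 g1; rewrite /Ex RintegralD. Qed.

Lemma ExZ c f : L1 f -> E (fun w => c * f w) = c * E f.
Proof. by move=> f1; rewrite /Ex RintegralZl. Qed.

Lemma ExN f : L1 f -> E (fun w => - f w) = - E f.
Proof.
move=> f1; rewrite -mulN1r -ExZ//; congr E; apply/funext => w.
by rewrite mulN1r.
Qed.

Lemma ExB f g : L1 f -> L1 g -> E (fun w => f w - g w) = E f - E g.
Proof. by move=> f1 g1; rewrite ExD ?ExN//; exact: L1N. Qed.

Lemma Excst c : E (fun=> c) = c.
Proof. by rewrite /Ex Rintegral_cst//= probability_setT mulr1. Qed.

Lemma Ex_sum (I : Type) (s : seq I) (Q : pred I) (F : I -> T -> R) :
  (forall i, Q i -> L1 (F i)) ->
  E (fun w => \sum_(i <- s | Q i) F i w) = \sum_(i <- s | Q i) E (F i).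
Proof.
move=> bF; elim: s => [|i s IH].
  by under eq_fun do rewrite big_nil; rewrite Excst big_nil.
under eq_fun do rewrite big_cons.
rewrite big_cons; case: (boolP (Q i)) => // Qi; rewrite ExD ?IH//; first exact: bF.
exact: L1_sum.
Qed.

Lemma Ex_le f g : L1 f -> L1 g -> (forall w, f w <= g w) -> E f <= E g.
Proof. by move=> f1 g1 fg; apply: le_Rintegral. Qed.

Lemma Ex_ge0 f : (forall w, 0 <= f w) -> 0 <= E f.
Proof. by move=> f0; apply: Rintegral_ge0. Qed.

Lemma Ex_norm f : L1 f -> `|E f| <= E (fun w => `|f w|).
Proof. by move=> f1; apply: le_normr_Rintegral. Qed.

Lemma Ex_indic A : measurable A -> E (fun w => \1_A w) = fine (P A).
Proof. by move=> mA; rewrite /Ex /Rintegral integral_indic// setIT. Qed.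

(** Young's inequality [f g <= v / (2 u) f^2 + u / (2 v) g^2] integrates to [u v]
when [u] and [v] bound the two norms. Only bounds on the norms occur, so no root
of an expectation is ever taken. *)
Lemma cauchy_schwarz f g a b : L1 (fun w => f w ^+ 2) -> L1 (fun w => g w ^+ 2) ->
  L1 (fun w => f w * g w) -> 0 <= a -> 0 <= b ->
  E (fun w => f w ^+ 2) <= a ^+ 2 -> E (fun w => g w ^+ 2) <= b ^+ 2 ->
  E (fun w => f w * g w) <= a * b.
Proof.
move=> f2 g2 fg a0 b0 fa gb; apply/ler_addgt0Pr => e e0.
have young (u v : R) : 0 < u -> 0 < v -> E (fun w => f w ^+ 2) <= u ^+ 2 ->
    E (fun w => g w ^+ 2) <= v ^+ 2 -> E (fun w => f w * g w) <= u * v.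
  move=> u0 v0 fu gv.
  have -> : u * v = v / (2 * u) * u ^+ 2 + u / (2 * v) * v ^+ 2.
    by field; rewrite !gt_eqF.
  apply: (@le_trans _ _ (v / (2 * u) * E (fun w => f w ^+ 2) +
                         u / (2 * v) * E (fun w => g w ^+ 2))).
    rewrite -!ExZ// -ExD; [|exact: L1Z..].
    apply: Ex_le => //; first by apply: L1D; exact: L1Z.
    move=> w; rewrite -subr_ge0.
    have -> : v / (2 * u) * f w ^+ 2 + u / (2 * v) * g w ^+ 2 - f w * g w =
      (v * f w - u * g w) ^+ 2 / (2 * u * v) by field; rewrite !gt_eqF.
    by rewrite divr_ge0 ?sqr_ge0// !mulr_ge0 ?ltW.
  by apply: lerD; rewrite ler_wpM2l// divr_ge0 ?mulr_ge0 ?ltW.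
(* Young's inequality divides by the two bounds, which may vanish *)
pose t := Num.min 1 (e / (a + b + 1)).
have ab0 : 0 < a + b + 1 by lra.
have t0 : 0 < t by rewrite lt_min ltr01 divr_gt0.
have t1 : t <= 1 by rewrite ge_min lexx.
have te : t * (a + b + 1) <= e by rewrite -ler_pdivlMr// ge_min lexx orbT.
have := @young (a + t) (b + t); rewrite !ltr_wpDl// => /(_ isT isT) H.
apply: le_trans (H _ _) _.
- by apply: (le_trans fa); rewrite lerXn2r ?nnegrE ?lerDl//; lra.
- by apply: (le_trans gb); rewrite lerXn2r ?nnegrE ?lerDl//; lra.
- nra.
Qed.

Lemma measurable_le_set f g : mfun f -> mfun g -> measurable [set w | f w <= g w].
Proof.
move=> mf mg; rewrite -[X in measurable X]setTI.
exact: (measurable_fun_ler mf mg measurableT (Y := [set true]) I).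
Qed.

Lemma measurable_lt_set f g : mfun f -> mfun g -> measurable [set w | f w < g w].
Proof.
move=> mf mg; rewrite -[X in measurable X]setTI.
exact: (measurable_fun_ltr mf mg measurableT (Y := [set true]) I).
Qed.

Lemma Ex_var_le f : bm f -> E (fun w => (f w - E f) ^+ 2) <= E (fun w => f w ^+ 2).
Proof.
move=> bf.
have -> : (fun w => (f w - E f) ^+ 2) =
          (fun w => f w ^+ 2 - (2 * E f * f w - E f ^+ 2)).
  by apply/funext => w; ring.
rewrite ExB; [|by apply: bmL1; bmt..].
rewrite ExB; [|by apply: bmL1; bmt..].
rewrite ExZ; last exact: bmL1.
rewrite Excst; have := sqr_ge0 (E f); nra.
Qed.

Lemma markovE f A c : measurable A -> L1 f -> (forall w, 0 <= f w) ->
  0 <= c -> (forall w, A w -> 1 <= c * f w) -> fine (P A) <= c * E f.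
Proof.
move=> mA f1 f0 c0 Af; rewrite -Ex_indic// -ExZ//; apply: Ex_le.
- exact/bmL1/bm_indic.
- exact: L1Z.
move=> w; rewrite indicE; case: (boolP (w \in A)) => [|_].
  by rewrite inE => /Af.
by rewrite mulr_ge0.
Qed.

End Expectation.

#[global] Hint Resolve bmcst : core.
Ltac bmt := by repeat first [ assumption | exact: bmcst | apply: bm_exp | apply: bmN
  | apply: bmX | apply: bm_norm | apply: bm_max | apply: bm_min | apply: bmM
  | apply: bmD | apply: bm_sum => ? ? | exact: bm_indic ].

(** * Independence from a sigma-algebra *)

Section Independence.
Context d (T : measurableType d) (R : realType) (P : probability T R).
Local Notation E := (Ex P).
Local Notation "G .-meas f" := (measurable_fun [set: g_sigma_algebraType G] (f : g_sigma_algebraType G -> _)) (at level 2).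

Definition sigma_indep (G : set_system T) d' (T' : measurableType d') (U : T -> T') :=
  forall A B, <<s G >> A -> measurable B ->
    P (A `&` U @^-1` B) = (P A * P (U @^-1` B))%E.

Section fixed_sigma.
Context (G : set_system T) d' (T' : measurableType d') (U : T -> T').
Hypotheses (mG : G `<=` measurable) (mU : measurable_fun [set: T] U).
Hypothesis GU : sigma_indep G U.

Lemma sub_sigma : <<s G >> `<=` measurable.
Proof. exact: smallest_sub (@sigma_algebra_measurable _ T) mG. Qed.

Lemma meas_sub d2 (T2 : measurableType d2) (f : T -> T2) :
  G.-meas f -> measurable_fun [set: T] f.
Proof.
move=> mf _ B mB; apply: sub_sigma.
exact: (mf measurableT _ mB).
Qed.

Local Open Scope ereal_scope.

(** The joint law of [w] and [U w] is the product of the two marginals by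
independence, so that Fubini's theorem freezes the second variable. *)
Lemma indep_integral (h : g_sigma_algebraType G * T' -> \bar R) :
  measurable_fun [set: g_sigma_algebraType G * T'] h -> (forall u, 0 <= h u) ->
  \int[P]_w h (w, U w) = \int[P]_v \int[P]_w h (w, U v).
Proof.
move=> mh h0.
have mid : measurable_fun [set: T] (idfun : T -> g_sigma_algebraType G).
  by move=> _ B mB; apply: sub_sigma; rewrite setTI preimage_id.
pose X1 : {mfun T >-> g_sigma_algebraType G} := mfun_Sub (mem_set mid).
pose X2 : {mfun T >-> T'} := mfun_Sub (mem_set mU).
have mp : measurable_fun [set: T] (fun w => (w, U w) : g_sigma_algebraType G * T').
  exact: (measurable_fun_pair mid mU).
pose X3 : {mfun T >-> (g_sigma_algebraType G * T')%type} := mfun_Sub (mem_set mp).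
rewrite -[LHS](@ge0_integral_distribution _ _ _ _ _ P X3)//.
rewrite (@eq_measure_integral _ _ _ [set: _] (distribution P X1 \x distribution P X2)%E).
  rewrite fubini_tonelli2//.
  rewrite (@ge0_integral_distribution _ _ _ _ _ P X2).
  - apply: eq_integral => w _.
    rewrite /= /fubini_G (@ge0_integral_distribution _ _ _ _ _ P X1)//.
    exact: (measurableT_comp mh (pair2_measurable _)).
  - exact: measurable_fun_fubini_tonelli_G.
  - by move=> y; apply: integral_ge0.
move=> A mA _; symmetry.
by apply: (product_measure_unique (m1 := distribution P X1) (m2 := distribution P X2)
  (m' := distribution P X3)) => // A1 A2 mA1 mA2; exact: GU.
Qed.

Lemma measurable_freeze (h : g_sigma_algebraType G * T' -> \bar R) :
  measurable_fun [set: g_sigma_algebraType G * T'] h -> (forall u, 0 <= h u) ->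
  measurable_fun [set: T'] (fun u => \int[P]_w h (w, u)).
Proof.
move=> mh h0.
have mid : measurable_fun [set: T] (idfun : T -> g_sigma_algebraType G).
  by move=> _ B mB; apply: sub_sigma; rewrite setTI preimage_id.
pose X1 : {mfun T >-> g_sigma_algebraType G} := mfun_Sub (mem_set mid).
rewrite (_ : (fun u => _) = fubini_G (distribution P X1) h).
  exact: measurable_fun_fubini_tonelli_G.
apply/funext => u; rewrite /fubini_G (@ge0_integral_distribution _ _ _ _ _ P X1)//.
exact: (measurableT_comp mh (pair2_measurable _)).
Qed.

Lemma indep_mul_ge0 (f : T -> R) (g : T' -> R) : G.-meas f ->
  measurable_fun [set: T'] g -> (forall w, 0 <= f w)%R -> (forall u, 0 <= g u)%R ->
  \int[P]_w (f w * g (U w))%:E = (\int[P]_w (f w)%:E) * \int[P]_w (g (U w))%:E.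
Proof.
move=> mf mg f0 g0.
rewrite (@indep_integral (fun u => (f u.1 * g u.2)%:E)); last 2 first.
- apply/measurable_EFinP; apply: measurable_funM.
    by apply: (measurableT_comp mf); exact: measurable_fst.
  by apply: (measurableT_comp mg); exact: measurable_snd.
- by move=> u; rewrite lee_fin mulr_ge0.
have mf' : measurable_fun [set: T] (fun w => (f w)%:E).
  by apply/measurable_EFinP; exact: meas_sub.
transitivity (\int[P]_v ((\int[P]_w (f w)%:E) * (g (U v))%:E)).
  apply: eq_integral => v _; rewrite -ge0_integralZr ?lee_fin// => w _; rewrite lee_fin//.
by rewrite ge0_integralZl ?integral_ge0//;
  [apply/measurable_EFinP; exact: measurableT_comp|move=> *; rewrite lee_fin..].
Qed.

Local Close Scope ereal_scope.

Lemma indep_mul (f : T -> R) (g : T' -> R) : G.-meas f ->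
  measurable_fun [set: T'] g -> L1 P f -> L1 P (fun w => g (U w)) ->
  L1 P (fun w => f w * g (U w)) /\
  E (fun w => f w * g (U w)) = E f * E (fun w => g (U w)).
Proof.
move=> mf mg f1 g1.
have pos (f' : T -> R) (g' : T' -> R) : G.-meas f' ->
  measurable_fun [set: T'] g' -> L1 P f' -> L1 P (fun w => g' (U w)) ->
  (forall w, 0 <= f' w) -> (forall w, 0 <= g' w) ->
  L1 P (fun w => f' w * g' (U w)) /\
  E (fun w => f' w * g' (U w)) = E f' * E (fun w => g' (U w)).
  move=> mf' mg' f'1 g'1 f'0 g'0.
  have H := indep_mul_ge0 mf' mg' f'0 g'0.
  rewrite (ExE f'1) (ExE g'1) -EFinM in H; split; last by rewrite {1}/Ex /Rintegral H.
  apply/integrableP; split.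
    apply/measurable_EFinP; apply: measurable_funM; first exact: meas_sub.
    exact: measurableT_comp.
  under eq_integral do rewrite /= ger0_norm ?mulr_ge0//.
  by rewrite H ltry.
pose fp := f^\+; pose fm := f^\-; pose gp := g^\+; pose gm := g^\-.
have ff w : f w = fp w - fm w by rewrite -[in LHS](funrposBneg f).
have gg w : g w = gp w - gm w by rewrite -[in LHS](funrposBneg g).
have [fp1 fm1] : L1 P fp /\ L1 P fm.
  by split; [exact: integrable_funrpos|exact: integrable_funrneg].
have [gp1 gm1] : L1 P (gp \o U) /\ L1 P (gm \o U).
  by split; [exact: (integrable_funrpos measurableT g1)|
             exact: (integrable_funrneg measurableT g1)].
have mfp : G.-meas fp by exact: measurable_funrpos.
have mfm : G.-meas fm by exact: measurable_funrneg.
have mgp : measurable_fun setT gp by exact: measurable_funrpos.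
have mgm : measurable_fun setT gm by exact: measurable_funrneg.
have fp0 w : 0 <= fp w by exact: funrpos_ge0.
have fm0 w : 0 <= fm w by exact: funrneg_ge0.
have gp0 w : 0 <= gp w by exact: funrpos_ge0.
have gm0 w : 0 <= gm w by exact: funrneg_ge0.
have [pp1 pp] := pos _ _ mfp mgp fp1 gp1 fp0 gp0.
have [pm1 pm] := pos _ _ mfp mgm fp1 gm1 fp0 gm0.
have [mp1 mp] := pos _ _ mfm mgp fm1 gp1 fm0 gp0.
have [mm1 mm] := pos _ _ mfm mgm fm1 gm1 fm0 gm0.
have -> : (fun w => f w * g (U w)) = (fun w => (fp w * gp (U w) + fm w * gm (U w))
    - (fp w * gm (U w) + fm w * gp (U w))).
  by apply/funext => w; rewrite ff gg; ring.
have -> : f = (fun w => fp w - fm w) by apply/funext => w; exact: ff.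
have -> : (fun w => g (U w)) = (fun w => gp (U w) - gm (U w)).
  by apply/funext => w; exact: gg.
split; first by apply: L1D; [exact: L1D|apply: L1N; exact: L1D].
rewrite !ExB ?ExD ?pp ?pm ?mp ?mm//; [ring|exact: L1D..].
Qed.

(** A bound that holds for each frozen value [u] integrates to a bound at [u = U].
It serves to apply a concentration inequality with a random radius. *)
Lemma indep_freeze (h : T -> T' -> R) (k : T' -> R) c :
  measurable_fun [set: g_sigma_algebraType G * T'] (fun u => h u.1 u.2) ->
  (forall w u, 0 <= h w u <= c) -> L1 P (fun v => k (U v)) ->
  (forall u, E (fun w => h w u) <= k u) ->
  L1 P (fun w => h w (U w)) /\ E (fun w => h w (U w)) <= E (fun v => k (U v)).
Proof.
move=> mh h0c k1 hk.
have mhU : measurable_fun [set: T] (fun w => h w (U w)).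
  have mp : measurable_fun [set: T] (fun w => (w, U w) : g_sigma_algebraType G * T').
    apply: measurable_fun_pair => //.
    by move=> _ B mB; apply: sub_sigma; rewrite setTI preimage_id.
  exact: (measurableT_comp mh mp).
have hU1 : L1 P (fun w => h w (U w)).
  apply/bmL1; split=> //; exists c => w; have /andP[h0 hc] := h0c w (U w).
  by rewrite ger0_norm.
have h1 u : L1 P (fun w => h w u).
  apply/bmL1; split; last first.
    exists c => w; have /andP[h0 hc] := h0c w u.
    by rewrite ger0_norm.
  apply: (@meas_sub _ _ (fun w => h w u)).
  exact: (measurableT_comp mh (pair2_measurable u)).
split=> //.
rewrite -lee_fin -!ExE//.
rewrite (@indep_integral (fun u => (h u.1 u.2)%:E)); last 2 first.
- exact/measurable_EFinP.
- by move=> u; rewrite lee_fin; case/andP: (h0c u.1 u.2).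
apply: ge0_le_integral => //=.
- by move=> v _; apply: integral_ge0 => w _; rewrite lee_fin; case/andP: (h0c w (U v)).
- have := @measurable_freeze (fun u => (h u.1 u.2)%:E) _ _.
  move=> /(_ (proj2 (measurable_EFinP _ _) mh)) mf; apply: (measurableT_comp (mf _) mU).
  by move=> u; rewrite lee_fin; case/andP: (h0c u.1 u.2).
- by apply/measurable_EFinP; exact: L1m k1.
- by move=> v _; rewrite ExE// lee_fin.
Qed.

End fixed_sigma.
End Independence.

(** * Sums of independent variables *)

Section ExpIneq.
Context (R : realType).
Implicit Types x y : R.

Lemma expR_le_quad y : expR y <= 1 + y + y ^+ 2 * expR `|y|.
Proof.
have h1 : expR y - 1 <= y * expR y.
  have := expR_ge1Dx (- y); rewrite expRN => h.
  have e0 := expR_gt0 y.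
  have : (1 + - y) * expR y <= 1 by rewrite -ler_pdivlMr// div1r.
  nra.
have h2 := expR_ge1Dx y.
case: (leP 0 y) => y0.
  rewrite ger0_norm//; nra.
rewrite ltr0_norm//.
have : 1 <= expR (- y) by rewrite -expR0 ler_expR; lra.
nra.
Qed.

Lemma sqr_le_expR y : y ^+ 2 <= 4 * (expR y + expR (- y)).
Proof.
have aux x : 0 <= x -> x ^+ 2 <= 4 * expR x.
  move=> x0; have -> : x = x / 2 + x / 2 by field.
  rewrite expRD; have := expR_ge1Dx (x / 2); nra.
have [y0|y0] := leP 0 y.
  have := aux _ y0; have := expR_ge0 (- y); lra.
have := aux (- y); rewrite sqrrN; have := expR_ge0 y; lra.
Qed.

End ExpIneq.

Section Families.
Context d (T : measurableType d) (R : realType) (P : probability T R).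
Local Notation E := (Ex P).
Local Notation "G .-meas f" := (measurable_fun [set: g_sigma_algebraType G] (f : g_sigma_algebraType G -> _)) (at level 2).

(** Independence in the form used by leave-one-out arguments. The sigma-algebra
generated by [G i] makes all [z j] but the [i]-th measurable; it may be larger
than what these variables generate, which leaves room for a perturbation that
involves additional randomness. *)
Definition indep_fam K (G : nat -> set_system T) (z : nat -> T -> R) :=
  forall i, (i < K)%N -> [/\ G i `<=` measurable, measurable_fun [set: T] (z i),
    sigma_indep P (G i) (z i) &
    forall j, (j < K)%N -> j != i -> (G i).-meas (z j)].

Lemma indep_fam_comp K G z (t : nat -> R -> R) :
  (forall j, measurable_fun [set: R] (t j)) -> indep_fam K G z ->
  indep_fam K G (fun j w => t j (z j w)).
Proof.
move=> mt iz i iK; have [Gm mz zi Gz] := iz _ iK; split => //.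
- exact: measurableT_comp.
- move=> A B sA mB; rewrite -[X in P (A `&` X)]/(z i @^-1` (t i @^-1` B)) zi//.
  by rewrite -[X in measurable X]setTI; exact: mt.
- by move=> j jK ji; exact: measurableT_comp (mt j) (Gz _ jK ji).
Qed.

Section sums.
Context (K : nat) (G : nat -> set_system T) (z : nat -> T -> R).
Hypothesis iz : indep_fam K G z.

Lemma meas_partial_sum k : (k < K)%N -> (G k).-meas (fun w => \sum_(i < k) z i w).
Proof.
move=> kK; apply: measurable_sum => i.
have [_ _ _] := iz kK; apply; first exact: ltn_trans kK.
by rewrite ltn_eqF.
Qed.

Lemma meas_sum_rem i : (i < K)%N -> (G i).-meas (fun w => \sum_(j < K) z j w - z i w).
Proof.
move=> iK; have [_ _ _ Gz] := iz iK.
have -> : (fun w => \sum_(j < K) z j w - z i w) =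
          (fun w => \sum_(j < K | j != Ordinal iK) z j w).
  by apply/funext => w; rewrite (bigD1 (Ordinal iK))//= addrAC subrr add0r.
rewrite (_ : (fun w => _) = (fun w => \sum_(j < K) (if j != Ordinal iK then z j w else 0))).
  apply: measurable_sum => j.
  by case: (boolP (j != Ordinal iK)) => ji; [exact: Gz|exact: measurable_cst].
by apply/funext => w; rewrite big_mkcond.
Qed.

Lemma var_sum : (forall i, (i < K)%N -> L1 P (z i)) ->
  (forall i, (i < K)%N -> L1 P (fun w => z i w ^+ 2)) ->
  (forall i, (i < K)%N -> E (z i) = 0) ->
  [/\ L1 P (fun w => \sum_(i < K) z i w),
      L1 P (fun w => (\sum_(i < K) z i w) ^+ 2) &
   E (fun w => (\sum_(i < K) z i w) ^+ 2) = \sum_(i < K) E (fun w => z i w ^+ 2)].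
Proof.
move=> z1 z2 z0.
suff : forall k, (k <= K)%N -> [/\ L1 P (fun w => \sum_(i < k) z i w),
      L1 P (fun w => (\sum_(i < k) z i w) ^+ 2) &
   E (fun w => (\sum_(i < k) z i w) ^+ 2) = \sum_(i < k) E (fun w => z i w ^+ 2)].
  exact.
elim=> [_|k IH kK].
  split; last first.
  - by rewrite big_ord0; under eq_fun do rewrite big_ord0 expr0n; rewrite Excst.
  - by under eq_fun do rewrite big_ord0 expr0n; exact: bmL1.
  - by under eq_fun do rewrite big_ord0; exact: bmL1.
have [S1 S2 SE] := IH (ltnW kK).
have [Gm mz zi Gz] := iz kK.
have [c1 ce] := indep_mul Gm mz zi (meas_partial_sum kK) (@measurable_id _ _ setT) S1 (z1 _ kK).
rewrite /= (z0 _ kK) mulr0 in ce.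
have sq w : (\sum_(i < k.+1) z i w) ^+ 2 =
  (\sum_(i < k) z i w) ^+ 2 + (2 * ((\sum_(i < k) z i w) * z k w) + z k w ^+ 2).
  by rewrite big_ord_recr/=; ring.
have L : L1 P (fun w => 2 * ((\sum_(i < k) z i w) * z k w) + z k w ^+ 2).
  by apply: L1D; [exact: L1Z|exact: z2].
split.
- under eq_fun do rewrite big_ord_recr/=; apply: L1D => //; exact: z1.
- by under eq_fun do rewrite sq; exact: L1D.
- under eq_fun do rewrite sq.
  rewrite ExD// ExD//; [|exact: L1Z|exact: z2].
  by rewrite ExZ// ce SE mulr0 add0r big_ord_recr.
Qed.

(** Each factor of [E (exp (l S))] is at most
[1 + l E z_i + l^2 exp |l| E z_i^2], and a product of such terms is at most the
exponential of their sum: the number of summands does not matter. *)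
Lemma exp_moment (l : R) : (forall i w, (i < K)%N -> `|z i w| <= 1) ->
  \sum_(i < K) `|E (z i)| <= 1 -> \sum_(i < K) E (fun w => z i w ^+ 2) <= 1 ->
  E (fun w => expR (l * \sum_(i < K) z i w)) <= expR (`|l| + l ^+ 2 * expR `|l|).
Proof.
move=> zb m1 v1.
have bz i : (i < K)%N -> bm (z i).
  by move=> iK; have [] := iz iK; split => //; exists 1 => w; exact: zb.
pose a i := `|l| * `|E (z i)| + l ^+ 2 * expR `|l| * E (fun w => z i w ^+ 2).
suff H : forall k, (k <= K)%N ->
    E (fun w => expR (l * \sum_(i < k) z i w)) <= expR (\sum_(i < k) a i).
  apply: le_trans (H K (leqnn K)) _; rewrite ler_expR big_split/= -!mulr_sumr.
  have e0 : 0 <= l ^+ 2 * expR `|l| by rewrite mulr_ge0 ?sqr_ge0 ?expR_ge0.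
  by apply: lerD; [rewrite ler_piMr|rewrite ler_piMr].
elim=> [_|k IH kK].
  by under eq_fun do rewrite big_ord0 mulr0; rewrite Excst big_ord0.
have [Gm mz zi Gz] := iz kK.
have bS : bm (fun w => \sum_(i < k) z i w).
  by apply: bm_sum => i _; apply: bz; exact: ltn_trans (ltn_ord i) kK.
have bzk := bz _ kK.
have mS : (G k).-meas (fun w => expR (l * \sum_(i < k) z i w)).
  apply: measurableT_comp => //; apply: measurable_funM => //.
  exact: meas_partial_sum.
have mexp : measurable_fun [set: R] (fun y : R => expR (l * y)).
  by apply: measurableT_comp => //; exact: mulrl_measurable.
have [] := indep_mul Gm mz zi mS mexp.
- by apply: bmL1; bmt.
- by apply: bmL1; bmt.
move=> _ ce.
have -> : (fun w => expR (l * \sum_(i < k.+1) z i w)) =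
  (fun w => expR (l * \sum_(i < k) z i w) * expR (l * z k w)).
  by apply/funext => w; rewrite big_ord_recr/= mulrDr expRD.
rewrite ce big_ord_recr/= expRD; apply: ler_pM.
- by apply: Ex_ge0 => w; exact: expR_ge0.
- by apply: Ex_ge0 => w; exact: expR_ge0.
- exact: IH (ltnW kK).
apply: le_trans (expR_ge1Dx _).
apply: (@le_trans _ _ (E (fun w => 1 + l * z k w + l ^+ 2 * expR `|l| * z k w ^+ 2))).
  apply: Ex_le; [by apply: bmL1; bmt..|] => w.
  apply: le_trans (expR_le_quad _) _; rewrite lerD2l exprMn mulrAC.
  rewrite ler_wpM2r ?sqr_ge0// ler_wpM2l ?sqr_ge0// ler_expR normrM ler_piMr//.
  exact: zb.
rewrite ExD; [|by apply: bmL1; bmt..].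
rewrite ExD; [|by apply: bmL1; bmt..].
rewrite Excst !ExZ; [|by apply: bmL1; bmt..].
rewrite /a -addrA lerD2l lerD2r -normrM; exact: ler_norm.
Qed.
End sums.
End Families.

(** * Test functions for the concentration inequality *)

Section Ramp.
Context (R : realType).
Implicit Types u v x D g s : R.

(** In [u], a line of slope one across the window of radius [D + g] around [x],
constant outside of it. *)
Definition ramp x g u D : R := Num.min (Num.max (u - x + D + g) 0) (2 * D + 2 * g).

(** On the window around [x] the exponential factor is large with [x]; dividing by
it at the end produces an estimate that decays in [x]. *)
Definition tilt x g u D : R := expR (u / 2) * ramp x g u D.

Lemma ramp_ge0 x g u D : 0 <= D -> 0 <= g -> 0 <= ramp x g u D.
Proof.
move=> D0 g0; rewrite /ramp le_min le_max lexx orbT/=; lra.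
Qed.

Lemma ramp_le x g u D : ramp x g u D <= 2 * D + 2 * g.
Proof. by rewrite /ramp ge_min lexx orbT. Qed.

Lemma ramp_mono x g u v D : u <= v -> ramp x g u D <= ramp x g v D.
Proof.
move=> uv; rewrite /ramp le_min !ge_min !ge_max lexx orbT andbT.
by rewrite !le_max lexx orbT andbT; apply/orP; left; apply/orP; left; lra.
Qed.

Lemma ramp_lip x g u D D' : `|ramp x g u D - ramp x g u D'| <= 2 * `|D - D'|.
Proof.
have key e f : ramp x g u e <= ramp x g u f + 2 * `|e - f|.
  have h : e - f <= `|e - f| by exact: ler_norm.
  have h0 : 0 <= `|e - f| by [].
  rewrite -lerBlDr /ramp le_min; apply/andP; split.
    rewrite lerBlDr ge_min; apply/orP; left; rewrite ge_max; apply/andP; split.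
      by rewrite -lerBlDr le_max; apply/orP; left; lra.
    by rewrite -lerBlDr le_max; apply/orP; right; lra.
  by rewrite lerBlDr ge_min; apply/orP; right; lra.
rewrite ler_norml; apply/andP; split.
  have := key D' D; rewrite distrC; lra.
have := key D D'; lra.
Qed.

Lemma tilt_mono x g u v D : 0 <= D -> 0 <= g -> u <= v -> tilt x g u D <= tilt x g v D.
Proof.
move=> D0 g0 uv; apply: ler_pM; rewrite ?expR_ge0 ?ramp_ge0 ?ramp_mono//.
by rewrite ler_expR; lra.
Qed.

Lemma tilt_ge0 x g u D : 0 <= D -> 0 <= g -> 0 <= tilt x g u D.
Proof. by move=> D0 g0; rewrite mulr_ge0 ?expR_ge0 ?ramp_ge0. Qed.

Lemma tilt_incr_ge0 x g u D s : 0 <= D -> 0 <= g ->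
  0 <= s * (tilt x g u D - tilt x g (u - s) D).
Proof.
move=> D0 g0; case: (leP 0 s) => s0.
  by rewrite mulr_ge0// subr_ge0 tilt_mono// lerBlDr lerDl.
by rewrite nmulr_rge0// subr_le0 tilt_mono// lerBrDl gerDr ltW.
Qed.

(** Within distance [D] of [x] there is a margin [g] left on both sides, so a step
[s] changes the ramp by at least [min (|s|, g)]. There [u] is at least
[3 x / 4 - 1], and [u - s] at least [3 x / 4 - 2], whence the exponent. *)
Lemma tilt_incr_lb x g u D s : 0 <= D <= 1 + x / 4 -> 0 <= g -> `|s| <= 1 ->
  `|u - x| <= D ->
  expR (3 * x / 8 - 1) * (`|s| * Num.min `|s| g) <=
  s * (tilt x g u D - tilt x g (u - s) D).
Proof.
move=> /andP[D0 Dx] g0 s1 uD.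
have key v r : expR (3 * x / 8 - 1) <= expR (v / 2) -> 0 <= ramp x g v D -> 
  v <= v + r -> Num.min r g <= ramp x g (v + r) D - ramp x g v D ->
  0 <= Num.min r g ->
  expR (3 * x / 8 - 1) * Num.min r g <= tilt x g (v + r) D - tilt x g v D.
  move=> ev rv vr mr m0.
  have ee : expR (v / 2) <= expR ((v + r) / 2) by rewrite ler_expR; lra.
  apply: (@le_trans _ _ (expR (v / 2) * (ramp x g (v + r) D - ramp x g v D))).
    by apply: ler_pM; rewrite ?expR_ge0.
  rewrite mulrBr lerD2r ler_wpM2r//.
  by apply: le_trans rv _; exact: ramp_mono.
move: uD; rewrite ler_norml => /andP[uD1 uD2].
have rampD : ramp x g u D = u - x + D + g.
  by rewrite /ramp max_l ?min_l//; lra.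
case: (leP 0 s) s1 => s0.
  rewrite ger0_norm// => s1.
  rewrite mulrCA; apply: ler_wpM2l => //.
  have := key (u - s) s; rewrite subrK; apply.
  - rewrite ler_expR; lra.
  - exact: ramp_ge0.
  - lra.
  - rewrite rampD.
    rewrite lerBrDl -lerBrDr.
    rewrite /ramp ge_min; apply/orP; left; rewrite ge_max; apply/andP; split.
      rewrite lerBrDl -lerBrDr ge_min; apply/orP; left; lra.
    rewrite lerBrDl addr0 ge_min; apply/orP; right; lra.
  - by rewrite le_min s0.
rewrite ltr0_norm// => s1.
rewrite mulrCA -[leRHS]mulrNN; apply: ler_wpM2l; first lra.
rewrite opprB; have := key u (- s); apply.
- rewrite ler_expR; lra.
- exact: ramp_ge0.
- lra.
- rewrite rampD.
  rewrite lerBrDr /ramp le_min; apply/andP; split.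
    by rewrite le_max; apply/orP; left; rewrite -lerBrDr ge_min; apply/orP; left; lra.
  rewrite -lerBrDr ge_min; apply/orP; right; lra.
- by rewrite le_min g0 andbT; lra.
Qed.
End Ramp.

(** * A randomized concentration inequality *)

Section Concentration.
Context d (T : measurableType d) (R : realType) (P : probability T R).
Local Notation E := (Ex P).
Local Notation "G .-meas f" := (measurable_fun [set: g_sigma_algebraType G] (f : g_sigma_algebraType G -> _)) (at level 2).

(** The bound of [exp_moment] at [l = 2]. *)
Definition Cexp : R := expR (2 + 4 * expR 2).

Lemma Cexp_ge1 : 1 <= Cexp.
Proof. by rewrite -expR0 ler_expR addr_ge0// mulr_ge0// expR_ge0. Qed.

Context (K : nat) (G : nat -> set_system T) (z : nat -> T -> R) (beta : R).
Hypotheses (iz : indep_fam P K G z) (zb : forall i w, (i < K)%N -> `|z i w| <= 1).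
Hypotheses (beta0 : 0 <= beta) (beta1 : beta <= 1).
Hypotheses (zm : \sum_(i < K) `|E (z i)| <= beta)
  (zv : \sum_(i < K) E (fun w => z i w ^+ 2) <= 1).
Let S w := \sum_(i < K) z i w.

Lemma bm_fam i : (i < K)%N -> bm (z i).
Proof. by move=> iK; have [] := iz iK; split => //; exists 1 => w; exact: zb. Qed.

Lemma bm_famS : bm S.
Proof. by apply: bm_sum => i _; exact: bm_fam. Qed.

Lemma exp_moment2 l : `|l| <= 2 -> E (fun w => expR (l * S w)) <= Cexp.
Proof.
move=> l2; apply: le_trans (exp_moment iz l zb (le_trans zm beta1) zv) _.
rewrite ler_expR lerD// ler_pM ?sqr_ge0 ?expR_ge0 ?ler_expR//.
rewrite -real_normK ?num_real//; have := normr_ge0 l; nra.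
Qed.

Lemma exp_half : E (fun w => expR (S w / 2) ^+ 2) <= Cexp ^+ 2.
Proof.
have bS := bm_famS.
have h : E (fun w => expR (S w / 2) ^+ 2) = E (fun w => expR (1 * S w)).
  by congr Ex; apply/funext => w; rewrite -expRM_natl; congr expR; field.
rewrite h; apply: le_trans (exp_moment2 _) _; first by rewrite normr1; lra.
have := Cexp_ge1; nra.
Qed.

Lemma abs_exp_half : E (fun w => (`|S w| * expR (S w / 2)) ^+ 2) <= (3 * Cexp) ^+ 2.
Proof.
have bS := bm_famS.
apply: (@le_trans _ _ (E (fun w => 4 * (expR (2 * S w) + 1)))).
  apply: Ex_le; [by apply: bmL1; bmt..|] => w.
  rewrite exprMn real_normK ?num_real// -expRM_natl.
  have -> : 2%:R * (S w / 2) = S w by field.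
  have -> : 4 * (expR (2 * S w) + 1) = 4 * (expR (S w) + expR (- S w)) * expR (S w).
    rewrite -mulrA [_ * expR (S w)]mulrDl -!expRD addNr expR0.
    by congr (_ * (expR _ + _)); ring.
  by rewrite ler_wpM2r ?expR_ge0// sqr_le_expR.
rewrite ExZ; last by apply: bmL1; bmt.
rewrite ExD; [|by apply: bmL1; bmt..].
rewrite Excst; have := @exp_moment2 2; rewrite ger0_norm// => /(_ (lexx _)).
have := Cexp_ge1; nra.
Qed.

(** The terms of [Q] are independent and at most [beta |z_i|]. Hence [Q] deviates
from its mean by [beta] in L^2, whereas the mean itself is of order one. *)
Lemma var_quad (Q := fun w => \sum_(i < K) `|z i w| * Num.min `|z i w| beta) :
  E (fun w => (Q w - E Q) ^+ 2) <= beta ^+ 2.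
Proof.
pose t (u : R) := `|u| * Num.min `|u| beta.
have mt : measurable_fun [set: R] t.
  have mn : measurable_fun [set: R] (fun u : R => `|u|) by exact: normr_measurable.
  by apply: measurable_funM => //; apply: measurable_minr.
have bt i : (i < K)%N -> bm (fun w => t (z i w)).
  by move=> iK; have := bm_fam iK => ?; rewrite /t; bmt.
have it := @indep_fam_comp _ _ _ P K G z
  (fun j u => t u - E (fun w => t (z j w))) _ iz.
have [] := var_sum (it _).
- by move=> j; apply: measurable_funB.
- by move=> i iK; apply: bmL1; have := bt _ iK => ?; bmt.
- by move=> i iK; apply: bmL1; have := bt _ iK => ?; bmt.
- move=> i iK; rewrite ExB ?Excst ?subrr//; [exact/bmL1/bt|exact: bmL1].
move=> _ _.
have -> : (fun w => (\sum_(i < K) (t (z i w) - E (fun w => t (z i w)))) ^+ 2) =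
   (fun w => (Q w - E Q) ^+ 2).
  apply/funext => w; rewrite sumrB; congr ((_ - _) ^+ 2).
  by rewrite /Q Ex_sum// => i _; apply/bmL1/bt.
move=> ->.
apply: (@le_trans _ _ (\sum_(i < K) beta ^+ 2 * E (fun w => z i w ^+ 2))).
  apply: ler_sum => i _; apply: le_trans (Ex_var_le _ (bt _ (ltn_ord i))) _.
  have bi := bm_fam (ltn_ord i); have bti := bt _ (ltn_ord i).
  rewrite -ExZ; last by apply: bmL1; bmt.
  apply: Ex_le; [by apply: bmL1; bmt..|] => w.
  rewrite /t exprMn real_normK ?num_real// mulrC ler_wpM2r ?sqr_ge0//.
  by rewrite lerXn2r ?nnegrE ?le_min ?normr_ge0 ?ge_min ?lexx ?orbT.
by rewrite -mulr_sumr ler_piMr// sqr_ge0.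
Qed.

Context (x b : R) (D : T -> R) (Di : nat -> T -> R) (di : nat -> R).
Hypotheses (x0 : 0 <= x)
  (Qlb : 1 / 4 <= E (fun w => \sum_(i < K) `|z i w| * Num.min `|z i w| beta))
  (mD : measurable_fun [set: T] D) (Db : forall w, 0 <= D w <= 1 + x / 4)
  (mDi : forall i, (i < K)%N -> (G i).-meas (Di i))
  (Dib : forall i w, (i < K)%N -> 0 <= Di i w <= 1 + x / 4)
  (b0 : 0 <= b) (D2 : E (fun w => D w ^+ 2) <= b ^+ 2)
  (di0 : forall i, (i < K)%N -> 0 <= di i)
  (Ddi : forall i, (i < K)%N -> E (fun w => (D w - Di i w) ^+ 2) <= di i ^+ 2)
  (dib : \sum_(i < K) di i <= b).

Let A := [set w | `|S w - x| <= D w].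

(** Let [F] be the tilted ramp at [S] with radius [D]. As the ramp is at most
[2 D + 2 beta], [E (S F)] is O(b + beta) by Cauchy--Schwarz. On the other hand
[S F] is the sum of the [z_i F], and subtracting from [F] its value at
[S - z_i] and [Di i], a factor independent of [z_i], leaves the increments of
[F] along [z_i] up to the cost [di i] of the change of radius. These increments
are nonnegative, and on the event in question they add up to at least
[exp (3 x / 8 - 1) Q], where [Q] has mean at least [1/4]. *)
Lemma concentration :
  fine (P A) <= 44 * expR 2 * Cexp * expR (- (x / 4)) * (beta + b).
Proof.
have [x_ge0 b_ge0 beta_ge0 beta_le1] := And4 x0 b0 beta0 beta1.
have bS := bm_famS.
have mA : measurable A.
  apply: measurable_le_set => //; apply: bmm; bmt.
have C1 := Cexp_ge1.
have bD : bm D.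
  by split => //; exists (1 + x / 4) => w; have /andP[? ?] := Db w; rewrite ger0_norm.
have bDi i : (i < K)%N -> bm (Di i).
  move=> iK; have [Gm _ _ _] := iz iK; split; first exact: (meas_sub Gm (mDi iK)).
  by exists (1 + x / 4) => w; have /andP[? ?] := Dib w iK; rewrite ger0_norm.
pose Q w := \sum_(i < K) `|z i w| * Num.min `|z i w| beta.
have bQ : bm Q by apply: bm_sum => i _; have := bm_fam (ltn_ord i) => ?; bmt.
have Q0 w : 0 <= Q w.
  by apply: sumr_ge0 => i _; rewrite mulr_ge0// le_min normr_ge0.
pose c := expR (3 * x / 8 - 1).
have c0 : 0 < c by exact: expR_gt0.
have D0 w : 0 <= D w by case/andP: (Db w).
have btSD : bm (fun w => tilt x beta (S w) (D w)) by rewrite /tilt /ramp; bmt.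
pose e2 : R := expR (1 / 2).
have e20 : 0 < e2 by exact: expR_gt0.
have expS i w : (i < K)%N -> expR ((S w - z i w) / 2) <= e2 * expR (S w / 2).
  move=> iK; rewrite -expRD ler_expR; have := zb w iK; rewrite ler_norml => /andP[]; lra.
have Eexp : E (fun w => expR (S w / 2) * 1) <= Cexp * 1.
  apply: cauchy_schwarz; rewrite ?expr1n ?Excst//; try by apply: bmL1; bmt.
  - lra.
  - exact: exp_half.
pose B := e2 * Cexp * (2 * (1 + x / 4) + 2 * beta).
(* the sums on the right are the cost of exchanging [D] for [Di i] and the
   contribution of the means of the [z i] *)
have H1 : c * E (fun w => \1_A w * Q w) <= E (fun w => S w * tilt x beta (S w) (D w)) +
   (\sum_(i < K) 2 * e2 * Cexp * di i + \sum_(i < K) `|E (z i)| * B).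
  rewrite -ExZ; last by apply: bmL1; bmt.
  pose inc i w := z i w * (tilt x beta (S w) (D w) - tilt x beta (S w - z i w) (D w)).
  have binc i : (i < K)%N -> bm (inc i).
    by move=> iK; have := bm_fam iK => ?; rewrite /inc /tilt /ramp; bmt.
  apply: (@le_trans _ _ (E (fun w => \sum_(i < K) inc i w))).
    apply: Ex_le; [by apply: bmL1; bmt| |].
      by apply: bmL1; apply: bm_sum => i _; exact: binc.
    move=> w; rewrite indicE; case: (boolP (w \in A)) => [|_]; last first.
      rewrite mul0r mulr0; apply: sumr_ge0 => i _; exact: tilt_incr_ge0.
    rewrite inE /A /= => wA; rewrite mul1r /Q mulr_sumr; apply: ler_sum => i _.
    by apply: tilt_incr_lb => //; exact: zb.
  rewrite Ex_sum; last by move=> i _; exact/bmL1/binc.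
  have -> : E (fun w => S w * tilt x beta (S w) (D w)) =
     \sum_(i < K) E (fun w => z i w * tilt x beta (S w) (D w)).
    rewrite -Ex_sum.
      by congr Ex; apply/funext => w; rewrite /S mulr_suml.
    by move=> i _; have := bm_fam (ltn_ord i) => ?; apply: bmL1; bmt.
  rewrite -!big_split/=; apply: ler_sum => i _.
  have iK := ltn_ord i; have bzi := bm_fam iK; have bDii := bDi _ iK.
  have btD : bm (fun w => tilt x beta (S w - z i w) (D w)) by rewrite /tilt /ramp; bmt.
  have btDi : bm (fun w => tilt x beta (S w - z i w) (Di i w)) by rewrite /tilt /ramp; bmt.
  have -> : E (inc i) = E (fun w => z i w * tilt x beta (S w) (D w)) +
     (E (fun w => z i w * (tilt x beta (S w - z i w) (Di i w) - tilt x beta (S w - z i w) (D w)))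
       + - E (fun w => tilt x beta (S w - z i w) (Di i w) * z i w)).
    rewrite -ExN; last by apply: bmL1; bmt.
    rewrite -ExD; [|by apply: bmL1; bmt..].
    rewrite -ExD; [|by apply: bmL1; bmt..].
    by congr Ex; apply/funext => w; rewrite /inc; ring.
  rewrite lerD2l; apply: lerD.
    apply: (@le_trans _ _ (2 * e2 * E (fun w => expR (S w / 2) * `|D w - Di i w|))).
      rewrite -ExZ; last by apply: bmL1; bmt.
      apply: Ex_le; [by apply: bmL1; bmt..|] => w.
      apply: le_trans (ler_norm _) _; rewrite normrM /tilt -mulrBr normrM.
      apply: (@le_trans _ _ (1 * (e2 * expR (S w / 2) * (2 * `|D w - Di i w|)))).
        apply: ler_pM => //; first exact: zb.
        apply: ler_pM => //; first by rewrite ger0_norm ?expR_ge0// expS.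
        by rewrite distrC ramp_lip.
      by rewrite mul1r le_eqVlt; apply/orP; left; apply/eqP; ring.
    rewrite -[leRHS]mulrA ler_wpM2l//; first by rewrite mulr_ge0// ltW.
    apply: cauchy_schwarz; try (by apply: bmL1; bmt).
    - lra.
    - exact: di0.
    - exact: exp_half.
    - under eq_fun do rewrite real_normK ?num_real//; exact: Ddi.
  have [Gm mz zi Gz] := iz iK.
  have mt : (G i).-meas (fun w => tilt x beta (S w - z i w) (Di i w)).
    have m1 := meas_sum_rem iz iK; have m2 := mDi iK.
    apply: measurable_funM.
      by apply: measurableT_comp => //; apply: measurable_funM.
    apply: measurable_minr; last by apply: measurable_funD => //; exact: measurable_funM.
    apply: measurable_maxr => //; apply: measurable_funD => //; apply: measurable_funD => //.
    exact: measurable_funB.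
  have [_ ->] := indep_mul Gm mz zi mt (@measurable_id _ _ setT) (bmL1 P btDi) (bmL1 P bzi).
  apply: le_trans (ler_norm _) _; rewrite normrN normrM mulrC ler_wpM2l//.
  rewrite ger0_norm; last first.
    by apply: Ex_ge0 => w; case/andP: (Dib w iK) => *; exact: tilt_ge0.
  apply: (@le_trans _ _ ((2 * (1 + x / 4) + 2 * beta) * e2 * E (fun w => expR (S w / 2) * 1))).
    rewrite -ExZ; last by apply: bmL1; bmt.
    apply: Ex_le; [by apply: bmL1; bmt..|] => w.
    rewrite mulr1 -mulrA mulrC; case/andP: (Dib w iK) => Di0 Di1.
    apply: ler_pM; rewrite ?expR_ge0 ?ramp_ge0 ?expS//.
    apply: le_trans (ramp_le _ _ _ _) _; lra.
  rewrite /B; have -> : e2 * Cexp * (2 * (1 + x / 4) + 2 * beta) =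
    (2 * (1 + x / 4) + 2 * beta) * e2 * (Cexp * 1) by ring.
  have p0 : 0 <= 2 * (1 + x / 4) + 2 * beta.
    by rewrite addr_ge0// mulr_ge0// addr_ge0// divr_ge0.
  by apply: ler_wpM2l => //; rewrite mulr_ge0// ltW.
have H2 : E (fun w => S w * tilt x beta (S w) (D w)) <= 6 * Cexp * b + 6 * Cexp * beta.
  have cs1 : E (fun w => (`|S w| * expR (S w / 2)) * D w) <= 3 * Cexp * b.
    apply: cauchy_schwarz; try (by apply: bmL1; bmt); rewrite ?abs_exp_half//; lra.
  have cs2 : E (fun w => (`|S w| * expR (S w / 2)) * 1) <= 3 * Cexp * 1.
    by apply: cauchy_schwarz; try (by apply: bmL1; bmt); rewrite ?abs_exp_half ?expr1n ?Excst//; lra.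
  apply: (@le_trans _ _ (2 * E (fun w => (`|S w| * expR (S w / 2)) * D w) +
      2 * beta * E (fun w => (`|S w| * expR (S w / 2)) * 1))).
    rewrite -!ExZ; [|by apply: bmL1; bmt..].
    rewrite -ExD; [|by apply: bmL1; bmt..].
    apply: Ex_le; [by apply: bmL1; bmt..|] => w.
    have := ramp_le x beta (S w) (D w); have := ramp_ge0 x (S w) (D0 w) beta0.
    have := expR_gt0 (S w / 2); have := ler_norm (S w); have := normr_ge0 (S w).
    rewrite /tilt; move: (ramp _ _ _ _) (expR _) (`|S w|) => r e s s0 Ss e0 r0 rD.
    have : S w * (e * r) <= s * (e * r) by rewrite ler_wpM2r// mulr_ge0// ltW.
    have : s * (e * r) <= s * (e * (2 * D w + 2 * beta)).
      by rewrite ler_wpM2l// ler_wpM2l// ltW.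
    lra.
  apply: (@le_trans _ _ (2 * (3 * Cexp * b) + 2 * beta * (3 * Cexp * 1))); last lra.
  by apply: lerD; apply: ler_wpM2l => //; rewrite mulr_ge0.
(* [1/4 <= E Q <= Q + |Q - E Q|] on [A] *)
have H3 : fine (P A) / 4 <= E (fun w => \1_A w * Q w) + E (fun w => \1_A w * `|Q w - E Q|).
  rewrite -ExD; [|by apply: bmL1; bmt..].
  rewrite -Ex_indic// mulrC -ExZ; last by apply: bmL1; bmt.
  apply: Ex_le; [by apply: bmL1; bmt..|] => w.
  rewrite -mulrDr mulrC ler_wpM2l//.
  have := ler_norm (E Q - Q w); rewrite distrC; move: Qlb; rewrite -/(E Q) -/Q.
  change (E (fun w => \sum_(i < K) `|z i w| * Num.min `|z i w| beta)) with (E Q); lra.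
have H4 : c * E (fun w => \1_A w * `|Q w - E Q|) <= Cexp * beta.
  rewrite -ExZ; last by apply: bmL1; bmt.
  apply: (@le_trans _ _ (E (fun w => expR (S w / 2) * `|Q w - E Q|))).
    apply: Ex_le; [by apply: bmL1; bmt..|] => w.
    rewrite mulrA ler_wpM2r// indicE; case: (boolP (w \in A)) => [|_].
      rewrite inE /A /= mulr1 ler_norml => /andP[h _].
      rewrite ler_expR; case/andP: (Db w) => *; lra.
    by rewrite mulr0 expR_ge0.
  apply: cauchy_schwarz; try (by apply: bmL1; bmt).
  - lra.
  - exact: beta0.
  - exact: exp_half.
  - under eq_fun do rewrite real_normK ?num_real//; exact: var_quad.
have H5 : \sum_(i < K) 2 * e2 * Cexp * di i <= 2 * e2 * Cexp * b.
  by rewrite -mulr_sumr ler_wpM2l// !mulr_ge0//; lra.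
have B0 : 0 <= B by rewrite /B !mulr_ge0//; lra.
have H6 : \sum_(i < K) `|E (z i)| * B <= beta * B by rewrite -mulr_suml ler_wpM2r.
have e21 : 1 <= e2 by have := expR_ge1Dx (1 / 2 : R); rewrite -/e2; lra.
have PA0 : 0 <= fine (P A) by rewrite fine_ge0.
have cP : c * fine (P A) <= 4 * e2 * Cexp * ((beta + b) * (11 + x)).
  have h : c * (fine (P A) / 4) <= 6 * Cexp * b + 6 * Cexp * beta +
      (2 * e2 * Cexp * b + beta * B) + Cexp * beta.
    apply: (@le_trans _ _ (c * (E (fun w => \1_A w * Q w) + E (fun w => \1_A w * `|Q w - E Q|)))).
      by rewrite ler_wpM2l// ltW.
    rewrite mulrDr; lra.
  have e2C : Cexp <= e2 * Cexp by rewrite ler_peMl//; lra.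
  have eCb : Cexp * b <= e2 * Cexp * b by rewrite ler_wpM2r.
  have eCbeta : Cexp * beta <= e2 * Cexp * beta by rewrite ler_wpM2r.
  have bB : beta * B <= e2 * Cexp * beta * (4 + x / 2).
    rewrite /B; have -> : beta * (e2 * Cexp * (2 * (1 + x / 4) + 2 * beta)) =
      e2 * Cexp * beta * (2 * (1 + x / 4) + 2 * beta) by ring.
    rewrite ler_wpM2l//; [by rewrite !mulr_ge0//; lra|lra].
  have p1 : 0 <= e2 * Cexp * b by rewrite !mulr_ge0//; lra.
  have p2 : 0 <= e2 * Cexp * beta by rewrite !mulr_ge0//; lra.
  have p3 : 0 <= e2 * Cexp * b * x by rewrite mulr_ge0.
  have p4 : 0 <= e2 * Cexp * beta * x by rewrite mulr_ge0.
  lra.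
(* a third of the exponential decay absorbs the factor linear in [x] *)
have hx : (11 + x) * expR (- (x / 8)) <= 11.
  have := expR_ge1Dx (x / 8); rewrite expRN => h.
  rewrite ler_pdivrMr ?expR_gt0//; lra.
have -> : fine (P A) = expR (- (3 * x / 8) + 1) * (c * fine (P A)).
  by rewrite mulrA /c -expRD (_ : _ + _ = 0) ?expR0 ?mul1r//; ring.
apply: (@le_trans _ _ (expR (- (3 * x / 8) + 1) * (4 * e2 * Cexp * ((beta + b) * (11 + x))))).
  by rewrite ler_wpM2l// expR_ge0.
have -> : expR (- (3 * x / 8) + 1) = expR (- (x / 4)) * (expR (- (x / 8)) * expR 1).
  by rewrite -!expRD; congr expR; field.
have e2e : e2 * expR 1 <= expR 2 by rewrite -expRD ler_expR; lra.
have -> : expR (- (x / 4)) * (expR (- (x / 8)) * expR 1) * (4 * e2 * Cexp * ((beta + b) * (11 + x)))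
  = (4 * Cexp * expR (- (x / 4)) * (beta + b)) * ((e2 * expR 1) * ((11 + x) * expR (- (x / 8)))).
  by ring.
have -> : 44 * expR 2 * Cexp * expR (- (x / 4)) * (beta + b) =
  (4 * Cexp * expR (- (x / 4)) * (beta + b)) * (expR 2 * 11) by ring.
apply: ler_wpM2l; first by rewrite !mulr_ge0 ?expR_ge0//; lra.
by apply: ler_pM => //; rewrite !mulr_ge0 ?expR_ge0//; lra.
Qed.
End Concentration.

(** * The normal tail *)

Section Normal.
Context (R : realType).
Implicit Types x w s : R.
Local Notation Phi := (@std_normal_cdf R).
Local Notation mu := (@lebesgue_measure R).

(** The constant [sqrt (2 pi)]. *)
Definition npeak_inv : R := (normal_peak (1 : R))^-1.

Definition tailN x : R := 1 - Phi x.

Lemma npeak_inv_gt0 : 0 < npeak_inv.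
Proof. by rewrite invr_gt0 normal_peak_gt0// oner_neq0. Qed.

Lemma pdf01E w : normal_pdf 0 1 w = npeak_inv^-1 * expR (- (w ^+ 2 / 2)).
Proof.
rewrite normal_pdfE ?oner_neq0// /npeak_inv invrK /normal_fun subr0 expr1n.
by rewrite mulNr.
Qed.

Lemma Phi_fin A : measurable A -> normal_prob (0 : R) 1 A \is a fin_num.
Proof. by move=> mA; exact: fin_num_measure. Qed.

Lemma Phi_ge0 x : 0 <= Phi x.
Proof. by rewrite /std_normal_cdf fine_ge0. Qed.

Lemma Phi_le1 x : Phi x <= 1.
Proof.
by rewrite /std_normal_cdf -lee_fin fineK ?Phi_fin// probability_le1.
Qed.

Lemma tailN_ge0 x : 0 <= tailN x. Proof. by rewrite subr_ge0 Phi_le1. Qed.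
Lemma tailNE x : tailN x = fine (normal_prob (0 : R) 1 `]x, +oo[%classic).
Proof.
have -> : `]x, +oo[%classic = ~` `]-oo, x]%classic by rewrite setCitvl.
by rewrite probability_setC// fineB// ?Phi_fin.
Qed.

Lemma PhiN x : Phi (- x) = tailN x.
Proof.
rewrite tailNE /std_normal_cdf; congr fine; rewrite /normal_prob.
transitivity (\int[mu]_(y in `[x, +oo[) (normal_pdf 0 1 y)%:E)%E; last first.
  apply/esym/integral_itv_obnd_cbnd/measurable_EFinP/measurable_funTS.
  exact: measurable_normal_pdf.
have -> : `]-oo, - x]%classic = (-%R : _ -> measurableTypeR R) @^-1` `[x, +oo[%classic.
  by rewrite opp_preimage_itvbndy.
have even y : normal_pdf 0 1 y = normal_pdf 0 1 (- y) :> R.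
  by rewrite !pdf01E sqrrN.
transitivity (\int[mu]_(y in (-%R : _ -> measurableTypeR R) @^-1` `[x, +oo[)
   ((fun z => (normal_pdf 0 1 z)%:E) \o -%R) y)%E.
  by apply: eq_integral => y _ /=; rewrite even.
rewrite -ge0_integral_pushforward//=.
- by apply: eq_measure_integral => A mA _; exact: lebesgue_measureN.
- by apply/measurable_EFinP/measurable_funTS; exact: measurable_normal_pdf.
- by move=> y _; rewrite lee_fin normal_pdf_ge0.
Qed.

(** For [y >= x >= 0] one has [y^2 >= x^2 + (y - x)^2], so the density at [y] is at
most [exp (- x^2 / 2)] times the normal density centred at [x]. *)
Lemma tailN_exp x : 0 <= x -> tailN x <= expR (- (x ^+ 2 / 2)).
Proof.
move=> x0; rewrite tailNE -lee_fin fineK ?Phi_fin//.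
rewrite -[leRHS]mule1 -(@integral_normal_pdf R x 1) -ge0_integralZl//= ?lee_fin ?expR_ge0//; first last.
- by move=> y _; rewrite lee_fin normal_pdf_ge0.
- by apply/measurable_EFinP; exact: measurable_normal_pdf.
rewrite /normal_prob integral_mkcond; apply: ge0_le_integral => //=.
- by move=> y _; rewrite patchE; case: ifP => //; rewrite lee_fin normal_pdf_ge0.
- apply/(measurable_restrictT _ _).1 => //; apply/measurable_EFinP/measurable_funTS.
  exact: measurable_normal_pdf.
- by apply/measurable_EFinP/measurable_funM => //; exact: measurable_normal_pdf.
move=> y _; rewrite patchE -EFinM; case: ifPn => [|_]; last first.
  by rewrite lee_fin mulr_ge0 ?expR_ge0 ?normal_pdf_ge0.
rewrite inE/= in_itv/= andbT lee_fin => xy.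
rewrite !normal_pdfE ?oner_neq0// mulrCA ler_wpM2l ?normal_peak_ge0//.
rewrite /normal_fun -expRD ler_expR subr0 expr1n; nra.
Qed.

Lemma is_derive_Phi w : is_derive w 1 Phi (npeak_inv^-1 * expR (- (w ^+ 2 / 2))).
Proof.
rewrite -pdf01E.
have [] := @continuous_FTC1 R (normal_pdf 0 1) -oo%O w (w + 1).
- by rewrite ltrDl.
- apply: integrableS (integrable_normal_pdf 0 1) => //.
- by rewrite ltNyr.
- by apply: continuous_normal_pdf; rewrite oner_neq0.
move=> dF; rewrite derive1E => F'.
apply: DeriveDef => //.
Qed.

End Normal.

(** * The Stein equation *)

Section Stein.
Context (R : realType).
Implicit Types x w s t : R.
Local Notation Phi := (@std_normal_cdf R).
Local Notation q := (@npeak_inv R).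

(** The bounded solution of [f' - w f = 1_{w <= x} - Phi x] is [st1] before [x] and
[st2] after it. Both expressions are smooth on the whole line, so that the mean
value theorem applies to each of them up to the corner. *)
Definition st1 x w := tailN x * (q * expR (w ^+ 2 / 2) * Phi w).
Definition st2 x w := Phi x * (q * expR (w ^+ 2 / 2) * tailN w).
Definition stein x w := if w <= x then st1 x w else st2 x w.
(** At the corner [x] this is the left derivative. *)
Definition dstein x w := w * stein x w + (w <= x)%R%:R - Phi x.
(** Once [w] is replaced by a variable with exponential moments, the envelope is of
order [exp (- x)]; it dominates the solution and its derivatives. *)
Definition envel x w := expR (- x) * (expR (- w) + expR (2 * w)).
Definition cS : R := expR 1 * (8 * q + 1).

Lemma is_derive_congr (f g : R -> R) (a b w : R) :
  is_derive w 1 f a -> f = g -> a = b -> is_derive w 1 g b.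
Proof. by move=> h <- <-. Qed.

Lemma is_derive_gauss_inv w :
  is_derive w 1 (fun w => q * expR (w ^+ 2 / 2)) (w * (q * expR (w ^+ 2 / 2))).
Proof.
have h : is_derive w 1 (fun w : R => w ^+ 2 / 2) w.
  apply: (is_derive_congr (is_deriveZ _ (is_deriveX 2 (is_derive_id w (1 : R))))).
    by apply/funext => t; rewrite /GRing.scale/= mulrC.
  by rewrite /GRing.scale/= -mulr_natr; field.
have he := @is_derive1_comp R (@expR R) (fun w => w ^+ 2 / 2) w _ _ (is_derive_expR _) h.
have := @is_deriveZ _ _ _ (fun w => expR (w ^+ 2 / 2)) q w 1 _ he.
rewrite (_ : q *: _ = w * (q * expR (w ^+ 2 / 2)))//.
by rewrite /GRing.scale/=; ring.
Qed.

Lemma gauss_inv_pdf w :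
  (q * expR (w ^+ 2 / 2)) * (q^-1 * expR (- (w ^+ 2 / 2))) = 1.
Proof.
rewrite mulrACA divff ?gt_eqF ?npeak_inv_gt0// mul1r -expRD subrr expR0//.
Qed.

Lemma is_derive_st1 x w : is_derive w 1 (st1 x) (w * st1 x w + tailN x).
Proof.
have := is_deriveM (is_derive_gauss_inv w) (is_derive_Phi w).
move=> /(@is_deriveZ _ _ _ _ (tailN x) w 1 _) h.
apply: (is_derive_congr h) => //; rewrite /st1 /GRing.scale/=.
have := gauss_inv_pdf w; set a := q * _; set b := q^-1 * _ => ab.
rewrite ab; ring.
Qed.

Lemma is_derive_tailN w : is_derive w 1 (@tailN R) (- (q^-1 * expR (- (w ^+ 2 / 2)))).
Proof.
have := is_deriveB (is_derive_cst (1 : R) w 1) (is_derive_Phi w).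
by rewrite sub0r.
Qed.

Lemma is_derive_st2 x w : is_derive w 1 (st2 x) (w * st2 x w - Phi x).
Proof.
have := is_deriveM (is_derive_gauss_inv w) (is_derive_tailN w).
move=> /(@is_deriveZ _ _ _ _ (Phi x) w 1 _) h.
apply: (is_derive_congr h) => //; rewrite /st2 /GRing.scale/=.
have := gauss_inv_pdf w; set a := q * _; set b := q^-1 * _ => ab.
rewrite mulrN ab; ring.
Qed.

Lemma is_derive_mul_id (f : R -> R) (df : R) w : is_derive w 1 f df ->
  is_derive w 1 (fun t => t * f t) (f w + w * df).
Proof.
move=> h; apply: (is_derive_congr (is_deriveM (is_derive_id w (1 : R)) h)) => //.
by rewrite /GRing.scale/=; ring.
Qed.

Lemma st12 x : st1 x x = st2 x x.
Proof. by rewrite /st1 /st2; ring. Qed.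

Lemma stein1 x w : w <= x -> stein x w = st1 x w.
Proof. by rewrite /stein => ->. Qed.

Lemma stein2 x w : x <= w -> stein x w = st2 x w.
Proof.
move=> xw; rewrite /stein; case: ifPn => // wx.
have -> : w = x by apply/eqP; rewrite eq_le wx xw.
exact: st12.
Qed.

Lemma envel_ge0 x w : 0 <= envel x w.
Proof. by rewrite mulr_ge0 ?addr_ge0 ?expR_ge0. Qed.

Lemma one_le_envel w : 1 <= expR (- w) + expR (2 * w).
Proof.
have := expR_ge0 (- w); have := expR_ge0 (2 * w).
have := expR_ge1Dx (- w); have := expR_ge1Dx (2 * w).
case: (leP 0 w) => ? ? ? ? ?; lra.
Qed.

Lemma quad_le_exp w : 0 <= w -> 1 + w ^+ 2 <= 4 * expR w.
Proof.
move=> w0; have -> : w = w / 2 + w / 2 by field.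
rewrite expRD; have := expR_ge1Dx (w / 2); nra.
Qed.

Lemma quad_envel w : (1 + w ^+ 2) * (1 + expR w) <= 8 * (expR (- w) + expR (2 * w)).
Proof.
have e1 := expR_ge0 (- w); have e2 := expR_ge0 (2 * w).
have [w0|w0] := leP 0 w.
  have h := quad_le_exp w0; have h1 := expR_ge1Dx w.
  have -> : 2 * w = w + w by ring.
  rewrite expRD; nra.
have h : 1 + w ^+ 2 <= 4 * expR (- w) by rewrite -sqrrN quad_le_exp// oppr_ge0 ltW.
have h1 : expR w <= 1 by rewrite -expR0 ler_expR ltW.
have h2 := sqr_ge0 w; nra.
Qed.

Lemma abs_le_quad w : `|w| <= 1 + w ^+ 2.
Proof. by case: (ler0P w) => h; nra. Qed.

Lemma tailN_le_exp x : 0 <= x -> tailN x <= expR 1 * expR (- x).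
Proof.
move=> x0; apply: le_trans (tailN_exp x0) _; rewrite -expRD ler_expR.
have := sqr_ge0 (x - 1); nra.
Qed.

Lemma st1_ge0 x w : 0 <= st1 x w.
Proof.
by rewrite !mulr_ge0 ?tailN_ge0 ?expR_ge0 ?Phi_ge0// ltW// npeak_inv_gt0.
Qed.

Lemma st2_ge0 x w : 0 <= st2 x w.
Proof.
by rewrite !mulr_ge0 ?tailN_ge0 ?expR_ge0 ?Phi_ge0// ltW// npeak_inv_gt0.
Qed.

(** The growth of [exp (w^2 / 2)] is compensated by the tail at [x >= w] if
[w >= 0], and by [Phi w] otherwise. *)
Lemma st1_le x w : 0 <= x -> w <= x -> st1 x w <= q * expR 1 * (expR (- x) * (1 + expR w)).
Proof.
move=> x0 wx; have q0 := @npeak_inv_gt0 R.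
have -> : st1 x w = q * (tailN x * (expR (w ^+ 2 / 2) * Phi w)) by rewrite /st1; ring.
rewrite -mulrA ler_pM2l//.
have [w0|w0] := leP 0 w.
  apply: (@le_trans _ _ (expR (- (x ^+ 2 / 2)) * (expR (w ^+ 2 / 2) * 1))).
    apply: ler_pM; rewrite ?tailN_ge0 ?tailN_exp ?mulr_ge0 ?expR_ge0 ?Phi_ge0//.
    by rewrite ler_wpM2l ?expR_ge0 ?Phi_le1.
  rewrite mulr1 -expRD; apply: (@le_trans _ _ (expR 1 * (expR (- x) * expR w))).
    rewrite -!expRD ler_expR; have := sqr_ge0 (x - 1).
    have [w2|w2] := leP w 2; nra.
  by rewrite ler_wpM2l ?expR_ge0// ler_wpM2l ?expR_ge0// lerDr.
have PhiE : Phi w <= expR (- (w ^+ 2 / 2)).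
  have := @tailN_exp R (- w); rewrite -PhiN opprK sqrrN; apply; lra.
apply: (@le_trans _ _ (expR 1 * expR (- x) * 1)).
  apply: ler_pM; rewrite ?tailN_ge0 ?tailN_le_exp ?mulr_ge0 ?expR_ge0 ?Phi_ge0//.
  apply: le_trans (ler_wpM2l (expR_ge0 _) PhiE) _.
  by rewrite -expRD subrr expR0.
by rewrite -mulrA ler_wpM2l ?expR_ge0// ler_wpM2l ?expR_ge0// lerDl expR_ge0.
Qed.

Lemma st2_le x w : 0 <= x -> x <= w -> st2 x w <= q * expR 1 * (expR (- x) * (1 + expR w)).
Proof.
move=> x0 xw; have q0 := @npeak_inv_gt0 R.
have -> : st2 x w = q * (Phi x * (expR (w ^+ 2 / 2) * tailN w)) by rewrite /st2; ring.
rewrite -mulrA ler_pM2l//.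
apply: (@le_trans _ _ (1 * 1)).
  apply: ler_pM; rewrite ?Phi_ge0 ?Phi_le1 ?mulr_ge0 ?expR_ge0 ?tailN_ge0//.
  have w0 : 0 <= w by lra.
  apply: le_trans (ler_wpM2l (expR_ge0 _) (tailN_exp w0)) _.
  by rewrite -expRD subrr expR0.
rewrite mulr1; apply: (@le_trans _ _ (expR 1 * (expR (- x) * expR w))).
  rewrite -!expRD -[leLHS]expR0 ler_expR; lra.
by rewrite ler_wpM2l ?expR_ge0// ler_wpM2l ?expR_ge0// lerDr.
Qed.

(** With [a] the solution and [w * a + r] its derivative, the last quantity is the
derivative of [w * a]. The factor [1 + w^2] that they require is absorbed by the
exponentials of the envelope. *)
Lemma envel_bound x w (a r : R) : 0 <= a ->
  a <= q * expR 1 * (expR (- x) * (1 + expR w)) ->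
  `|r| <= expR 1 * envel x w -> `|w * r| <= expR 1 * envel x w ->
  [/\ a <= cS * envel x w, `|w * a + r| <= cS * envel x w &
      `|a + w * (w * a + r)| <= cS * envel x w].
Proof.
move=> a0 aq r1 r2; have q0 := ltW (@npeak_inv_gt0 R).
have h : (1 + w ^+ 2) * a <= expR 1 * (8 * q) * envel x w.
  apply: (@le_trans _ _ ((1 + w ^+ 2) * (q * expR 1 * (expR (- x) * (1 + expR w))))).
    by rewrite ler_wpM2l// addr_ge0// sqr_ge0.
  have -> : (1 + w ^+ 2) * (q * expR 1 * (expR (- x) * (1 + expR w))) =
     q * expR 1 * expR (- x) * ((1 + w ^+ 2) * (1 + expR w)) by ring.
  have -> : expR 1 * (8 * q) * envel x w =
     q * expR 1 * expR (- x) * (8 * (expR (- w) + expR (2 * w))) by rewrite /envel; ring.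
  by rewrite ler_wpM2l ?quad_envel// !mulr_ge0 ?expR_ge0.
have w2 := sqr_ge0 w.
have e1 : 0 <= expR 1 * envel x w by rewrite mulr_ge0 ?expR_ge0 ?envel_ge0.
have -> : cS * envel x w = expR 1 * (8 * q) * envel x w + expR 1 * envel x w by rewrite /cS; ring.
have wa : `|w * a| <= (1 + w ^+ 2) * a.
  by rewrite normrM (ger0_norm a0) ler_wpM2r// abs_le_quad.
split.
- nra.
- by apply: le_trans (ler_normD _ _) _; apply: lerD => //; exact: le_trans wa h.
- have -> : a + w * (w * a + r) = (1 + w ^+ 2) * a + w * r by ring.
  apply: le_trans (ler_normD _ _) _; apply: lerD => //.
  by rewrite ger0_norm// mulr_ge0// addr_ge0.
Qed.

Lemma st1_bounds x w : 0 <= x -> w <= x ->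
  [/\ st1 x w <= cS * envel x w, `|w * st1 x w + tailN x| <= cS * envel x w &
      `|st1 x w + w * (w * st1 x w + tailN x)| <= cS * envel x w].
Proof.
move=> x0 wx.
have h (a : R) : a <= expR (- w) + expR (2 * w) -> 0 <= a ->
    a * tailN x <= expR 1 * envel x w.
  move=> ha a0; have -> : expR 1 * envel x w =
    (expR (- w) + expR (2 * w)) * (expR 1 * expR (- x)) by rewrite /envel; ring.
  by apply: ler_pM; rewrite ?tailN_ge0 ?tailN_le_exp.
apply: envel_bound; rewrite ?st1_ge0 ?st1_le//.
- by rewrite ger0_norm ?tailN_ge0// -[leLHS]mul1r h// one_le_envel.
- rewrite normrM (ger0_norm (tailN_ge0 _)) h//.
  have := expR_ge0 (- w); have := expR_ge0 (2 * w).
  have := expR_ge1Dx (- w); have := expR_ge1Dx (2 * w).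
  by case: (ler0P w) => ? ? ? ? ?; lra.
Qed.

Lemma st2_bounds x w : 0 <= x -> x <= w ->
  [/\ st2 x w <= cS * envel x w, `|w * st2 x w - Phi x| <= cS * envel x w &
      `|st2 x w + w * (w * st2 x w - Phi x)| <= cS * envel x w].
Proof.
move=> x0 xw.
have e1 : 1 <= expR 1 :> R by have := expR_ge1Dx (1 : R); lra.
have h : w <= envel x w /\ 1 <= envel x w.
  have H : expR w * expR (w - x) <= envel x w.
    have -> : expR w * expR (w - x) = expR (- x) * expR (2 * w).
      by rewrite -!expRD; congr expR; ring.
    by rewrite ler_wpM2l ?expR_ge0// lerDr expR_ge0.
  have h1 := expR_ge1Dx w; have h2 := expR_ge1Dx (w - x).
  have w0 : 0 <= w by lra.
  have : expR w * 1 <= expR w * expR (w - x) by rewrite ler_wpM2l ?expR_ge0//; lra.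
  lra.
have [h1 h2] := h.
have h3 : envel x w <= expR 1 * envel x w by rewrite ler_peMl// envel_ge0.
apply: envel_bound; rewrite ?st2_ge0 ?st2_le//.
- rewrite normrN ger0_norm ?Phi_ge0//; have := Phi_le1 x; lra.
- rewrite mulrN normrN normrM !ger0_norm ?Phi_ge0//; last lra.
  have := Phi_le1 x; have := Phi_ge0 x; nra.
Qed.

Lemma stein_bounds x w : 0 <= x ->
  0 <= stein x w <= cS * envel x w /\ `|dstein x w| <= cS * envel x w.
Proof.
move=> x0; rewrite /dstein /stein; case: ifPn => wx.
  have [h1 h2 _] := st1_bounds x0 wx; rewrite st1_ge0 h1; split => //.
  by rewrite -addrA.
rewrite -ltNge in wx; have [h1 h2 _] := st2_bounds x0 (ltW wx).
by rewrite st2_ge0 h1; split => //; rewrite addr0.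
Qed.

Lemma envel_shift x w t : `|t - w| <= 1 -> envel x t <= expR 2 * envel x w.
Proof.
rewrite ler_norml => /andP[h1 h2].
rewrite /envel mulrCA ler_wpM2l ?expR_ge0// mulrDr -!expRD.
by apply: lerD; rewrite ler_expR; lra.
Qed.

Lemma is_derive_continuous (f df : R -> R) :
  (forall t, is_derive t 1 f (df t)) -> continuous f.
Proof.
move=> fd t; apply: differentiable_continuous; apply/derivable1_diffP.
by have [] := fd t.
Qed.

(** Mean value inequality across a corner at [x], by gluing the two sides. The
constant [k] allows for an approximate derivative. *)
Lemma piecewise_mvt x (h h1 h2 d1 d2 : R -> R) (k M : R) v w :
  (forall t, t <= x -> h t = h1 t) -> (forall t, x <= t -> h t = h2 t) ->
  (forall t, is_derive t 1 h1 (d1 t)) -> (forall t, is_derive t 1 h2 (d2 t)) ->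
  v <= w ->
  (forall t, v < t < w -> t < x -> `|d1 t - k| <= M) ->
  (forall t, v < t < w -> x < t -> `|d2 t - k| <= M) ->
  `|h w - h v - k * (w - v)| <= M * (w - v).
Proof.
move=> hh1 hh2 hd1 hd2 vw dM1 dM2.
have seg (f df : R -> R) a b : (forall t, is_derive t 1 f (df t)) -> a <= b ->
   (forall t, a < t < b -> `|df t - k| <= M) ->
   `|f b - f a - k * (b - a)| <= M * (b - a).
  move=> fd; rewrite le_eqVlt => /predU1P[->|ab] dM.
    by rewrite !subrr !mulr0 subr0 normr0.
  have [|c] := @MVT R f df a b ab (fun t _ => fd t).
    by apply: continuous_subspaceT; exact: is_derive_continuous fd.
  rewrite in_itv/= => /andP[ac cb] ->.
  rewrite -mulrBl normrM (@ger0_norm _ (b - a)) ?subr_ge0 ?(ltW ab)//.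
  by rewrite ler_wpM2r ?subr_ge0 ?(ltW ab)// dM// ac.
have [wx|xw] := leP w x.
  rewrite !hh1//; last exact: le_trans wx.
  by apply: seg (hd1) vw _ => t /andP[vt tw]; apply: dM1; rewrite ?vt ?tw//; exact: lt_le_trans wx.
have [xv|vx] := leP x v.
  rewrite !hh2//; last exact: ltW.
  by apply: seg (hd2) vw _ => t /andP[vt tw]; apply: dM2; rewrite ?vt ?tw//; exact: le_lt_trans vt.
have s1 : `|h x - h v - k * (x - v)| <= M * (x - v).
  rewrite (hh1 x (lexx x)) (hh1 v (ltW vx)); apply: (seg _ _ _ _ hd1 (ltW vx)) => t /andP[vt tx].
  by apply: dM1 => //; rewrite vt (lt_trans tx).
have s2 : `|h w - h x - k * (w - x)| <= M * (w - x).
  rewrite (hh2 x (lexx x)) (hh2 w (ltW xw)); apply: (seg _ _ _ _ hd2 (ltW xw)) => t /andP[xt tw].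
  by apply: dM2 => //; rewrite tw (lt_trans vx).
have -> : h w - h v - k * (w - v) =
  (h w - h x - k * (w - x)) + (h x - h v - k * (x - v)) by ring.
have -> : M * (w - v) = M * (w - x) + M * (x - v) by ring.
exact: le_trans (ler_normD _ _) (lerD _ _).
Qed.

Definition kS : R := expR 2 * cS.

Lemma cS_ge0 : 0 <= cS.
Proof. by rewrite mulr_ge0 ?expR_ge0// addr_ge0// mulr_ge0// ltW// npeak_inv_gt0. Qed.

Lemma envel_loc x w t : `|t - w| <= 1 -> cS * envel x t <= kS * envel x w.
Proof.
move=> h; have -> : kS * envel x w = cS * (expR 2 * envel x w) by rewrite /kS; ring.
by rewrite ler_wpM2l ?cS_ge0// envel_shift.
Qed.

Lemma stein_mul_lip x w s : 0 <= x -> `|s| <= 1 ->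
  `|(w + s) * stein x (w + s) - w * stein x w| <= `|s| * (kS * envel x w).
Proof.
move=> x0 s1.
have key v u : v <= u -> (forall t, v < t < u -> `|t - w| <= 1) ->
    `|u * stein x u - v * stein x v| <= kS * envel x w * (u - v).
  move=> vu tw.
  have := @piecewise_mvt x (fun t => t * stein x t) (fun t => t * st1 x t)
   (fun t => t * st2 x t) _ _ 0 (kS * envel x w) v u _ _
   (fun t => is_derive_mul_id (is_derive_st1 x t)) (fun t => is_derive_mul_id (is_derive_st2 x t))
   vu.
  rewrite mul0r subr0; apply.
  - by move=> t tx; rewrite stein1.
  - by move=> t tx; rewrite stein2.
  - move=> t /tw tw' tx; rewrite subr0.
    have [_ _ h] := st1_bounds x0 (ltW tx); apply: le_trans h _; exact: envel_loc.
  - move=> t /tw tw' tx; rewrite subr0.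
    have [_ _ h] := st2_bounds x0 (ltW tx); apply: le_trans h _; exact: envel_loc.
have [s0|s0] := leP 0 s.
  rewrite ger0_norm// in s1; have := key w (w + s).
  rewrite lerDl s0 (_ : w + s - w = s); last by ring.
  rewrite (ger0_norm s0) [_ * s]mulrC; apply => // t /andP[? ?].
  rewrite ler_norml; lra.
rewrite ltr0_norm// in s1; have := key (w + s) w.
rewrite distrC (ltr0_norm s0) gerDl (ltW s0) opprD addrA subrr add0r [_ * - s]mulrC.
by apply => // t /andP[? ?]; rewrite ler_norml; lra.
Qed.

(** The derivative is Lipschitz apart from its unit jump at [x], which lies between
[w] and [w + s] only if [|w - x| <= |s|]. *)
Lemma dstein_lip x w s : 0 <= x -> `|s| <= 1 ->
  `|dstein x (w + s) - dstein x w| <= `|s| * (kS * envel x w) + (`|w - x| <= `|s|)%R%:R.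
Proof.
move=> x0 s1; rewrite /dstein.
set a := _ * stein x (w + s); set b := w * stein x w.
have -> : a + (w + s <= x)%R%:R - Phi x - (b + (w <= x)%R%:R - Phi x) =
  (a - b) + ((w + s <= x)%R%:R - (w <= x)%R%:R) by ring.
apply: le_trans (ler_normD _ _) (lerD (stein_mul_lip _ x0 s1) _).
have hs : s <= `|s| by exact: ler_norm.
have hs' : - s <= `|s| by rewrite -normrN; exact: ler_norm.
case: (leP (w + s) x) => h1; case: (leP w x) => h2; rewrite ?subrr ?normr0//.
- rewrite subr0 normr1 (_ : `|w - x| <= `|s|)//.
  by rewrite ler_norml; apply/andP; split; lra.
- rewrite sub0r normrN normr1 (_ : `|w - x| <= `|s|)//.
  by rewrite ler_norml; apply/andP; split; lra.
Qed.

Lemma stein_taylor x w s : 0 <= x -> `|s| <= 1 ->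
  `|stein x (w + s) - stein x w - s * dstein x w| <=
  `|s| * (`|s| * (kS * envel x w) + (`|w - x| <= `|s|)%R%:R).
Proof.
move=> x0 s1.
set M := _ + _%:R.
have near t : `|t - w| <= `|s| -> `|dstein x t - dstein x w| <= M.
  move=> tw; have := @dstein_lip x w (t - w) x0 (le_trans tw s1).
  rewrite [w + _]addrC subrK => h; apply: le_trans h _; apply: lerD.
    apply: ler_wpM2r => //; apply: mulr_ge0 (envel_ge0 _ _).
    exact: mulr_ge0 (expR_ge0 _) cS_ge0.
  rewrite ler_nat; case: (boolP (`|w - x| <= `|t - w|)) => // h.
  by rewrite (le_trans h tw).
have key v u : v <= u -> (forall t, v < t < u -> `|t - w| <= `|s|) ->
    `|stein x u - stein x v - dstein x w * (u - v)| <= M * (u - v).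
  move=> vu tw.
  apply: (@piecewise_mvt x (stein x) (st1 x) (st2 x) _ _ _ _ v u (@stein1 x) (@stein2 x)
   (fun t => is_derive_st1 x t) (fun t => is_derive_st2 x t) vu).
  - move=> t /tw tw' tx; have := near _ tw'.
    rewrite (_ : dstein x t = t * st1 x t + tailN x)//.
    by rewrite /dstein stein1 (ltW tx)// -addrA.
  - move=> t /tw tw' tx; have := near _ tw'.
    rewrite (_ : dstein x t = t * st2 x t - Phi x)//.
    by rewrite /dstein stein2 ?(ltW tx)// leNgt tx addr0.
have [s0|s0] := leP 0 s.
  have := key w (w + s); rewrite lerDl s0 (_ : w + s - w = s); last by ring.
  rewrite [dstein x w * s]mulrC [M * s]mulrC (ger0_norm s0).
  apply => // t /andP[? ?]; rewrite ler_norml; lra.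
have := key (w + s) w; rewrite gerDl (ltW s0) opprD addrA subrr add0r.
rewrite (_ : stein x w - stein x (w + s) - dstein x w * - s =
   - (stein x (w + s) - stein x w - s * dstein x w)); last by ring.
rewrite normrN [M * _]mulrC (ltr0_norm s0).
apply => // t /andP[? ?]; rewrite ler_norml; lra.
Qed.

Lemma stein_eq x w : dstein x w - w * stein x w = (w <= x)%R%:R - Phi x.
Proof. by rewrite /dstein; ring. Qed.

Lemma measurable_stein x : measurable_fun [set: R] (stein x).
Proof.
apply: measurable_fun_ifT.
- exact: measurable_fun_ler.
- by apply: continuous_measurable_fun; exact: is_derive_continuous (is_derive_st1 x).
- by apply: continuous_measurable_fun; exact: is_derive_continuous (is_derive_st2 x).
Qed.

Lemma measurable_dstein x : measurable_fun [set: R] (dstein x).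
Proof.
apply: measurable_funB => //; apply: measurable_funD.
  by apply: measurable_funM => //; exact: measurable_stein.
rewrite (_ : (fun w => _) = (fun w => if w <= x then 1 else 0)).
  by apply: measurable_fun_ifT => //; exact: measurable_fun_ler.
by apply/funext => w; case: ifP.
Qed.

End Stein.

(** * Berry--Esseen bound for bounded summands *)

Lemma measurable_leb d (T : measurableType d) (R : realType) (f g : T -> R) :
  measurable_fun [set: T] f -> measurable_fun [set: T] g ->
  measurable_fun [set: T] (fun w => (f w <= g w)%R%:R : R).
Proof.
move=> mf mg; rewrite (_ : (fun w => _) = (fun w => if f w <= g w then 1 else 0)).
  by apply: measurable_fun_ifT => //; exact: measurable_fun_ler.
by apply/funext => w; case: ifP.
Qed.

Lemma bm_leb d (T : measurableType d) (R : realType) (f g : T -> R) :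
  measurable_fun [set: T] f -> measurable_fun [set: T] g ->
  bm (fun w => (f w <= g w)%R%:R : R).
Proof.
move=> mf mg; split; first exact: measurable_leb.
by exists 1 => w; case: (f w <= g w); rewrite ?normr1 ?normr0.
Qed.

Section BoundedBerryEsseen.
Context d (T : measurableType d) (R : realType) (P : probability T R).
Local Notation E := (Ex P).
Local Notation "G .-meas f" := (measurable_fun [set: g_sigma_algebraType G] (f : g_sigma_algebraType G -> _)) (at level 2).
Local Notation Phi := (@std_normal_cdf R).

Definition Cconc : R := 44 * expR 2 * Cexp R.

(** Integrate [a^2 b <= a^3 + b^3] in each of the two variables. *)
Lemma sqr_mul_abs_le (f : T -> R) : bm f ->
  E (fun w => f w ^+ 2) * E (fun w => `|f w|) <= 2 * E (fun w => `|f w| ^+ 3).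
Proof.
move=> bf.
have young (a b : R) : 0 <= a -> 0 <= b -> a ^+ 2 * b <= a ^+ 3 + b ^+ 3.
  move=> a0 b0; have [ab|ba] := leP a b.
    have : a ^+ 2 * b <= b ^+ 2 * b by rewrite ler_wpM2r// lerXn2r.
    have := exprn_ge0 3 a0; rewrite -exprSr; lra.
  have : a ^+ 2 * b <= a ^+ 2 * a by rewrite ler_wpM2l ?exprn_ge0// ltW.
  have := exprn_ge0 3 b0; rewrite -exprSr; lra.
set m3 := E (fun w => `|f w| ^+ 3).
have step b : 0 <= b -> E (fun w => f w ^+ 2) * b <= m3 + b ^+ 3.
  move=> b0; rewrite mulrC -ExZ; last by apply: bmL1; bmt.
  rewrite -[b ^+ 3](Excst P) -ExD; [|by apply: bmL1; bmt..].
  apply: Ex_le; [by apply: bmL1; bmt..|] => w.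
  by rewrite mulrC -real_normK ?num_real// young.
rewrite -ExZ; last by apply: bmL1; bmt.
apply: (@le_trans _ _ (E (fun w => m3 + `|f w| ^+ 3))).
  by apply: Ex_le => [| |w]; [by apply: bmL1; bmt..|exact: step].
rewrite ExD; [|by apply: bmL1; bmt..].
by rewrite Excst -/m3; lra.
Qed.

Context (K : nat) (G : nat -> set_system T) (z : nat -> T -> R) (beta : R).
Hypotheses (iz : indep_fam P K G z) (zb : forall i w, (i < K)%N -> `|z i w| <= 1).
Hypotheses (zm1 : \sum_(i < K) `|E (z i)| <= 1)
  (zv : \sum_(i < K) E (fun w => z i w ^+ 2) <= 1).
Let S w := \sum_(i < K) z i w.

Let bz i : (i < K)%N -> bm (z i).
Proof. exact: (bm_fam iz zb). Qed.

Let bS : bm S.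
Proof. exact: (bm_famS iz zb). Qed.

Lemma envel_moment x : E (fun w => envel x (S w)) <= 2 * Cexp R * expR (- x).
Proof.
rewrite /envel ExZ; last by apply: bmL1; bmt.
rewrite mulrC ler_wpM2r ?expR_ge0// ExD; [|by apply: bmL1; bmt..].
have h l := @exp_moment2 _ _ _ _ _ _ _ 1 iz zb (lexx 1) zm1 zv l.
have -> : (fun w => expR (- S w)) = (fun w => expR ((-1) * S w)).
  by apply/funext => w; rewrite mulN1r.
have h1 := h (-1); have h2 := h 2.
rewrite mulr_natl mulr2n; apply: lerD; [apply: h1|apply: h2].
  by rewrite normrN normr1; lra.
by rewrite ger0_norm.
Qed.

Hypotheses (beta0 : 0 < beta) (beta4 : beta <= 1 / 4)
  (zm : \sum_(i < K) `|E (z i)| <= beta)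
  (zvl : 1 - beta <= \sum_(i < K) E (fun w => z i w ^+ 2))
  (z3 : \sum_(i < K) E (fun w => `|z i w| ^+ 3) <= beta).

(** By [min (a, beta) >= a - a^2 / (4 beta)], the full sum has mean at least
[3/4 - beta], as the third moments add up to at most [beta]. The set [J] may omit
one index, at the cost of at most another [beta]: the bound is also needed for
sums without their [i]-th summand. *)
Lemma quad_mean_lb (J : pred 'I_K) : (forall i j, ~~ J i -> ~~ J j -> i = j) ->
  1 / 4 <= E (fun w => \sum_(i < K | J i) `|z i w| * Num.min `|z i w| beta).
Proof.
move=> J1.
pose t (u : R) := `|u| * Num.min `|u| beta.
have bt i : (i < K)%N -> bm (fun w => t (z i w)).
  by move=> iK; have := bz iK => ?; rewrite /t; bmt.
have [b0 b4] := conj beta0 beta4.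
have tot : 3 / 4 - beta <= \sum_(i < K) E (fun w => t (z i w)).
  apply: (@le_trans _ _ (\sum_(i < K) (E (fun w => z i w ^+ 2) -
      (4 * beta)^-1 * E (fun w => `|z i w| ^+ 3)))).
    rewrite sumrB -mulr_sumr.
    have : (4 * beta)^-1 * (\sum_(i < K) E (fun w => `|z i w| ^+ 3)) <= (4 * beta)^-1 * beta.
      by rewrite ler_wpM2l// invr_ge0 mulr_ge0// ltW.
    have -> : (4 * beta)^-1 * beta = 1 / 4 by field; rewrite gt_eqF.
    have := zvl; lra.
  apply: ler_sum => i _; have bi := bz (ltn_ord i); have bti := bt _ (ltn_ord i).
  rewrite -ExZ; last by apply: bmL1; bmt.
  rewrite -ExB; [|by apply: bmL1; bmt..].
  apply: Ex_le; [by apply: bmL1; bmt..|] => w; rewrite /t -real_normK ?num_real//.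
  have a0 := normr_ge0 (z i w); move: `|z i w| a0 => a a0.
  rewrite exprS [a ^+ 3]exprS mulrCA -mulrBr ler_wpM2l// expr1.
  have sq := sqr_ge0 (a - 2 * beta).
  have ib : 0 <= (4 * beta)^-1 by rewrite invr_ge0 mulr_ge0// ltW.
  rewrite le_min; apply/andP; split; first by rewrite gerBl mulr_ge0// sqr_ge0.
  rewrite -subr_ge0.
  have -> : beta - (a - (4 * beta)^-1 * a ^+ 2) = (4 * beta)^-1 * (a - 2 * beta) ^+ 2.
    by field; rewrite gt_eqF.
  by rewrite mulr_ge0.
rewrite Ex_sum; last by move=> i _; exact/bmL1/bt.
have [i0 Ji0|allJ] := pickP (fun i => ~~ J i); last first.
  rewrite (eq_bigl xpredT); last by move=> i; have := allJ i; case: (J i).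
  by apply: le_trans tot; lra.
have : \sum_(i < K) E (fun w => t (z i w)) =
   E (fun w => t (z i0 w)) + \sum_(i < K | J i) E (fun w => t (z i w)).
  rewrite (bigD1 i0)//=; congr (_ + _); apply: eq_bigl => i.
  by apply/idP/idP => [ii0|Ji]; [apply: contraNT ii0 => /J1 /(_ Ji0) ->|
    apply: contraNneq Ji0 => <-].
have : E (fun w => t (z i0 w)) <= beta.
  rewrite -[leRHS](Excst P); have bti := bt _ (ltn_ord i0).
  apply: Ex_le; [by apply: bmL1; bmt..|] => w.
  rewrite /t -[leRHS]mul1r; apply: ler_pM => //; last by rewrite ge_min lexx orbT.
    by rewrite le_min normr_ge0 ltW.
  exact: zb.
rewrite -/t; lra.
Qed.

(** Concentration with a deterministic radius for the sum without its [i]-th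
summand, whose quadratic form is still of order one by [quad_mean_lb]. *)
Lemma concentration_rem x i s : 0 <= x -> (i < K)%N -> 0 <= s <= 1 ->
  fine (P [set w | `|S w - z i w - x| <= s]) <=
  Cconc * expR (- (x / 4)) * (beta + s).
Proof.
move=> x0 iK /andP[s0 s1]; have [b0 b4] := conj beta0 beta4.
pose t j (u : R) := if j != i then u else 0.
pose z' j w := t j (z j w).
have iz' : indep_fam P K G z'.
  by apply: indep_fam_comp => // j; rewrite /t; case: (j != i).
have zb' j w : (j < K)%N -> `|z' j w| <= 1.
  by move=> jK; rewrite /z' /t; case: ifP => _; [exact: zb|rewrite normr0].
have S' w : \sum_(j < K) z' j w = S w - z i w.
  rewrite /S [in RHS](bigD1 (Ordinal iK))//= addrAC subrr add0r [RHS]big_mkcond/=.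
  by apply: eq_bigr => j _; rewrite /z' /t -val_eqE/=.
have := @concentration _ _ _ P K G z' beta iz' zb' (ltW beta0) _ _ _ x s (fun=> s)
  (fun=> fun=> s) (fun=> 0) x0.
under eq_set do rewrite S'.
apply => //; rewrite ?Excst//.
- lra.
- apply: le_trans zm; apply: ler_sum => j _; rewrite /z' /t; case: (nat_of_ord j != i) => //.
  by rewrite Excst normr0.
- apply: le_trans zv; apply: ler_sum => j _; rewrite /z' /t; case: (nat_of_ord j != i) => //.
  by rewrite expr0n Excst; apply: Ex_ge0 => w; exact: sqr_ge0.
- have := @quad_mean_lb (fun j => j != Ordinal iK).
  rewrite (_ : (fun w => \sum_(j < K | _) _) = (fun w =>
     \sum_(j < K) `|z' j w| * Num.min `|z' j w| beta)).
    apply => j k; rewrite !negbK => /eqP -> /eqP ->//.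
  apply/funext => w; rewrite big_mkcond; apply: eq_bigr => j _.
  rewrite /z' /t -val_eqE/=; case: ifP => // _; first by rewrite normr0 mul0r.
- by move=> w; rewrite s0/=; lra.
- by move=> j w _; rewrite s0/=; lra.
- by move=> j _; rewrite subrr.
- by rewrite big1.
Qed.

(** The radius [|z_i|] is independent of the remaining sum and can be frozen. *)
Lemma concentration_weighted x i (a : R -> R) : 0 <= x -> (i < K)%N ->
  measurable_fun [set: R] a -> (forall u, 0 <= a u <= 1) ->
  E (fun w => a (z i w) * (`|S w - z i w - x| <= `|z i w|)%R%:R) <=
  Cconc * expR (- (x / 4)) * (beta * E (fun w => a (z i w)) + E (fun w => a (z i w) * `|z i w|)).
Proof.
move=> x0 iK ma a01; have [b0 b4] := conj beta0 beta4.
have [Gm mz zi Gz] := iz iK; have bzi := bz iK.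
have ba : bm (fun w => a (z i w)).
  split; first exact: measurableT_comp.
  by exists 1 => w; have /andP[? ?] := a01 (z i w); rewrite ger0_norm.
pose h w (u : R) := a u * (`|S w - z i w - x| <= Num.min `|u| 1)%R%:R.
pose k (u : R) := a u * (Cconc * expR (- (x / 4)) * (beta + Num.min `|u| 1)).
have min1 w : Num.min `|z i w| 1 = `|z i w| by rewrite min_l// zb.
have C0 : 0 <= Cconc * expR (- (x / 4)).
  by rewrite !mulr_ge0 ?expR_ge0//; have := Cexp_ge1 R; lra.
have bk : bm (fun w => k (z i w)) by rewrite /k; bmt.
have mmin : measurable_fun [set: R] (fun u : R => Num.min `|u| 1).
  by apply: measurable_minr => //; exact: normr_measurable.
have [] := @indep_freeze _ _ _ P (G i) _ _ (z i) Gm mz zi h k 1.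
- apply: measurable_funM; first exact: measurableT_comp.
  apply: measurable_leb; last exact: (measurableT_comp mmin measurable_snd).
  apply: measurableT_comp; first exact: normr_measurable.
  apply: measurable_funB => //.
  exact: (measurableT_comp (meas_sum_rem iz iK) measurable_fst).
- move=> w u; have /andP[a0 a1] := a01 u.
  by rewrite /h; case: (`|S w - z i w - x| <= _); rewrite ?mulr1 ?mulr0 ?a0 ?lexx ?ler01.
- exact: bmL1.
- move=> u; rewrite /h /k; have /andP[a0 a1] := a01 u.
  rewrite ExZ; last first.
    by apply: bmL1; apply: bm_leb => //; apply: bmm; bmt.
  rewrite ler_wpM2l//.
  have m01 : 0 <= Num.min `|u| 1 <= 1 by rewrite le_min normr_ge0 ler01 ge_min lexx orbT.
  apply: le_trans (concentration_rem x0 iK m01).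
  rewrite -Ex_indic; last by apply: measurable_le_set => //; apply: bmm; bmt.
  rewrite le_eqVlt; apply/orP; left; apply/eqP; congr Ex; apply/funext => w.
  rewrite indicE; congr (_%:R); congr nat_of_bool.
  by apply/idP/idP => [h'|]; [rewrite inE|rewrite inE].
move=> _; rewrite /h /k.
have -> : (fun w => a (z i w) * (`|S w - z i w - x| <= Num.min `|z i w| 1)%R%:R) =
  (fun w => a (z i w) * (`|S w - z i w - x| <= `|z i w|)%R%:R).
  by apply/funext => w; rewrite min1.
move=> /le_trans; apply.
have -> : (fun v => a (z i v) * (Cconc * expR (- (x / 4)) * (beta + Num.min `|z i v| 1))) =
  (fun v => (Cconc * expR (- (x / 4))) * (beta * a (z i v) + a (z i v) * `|z i v|)).
  by apply/funext => w; rewrite min1; ring.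
rewrite ExZ; last by apply: bmL1; bmt.
rewrite ExD; [|by apply: bmL1; bmt..].
by rewrite ExZ//; exact: bmL1.
Qed.

Definition Cbe : R := 2 * kS R * Cexp R * (2 + 3 * expR 2) + 5 * Cconc.

(** Let [S_i] be the sum without [z_i] and [f] the Stein solution. Up to second
order, [z_i f(S)] is [z_i f(S_i) + z_i^2 f'(S_i)], whose expectation factorises
into [E z_i E f(S_i) + E z_i^2 E f'(S_i)]. The first terms are small with the
means, and the second ones add up to nearly [E f'(S)], so [E (f'(S) - S f(S))] is
small; by the Stein equation it is the difference of the tails. The smooth part
of the errors is bounded by the envelope, and the jump of [f'] by
concentration. *)
Lemma stein_berry_esseen x : 0 <= x ->
  `|fine (P [set w | x < S w]) - tailN x| <= Cbe * expR (- (x / 4)) * beta.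
Proof.
move=> x0; have [b0 b4] := conj beta0 beta4; have C1 := Cexp_ge1 R.
pose f := stein x; pose D := dstein x.
have k0 : 0 <= kS R by rewrite mulr_ge0 ?expR_ge0 ?cS_ge0.
have bounded_env (g : R -> R) (h : T -> R) : measurable_fun [set: R] g -> bm h ->
    (forall t, `|g t| <= cS R * envel x t) -> bm (fun w => g (h w)).
  move=> mg [mh [c hc]] gE; split; first exact: measurableT_comp.
  exists (cS R * (expR (- x) * (expR c + expR (2 * c)))) => w.
  apply: le_trans (gE _) _; rewrite ler_wpM2l ?cS_ge0// ler_wpM2l ?expR_ge0//.
  have := hc w; rewrite ler_norml => /andP[h1 h2].
  apply: lerD; rewrite ler_expR; lra.
have mf := @measurable_stein R x; have mD := @measurable_dstein R x.
have fE t : `|f t| <= cS R * envel x t.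
  by have [/andP[f0 f1] _] := @stein_bounds R x t x0; rewrite ger0_norm.
have DE t : `|D t| <= cS R * envel x t by have [_] := @stein_bounds R x t x0.
have bfS : bm (fun w => f (S w)) by exact: bounded_env.
have bDS : bm (fun w => D (S w)) by exact: bounded_env.
pose V : R := 2 * kS R * Cexp R.
have V0 : 0 <= V by apply: mulr_ge0; [apply: mulr_ge0|lra].
pose ex : R := expR (- (x / 4)).
have ex0 : 0 < ex by exact: expR_gt0.
have benvel : bm (fun w => envel x (S w)) by rewrite /envel; bmt.
have EV : kS R * E (fun w => envel x (S w)) <= V * ex.
  apply: (@le_trans _ _ (kS R * (2 * Cexp R * expR (- x)))).
    by rewrite ler_wpM2l// envel_moment.
  have : expR (- x) <= ex by rewrite ler_expR; lra.
  have -> : kS R * (2 * Cexp R * expR (- x)) = V * expR (- x) by rewrite /V; ring.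
  by move=> h; rewrite ler_wpM2l.
have C0 : 0 <= Cconc by rewrite !mulr_ge0 ?expR_ge0//; lra.
have main : E (fun w => D (S w)) - E (fun w => S w * f (S w)) =
    tailN x - fine (P [set w | x < S w]).
  rewrite -ExB; [|by apply: bmL1; bmt..].
  have -> : (fun w => D (S w) - S w * f (S w)) =
            (fun w => tailN x - \1_[set w | x < S w] w).
    apply/funext => w; rewrite /D /f stein_eq /tailN indicE.
    case: leP => h.
      by rewrite memNset ?subr0//= => /lt_geF; rewrite h.
    by rewrite mem_set//= mulr0n; ring.
  have mA : measurable [set w | x < S w] by apply: measurable_lt_set => //; exact: bmm.
  by rewrite ExB ?Excst ?Ex_indic//; apply: bmL1 => //; exact: bm_indic.
rewrite distrC -main.
pose Si i w := S w - z i w.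
have bSi i : (i < K)%N -> bm (Si i).
  by move=> iK; have := bz iK => ?; rewrite /Si; bmt.
have envel_i i w : (i < K)%N -> envel x (Si i w) <= expR 2 * envel x (S w).
  move=> iK; apply: envel_shift; rewrite /Si addrAC subrr add0r normrN; exact: zb.
have cSk t t' : envel x t <= expR 2 * envel x t' -> cS R * envel x t <= kS R * envel x t'.
  move=> h; have -> : kS R * envel x t' = cS R * (expR 2 * envel x t') by rewrite /kS; ring.
  by rewrite ler_wpM2l ?cS_ge0.
pose ind i w : R := (`|S w - z i w - x| <= `|z i w|)%R%:R.
have bind i : (i < K)%N -> bm (ind i).
  by move=> iK; have := bz iK => ?; apply: bm_leb; apply: bmm; bmt.
have C1i i (a : R -> R) (iK : (i < K)%N) (ma : measurable_fun [set: R] a)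
  (a01 : forall u, 0 <= a u <= 1) := concentration_weighted x0 iK ma a01.
pose m1 i := `|E (z i)|.
pose m2 i := E (fun w => z i w ^+ 2).
pose m3 i := E (fun w => `|z i w| ^+ 3).
have term i : (i < K)%N ->
  `|E (fun w => z i w * f (S w)) - m2 i * E (fun w => D (S w))| <=
  ex * (m1 i * V + m3 i * (3 * expR 2 * V + 3 * Cconc) + m2 i * (2 * Cconc * beta)).
  move=> iK; have bzi := bz iK; have bSii := bSi _ iK; have bi := bind _ iK.
  have [Gm mz zi Gz] := iz iK.
  have bfi : bm (fun w => f (Si i w)) by exact: bounded_env.
  have bDi : bm (fun w => D (Si i w)) by exact: bounded_env.
  have benvi : bm (fun w => envel x (Si i w)) by rewrite /envel; bmt.
  have mSi := meas_sum_rem iz iK.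
  have Eenvi : kS R * E (fun w => envel x (Si i w)) <= expR 2 * V * ex.
    apply: (@le_trans _ _ (kS R * E (fun w => expR 2 * envel x (S w)))).
      rewrite ler_wpM2l//; apply: Ex_le; [by apply: bmL1; bmt..|] => w.
      exact: envel_i.
    rewrite ExZ; last exact: bmL1.
    by rewrite mulrCA -mulrA ler_wpM2l ?expR_ge0.
  have i1 : E (fun w => f (Si i w) * z i w) = E (fun w => f (Si i w)) * E (z i).
    have [] := indep_mul Gm mz zi (f := fun w => f (Si i w)) (g := id) => //.
    - exact: measurableT_comp.
    - exact: bmL1.
    - exact: bmL1.
  have i2 : E (fun w => D (Si i w) * z i w ^+ 2) = E (fun w => D (Si i w)) * m2 i.
    have [] := indep_mul Gm mz zi (f := fun w => D (Si i w)) (g := fun u => u ^+ 2) => //.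
    - exact: measurableT_comp.
    - exact: bmL1.
    - by apply: bmL1; bmt.
  have i3 : E (fun w => envel x (Si i w) * `|z i w| ^+ 3) = E (fun w => envel x (Si i w)) * m3 i.
    have [] := indep_mul Gm mz zi (f := fun w => envel x (Si i w)) (g := fun u => `|u| ^+ 3) => //.
    - apply: measurable_funM => //; apply: measurable_funD; apply: measurableT_comp => //.
        exact: measurable_funN.
      exact: measurable_funM.
    - apply: measurable_funX; exact: normr_measurable.
    - exact: bmL1.
    - by apply: bmL1; bmt.
  have i4 : E (fun w => envel x (Si i w) * `|z i w|) =
      E (fun w => envel x (Si i w)) * E (fun w => `|z i w|).
    have [] := indep_mul Gm mz zi (f := fun w => envel x (Si i w)) (g := fun u => `|u|) => //.
    - apply: measurable_funM => //; apply: measurable_funD; apply: measurableT_comp => //.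
        exact: measurable_funN.
      exact: measurable_funM.
    - exact: bmL1.
    - by apply: bmL1; bmt.
  have m30 : 0 <= m3 i by apply: Ex_ge0 => w; rewrite exprn_ge0.
  have m20 : 0 <= m2 i by apply: Ex_ge0 => w; rewrite sqr_ge0.
  have m23 : m2 i * E (fun w => `|z i w|) <= 2 * m3 i by exact: sqr_mul_abs_le.
  have Eind2 : E (fun w => z i w ^+ 2 * ind i w) <= Cconc * ex * (beta * m2 i + m3 i).
    have := C1i i (fun u => Num.min (u ^+ 2) 1) iK.
    have min2 w : Num.min (z i w ^+ 2) 1 = z i w ^+ 2.
      by rewrite min_l// -real_normK ?num_real// exprn_ile1// zb.
    rewrite (_ : (fun w => _ * `|z i w|) = (fun w => `|z i w| ^+ 3)); last first.
      by apply/funext => w; rewrite min2 -real_normK ?num_real// -exprSr.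
    rewrite (_ : (fun w => _ * ind _ _) = (fun w => z i w ^+ 2 * ind i w)); last first.
      by apply/funext => w; rewrite min2.
    rewrite (_ : (fun w => Num.min _ _) = (fun w => z i w ^+ 2)); last first.
      by apply/funext => w; rewrite min2.
    apply.
      by apply: measurable_minr => //; exact: exprn_measurable.
    by move=> u; rewrite le_min sqr_ge0 ler01 ge_min lexx orbT.
  have Eind1 : E (ind i) <= Cconc * ex * (beta + E (fun w => `|z i w|)).
    have := C1i i (fun=> 1) iK.
    rewrite (_ : (fun w => _ * `|z i w|) = (fun w => `|z i w|)); last first.
      by apply/funext => w; rewrite mul1r.
    rewrite (_ : (fun w => _ * ind _ _) = ind i); last by apply/funext => w; rewrite mul1r.
    rewrite Excst mulr1; apply => // u; by rewrite ler01 lexx.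
  have r1 : `|E (fun w => z i w * f (S w)) - (E (fun w => f (Si i w) * z i w) +
      E (fun w => D (Si i w) * z i w ^+ 2))| <=
      kS R * E (fun w => envel x (Si i w) * `|z i w| ^+ 3) + E (fun w => z i w ^+ 2 * ind i w).
    rewrite -ExD; [|by apply: bmL1; bmt..].
    rewrite -ExB; [|by apply: bmL1; bmt..].
    apply: le_trans (Ex_norm _) _; first by apply: bmL1; bmt.
    rewrite -ExZ; last by apply: bmL1; bmt.
    rewrite -ExD; [|by apply: bmL1; bmt..].
    apply: Ex_le; [by apply: bmL1; bmt..|] => w.
    have -> : z i w * f (S w) - (f (Si i w) * z i w + D (Si i w) * z i w ^+ 2) =
      z i w * (f (Si i w + z i w) - f (Si i w) - z i w * D (Si i w)).
      by rewrite /Si subrK; ring.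
    rewrite normrM; apply: le_trans (ler_wpM2l _ (stein_taylor _ x0 (zb _ iK))) _ => //.
    rewrite -/(ind i w) -(real_normK (num_real (z i w))) le_eqVlt; apply/orP; left; apply/eqP.
    by rewrite /ind /Si; ring.
  have r2 : `|E (fun w => D (S w)) - E (fun w => D (Si i w))| <=
      kS R * E (fun w => envel x (Si i w) * `|z i w|) + E (ind i).
    rewrite -ExB; [|exact: bmL1..].
    apply: le_trans (Ex_norm _) _; first by apply: bmL1; bmt.
    rewrite -ExZ; last by apply: bmL1; bmt.
    rewrite -ExD; [|by apply: bmL1; bmt..].
    apply: Ex_le; [by apply: bmL1; bmt..|] => w.
    have -> : D (S w) = D (Si i w + z i w) by rewrite /Si subrK.
    apply: le_trans (dstein_lip _ x0 (zb _ iK)) _.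
    by rewrite le_eqVlt; apply/orP; left; apply/eqP; rewrite /ind /Si; ring.
  have r0 : `|E (fun w => f (Si i w))| <= V * ex.
    apply: le_trans (Ex_norm _) _; first exact: bmL1.
    apply: le_trans EV; rewrite -ExZ; last exact: bmL1.
    apply: Ex_le; [by apply: bmL1; bmt..|] => w.
    by apply: le_trans (fE _) _; apply: cSk; exact: envel_i.
  have r1' : kS R * E (fun w => envel x (Si i w) * `|z i w| ^+ 3) <= expR 2 * V * ex * m3 i.
    by rewrite i3 mulrA ler_wpM2r.
  have r2' : m2 i * (kS R * E (fun w => envel x (Si i w) * `|z i w|)) <=
      expR 2 * V * ex * (2 * m3 i).
    rewrite i4; have -> : forall a b c e : R, a * (b * (c * e)) = (b * c) * (a * e).
      by move=> *; ring.
    apply: ler_pM => //; apply: mulr_ge0 => //; apply: Ex_ge0 => w //.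
    exact: envel_ge0.
  have r2'' : m2 i * E (ind i) <= Cconc * ex * (beta * m2 i + 2 * m3 i).
    apply: (@le_trans _ _ (m2 i * (Cconc * ex * (beta + E (fun w => `|z i w|))))).
      by rewrite ler_wpM2l.
    have -> : m2 i * (Cconc * ex * (beta + E (fun w => `|z i w|))) =
      Cconc * ex * (beta * m2 i + m2 i * E (fun w => `|z i w|)) by ring.
    by rewrite (ler_wpM2l (mulr_ge0 C0 (ltW ex0)))// lerD2l.
  rewrite i1 i2 in r1.
  have r0' : `|E (fun w => f (Si i w)) * E (z i)| <= V * ex * m1 i.
    by rewrite normrM ler_wpM2r.
  have r2c : `|m2 i * (E (fun w => D (S w)) - E (fun w => D (Si i w)))| <=
     m2 i * (kS R * E (fun w => envel x (Si i w) * `|z i w|) + E (ind i)).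
    by rewrite normrM (ger0_norm m20) ler_wpM2l.
  rewrite [leRHS]mulrDr in r2c.
  set a := E (fun w => z i w * f (S w)) in r1 *.
  set b := E (fun w => f (Si i w)) * E (z i) in r1 r0' *.
  set c := E (fun w => D (Si i w)) in r1 r2c *.
  set e := E (fun w => D (S w)) in r2c *.
  have -> : a - m2 i * e = (a - (b + c * m2 i)) + b - m2 i * (e - c) by ring.
  apply: le_trans (ler_normB _ _) _.
  apply: le_trans (lerD (ler_normD _ _) (lexx _)) _.
  lra.
have sumE : E (fun w => S w * f (S w)) = \sum_(i < K) E (fun w => z i w * f (S w)).
  rewrite -Ex_sum.
    by congr Ex; apply/funext => w; rewrite /S mulr_suml.
  by move=> i _; have := bz (ltn_ord i) => ?; apply: bmL1; bmt.
have D1 : `|E (fun w => D (S w))| <= V * ex.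
  apply: le_trans (Ex_norm _) _; first exact: bmL1.
  apply: le_trans EV; rewrite -ExZ; last exact: bmL1.
  apply: Ex_le; [by apply: bmL1; bmt..|] => w.
  apply: le_trans (DE _) _; apply: cSk; rewrite ler_peMl ?envel_ge0//.
  by have := expR_ge1Dx (2 : R); lra.
set e := E (fun w => D (S w)) in term D1 *.
rewrite sumE.
have -> : e - \sum_(i < K) E (fun w => z i w * f (S w)) =
  (1 - \sum_(i < K) m2 i) * e - \sum_(i < K) (E (fun w => z i w * f (S w)) - m2 i * e).
  by rewrite sumrB -mulr_suml; ring.
apply: le_trans (ler_normB _ _) _.
have p1 : `|(1 - \sum_(i < K) m2 i) * e| <= beta * (V * ex).
  rewrite normrM; apply: ler_pM => //; rewrite ger0_norm ?subr_ge0//.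
  by rewrite lerBlDr -lerBlDl.
have p2 : `|\sum_(i < K) (E (fun w => z i w * f (S w)) - m2 i * e)| <=
   ex * (beta * V + beta * (3 * expR 2 * V + 3 * Cconc) + 1 * (2 * Cconc * beta)).
  apply: le_trans (ler_norm_sum _ _ _) _.
  apply: (@le_trans _ _ (\sum_(i < K) ex * (m1 i * V +
      m3 i * (3 * expR 2 * V + 3 * Cconc) + m2 i * (2 * Cconc * beta)))).
    by apply: ler_sum => i _; exact: term.
  rewrite -mulr_sumr ler_wpM2l ?(ltW ex0)// !big_split/= -!mulr_suml.
  have e2 := expR_ge0 (2 : R).
  have V3 : 0 <= 3 * expR 2 * V + 3 * Cconc.
    by apply: addr_ge0; [apply: mulr_ge0 => //; exact: mulr_ge0|exact: mulr_ge0].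
  have Cb : 0 <= 2 * Cconc * beta by apply: mulr_ge0; [exact: mulr_ge0|exact: ltW].
  by apply: lerD; [apply: lerD|]; rewrite ler_wpM2r.
apply: le_trans (lerD p1 p2) _.
rewrite /Cbe -/V -/ex le_eqVlt; apply/orP; left; apply/eqP; ring.
Qed.

End BoundedBerryEsseen.

(** * Nonlinear Berry--Esseen bound *)

Section Truncation.
Context (R : realType) (delta : R).
Implicit Types u : R.

Definition trunc u : R := u * (`|u| <= 1)%R%:R.

Lemma truncE u : trunc u = if `|u| <= 1 then u else 0.
Proof. by rewrite /trunc; case: ifP; rewrite ?mulr1 ?mulr0. Qed.

Lemma measurable_trunc : measurable_fun [set: R] trunc.
Proof.
apply: measurable_funM => //; apply: measurable_leb => //; exact: normr_measurable.
Qed.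

Lemma trunc_le1 u : `|trunc u| <= 1.
Proof. by rewrite truncE; case: ifP => //; rewrite normr0. Qed.

Lemma trunc_sqr_le u : trunc u ^+ 2 <= u ^+ 2.
Proof. by rewrite truncE; case: ifP => //; rewrite expr0n sqr_ge0. Qed.

Hypothesis delta01 : 0 < delta <= 1.

Lemma large_pow n u : (n <= 2)%N -> 1 <= `|u| -> `|u| ^+ n <= `|u| `^ (2 + delta).
Proof.
move=> n2 u1; rewrite -powR_mulrn//; apply: ler_powR => //.
have /andP[d0 d1] := delta01.
have : n%:R <= 2 :> R by rewrite ler_nat.
lra.
Qed.

Lemma small_pow u : `|u| <= 1 -> `|u| ^+ 3 <= `|u| `^ (2 + delta).
Proof.
move=> u1; have /andP[d0 d1] := delta01.
have [->|u0] := eqVneq u 0; first by rewrite normr0 expr0n powR_ge0.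
rewrite -powR_mulrn//; apply: ger_powR; first by rewrite u1 normr_gt0 u0.
lra.
Qed.

Lemma trunc_bias u : `|u - trunc u| <= `|u| `^ (2 + delta).
Proof.
rewrite truncE; case: ifP => [_|/negbT]; first by rewrite subrr normr0 powR_ge0.
rewrite -ltNge subr0 => u1; rewrite -[X in X <= _]expr1.
by apply: large_pow => //; exact: ltW.
Qed.

Lemma trunc_bias_sqr u : `|u - trunc u| <= u ^+ 2.
Proof.
rewrite truncE; case: ifP => [_|/negbT]; first by rewrite subrr normr0 sqr_ge0.
rewrite -ltNge subr0 => u1; rewrite -(real_normK (num_real u)) expr2 ler_peMl//.
exact: ltW.
Qed.

Lemma trunc_sqr_loss u : u ^+ 2 - trunc u ^+ 2 <= `|u| `^ (2 + delta).
Proof.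
rewrite truncE; case: ifP => [_|/negbT]; first by rewrite subrr powR_ge0.
rewrite -ltNge expr0n subr0 => u1; rewrite -(real_normK (num_real u)).
by apply: large_pow => //; exact: ltW.
Qed.

Lemma trunc_cube u : `|trunc u| ^+ 3 <= `|u| `^ (2 + delta).
Proof.
rewrite truncE; case: ifP => [u1|_]; first exact: small_pow.
by rewrite normr0 expr0n powR_ge0.
Qed.

End Truncation.

Section PointwiseBounds.
Context (R : realType).
Implicit Types x t y : R.

Lemma large_remainder_le x (D : R) : 0 <= x -> 1 + x / 4 < `|D| -> 1 <= 16 / (1 + x ^+ 2) * D ^+ 2.
Proof.
move=> x0 hD; have p0 : 0 < 1 + x ^+ 2 by rewrite ltr_wpDr// sqr_ge0.
rewrite mulrAC ler_pdivlMr// mul1r -(real_normK (num_real D)).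
have : (1 + x / 4) ^+ 2 <= `|D| ^+ 2 by rewrite lerXn2r ?nnegrE// ?ltW//; lra.
nra.
Qed.

Lemma far_from_threshold t x (D : R) : `|D| < `|t - x| ->
  (x <= t + D -> x < t) /\ (x < t -> x < t + D).
Proof.
have := ler_norm D; have := ler_norm (- D); rewrite normrN.
by case: (ler0P (t - x)); split; lra.
Qed.

(** If [t + D] exceeds [x] with [D] at most [1 + x / 4], then [y] or [t - y] is of
order [x]; the square of [y] is absorbed by [A]. *)
Lemma large_rest_le x t y (D A : R) : 0 <= x -> `|D| <= 1 + x / 4 -> x <= t + D ->
  1 <= A -> y ^+ 2 <= A -> 1 <= 7 / (1 + x ^+ 2) * (A * (2 + (t - y) ^+ 2)).
Proof.
move=> x0 hD xt A1 yA; have p0 : 0 < 1 + x ^+ 2 by rewrite ltr_wpDr// sqr_ge0.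
rewrite mulrAC ler_pdivlMr// mul1r; have D1 := ler_norm D.
set u := t - y; have tE : t = y + u by rewrite /u; ring.
have hx : 3 * x / 4 - 1 <= y + u by lra.
have q1 : (3 * x / 4) ^+ 2 <= 3 * (1 + y ^+ 2 + u ^+ 2).
  have : (3 * x / 4) ^+ 2 <= (1 + y + u) ^+ 2 by rewrite lerXn2r ?nnegrE//; lra.
  have := sqr_ge0 (y - u); have := sqr_ge0 (y - 1); have := sqr_ge0 (u - 1).
  nra.
have u2 := sqr_ge0 u.
nra.
Qed.

Lemma constants_le (Cc Cb eC e beta b : R) : 0 <= Cc -> 0 <= Cb -> 0 <= eC -> 0 <= e ->
  0 <= beta -> 0 <= b ->
  16 * b ^+ 2 + 64 * Cc * (beta + b) + (21 + 4 * eC) * beta + 64 * Cb * beta <=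
  (64 * (Cb + Cc + eC + 1) + 16 * e + 200) * (beta + b + b ^+ 2).
Proof.
move=> Cc0 Cb0 eC0 e0 be0 b0; have bb := sqr_ge0 b.
have := (mulr_ge0 Cb0 b0, mulr_ge0 Cb0 bb, mulr_ge0 Cc0 bb, mulr_ge0 eC0 b0).
have := (mulr_ge0 eC0 bb, mulr_ge0 e0 b0, mulr_ge0 e0 bb, mulr_ge0 eC0 be0, mulr_ge0 e0 be0).
move=> [[[[h1 h2] h3] h4] h5] [[[h6 h7] h8] h9]; lra.
Qed.

End PointwiseBounds.

Section NonlinearBerryEsseen.
Context d (T : measurableType d) (R : realType) (P : probability T R).
Local Notation E := (Ex P).
Local Notation "G .-meas f" := (measurable_fun [set: g_sigma_algebraType G] (f : g_sigma_algebraType G -> _)) (at level 2).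

Definition Cnl : R := 64 * (Cbe R + Cconc R + expR 1 * Cexp R + 1) + 16 * expR 1 + 200.

Lemma quad_exp_inv (x : R) : 0 <= x -> expR (- x) <= 4 / (1 + x ^+ 2).
Proof.
move=> x0; have := quad_le_exp x0; rewrite expRN => h.
have p0 : 0 < 1 + x ^+ 2 by rewrite ltr_wpDr// sqr_ge0.
by rewrite -div1r ler_pdivlMr// mul1r mulrC ler_pdivrMr ?expR_gt0.
Qed.

Lemma quad_exp_inv4 (x : R) : 0 <= x -> expR (- (x / 4)) <= 64 / (1 + x ^+ 2).
Proof.
move=> x0; have x40 : 0 <= x / 4 by rewrite divr_ge0.
apply: le_trans (quad_exp_inv x40) _.
have p0 : 0 < 1 + x ^+ 2 by rewrite ltr_wpDr// sqr_ge0.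
have p1 : 0 < 1 + (x / 4) ^+ 2 by rewrite ltr_wpDr// sqr_ge0.
rewrite ler_pdivrMr// mulrAC ler_pdivlMr//.
have := sqr_ge0 x; rewrite expr_div_n; lra.
Qed.

Context (K : nat) (G : nat -> set_system T) (xi : nat -> T -> R) (delta beta : R).
Hypotheses (ixi : indep_fam P K G xi) (delta01 : 0 < delta <= 1) (beta0 : 0 < beta)
  (xi1 : forall i, (i < K)%N -> L1 P (xi i))
  (xi2 : forall i, (i < K)%N -> L1 P (fun w => xi i w ^+ 2))
  (xia : forall i, (i < K)%N -> L1 P (fun w => `|xi i w| `^ (2 + delta)))
  (xi0 : forall i, (i < K)%N -> E (xi i) = 0)
  (xiv : \sum_(i < K) E (fun w => xi i w ^+ 2) = 1)
  (xib : \sum_(i < K) E (fun w => `|xi i w| `^ (2 + delta)) <= beta).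
Context (Dl : T -> R) (Di : nat -> T -> R) (b : R) (di : nat -> R).
Hypotheses (b0 : 0 <= b) (mDl : measurable_fun [set: T] Dl)
  (mDi : forall i, (i < K)%N -> (G i).-meas (Di i))
  (Dl2 : L1 P (fun w => Dl w ^+ 2)) (Dlb : E (fun w => Dl w ^+ 2) <= b ^+ 2)
  (di0 : forall i, (i < K)%N -> 0 <= di i)
  (Di2 : forall i, (i < K)%N -> L1 P (fun w => (Dl w - Di i w) ^+ 2))
  (Dib : forall i, (i < K)%N -> E (fun w => (Dl w - Di i w) ^+ 2) <= di i ^+ 2)
  (dib : \sum_(i < K) di i <= b).
Let T_ w := \sum_(i < K) xi i w.
Let z i w := trunc (xi i w).
Let S w := \sum_(i < K) z i w.
Let a i w := `|xi i w| `^ (2 + delta).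

Let iz : indep_fam P K G z.
Proof.
exact: (@indep_fam_comp _ _ _ P K G xi (fun _ u => trunc u) (fun _ => @measurable_trunc R) ixi).
Qed.

Let zb i w : (i < K)%N -> `|z i w| <= 1.
Proof. by move=> _; exact: trunc_le1. Qed.

Let bz i : (i < K)%N -> bm (z i).
Proof. exact: (bm_fam iz zb). Qed.

Let bS : bm S.
Proof. exact: (bm_famS iz zb). Qed.

Let a_ge0 i w : 0 <= a i w. Proof. exact: powR_ge0. Qed.

Let Ez i : (i < K)%N -> `|E (z i)| = `|E (fun w => xi i w - z i w)|.
Proof.
by move=> iK; rewrite ExB ?xi0 ?sub0r ?normrN//; [exact: xi1|exact/bmL1/bz].
Qed.

Let L1xz i : (i < K)%N -> L1 P (fun w => xi i w - z i w).
Proof. by move=> iK; apply: L1D; [exact: xi1|apply/L1N/bmL1/bz]. Qed.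

Let zm : \sum_(i < K) `|E (z i)| <= beta.
Proof.
apply: le_trans xib; apply: ler_sum => i _; rewrite Ez//.
apply: le_trans (Ex_norm (L1xz (ltn_ord i))) _.
apply: Ex_le; [exact/L1_norm/L1xz|exact: xia|] => w.
exact: trunc_bias.
Qed.

Let zm1 : \sum_(i < K) `|E (z i)| <= 1.
Proof.
rewrite -xiv; apply: ler_sum => i _; rewrite Ez//.
apply: le_trans (Ex_norm (L1xz (ltn_ord i))) _.
apply: Ex_le; [exact/L1_norm/L1xz|exact: xi2|] => w.
exact: trunc_bias_sqr.
Qed.

Let bz2 i : (i < K)%N -> L1 P (fun w => z i w ^+ 2).
Proof. by move=> iK; have := bz iK => ?; apply: bmL1; bmt. Qed.

Let zv : \sum_(i < K) E (fun w => z i w ^+ 2) <= 1.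
Proof.
rewrite -xiv; apply: ler_sum => i _.
apply: Ex_le; [exact: bz2|exact: xi2|] => w; exact: trunc_sqr_le.
Qed.

Let zvl : 1 - beta <= \sum_(i < K) E (fun w => z i w ^+ 2).
Proof.
rewrite lerBlDr -lerBlDl -xiv -sumrB; apply: le_trans xib; apply: ler_sum => i _.
rewrite -ExB; [|exact: xi2|exact: bz2].
apply: Ex_le; [by apply: L1D; [exact: xi2|apply: L1N; exact: bz2]|exact: xia|] => w.
exact: trunc_sqr_loss.
Qed.

Let z3 : \sum_(i < K) E (fun w => `|z i w| ^+ 3) <= beta.
Proof.
apply: le_trans xib; apply: ler_sum => i _; have := bz (ltn_ord i) => bzi.
apply: Ex_le; [by apply: bmL1; bmt|exact: xia|] => w; exact: trunc_cube.
Qed.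

Let var_rem i : (i < K)%N -> L1 P (fun w => (T_ w - xi i w) ^+ 2) /\
  E (fun w => (T_ w - xi i w) ^+ 2) <= 1.
Proof.
move=> iK.
pose t j (u : R) := if j != i then u else 0.
have it : indep_fam P K G (fun j w => t j (xi j w)).
  by apply: indep_fam_comp => // j; rewrite /t; case: (j != i).
have [] := var_sum it.
- move=> j jK; rewrite /t; case: (j != i); [exact: xi1|exact: bmL1].
- move=> j jK; rewrite /t; case: (j != i); first exact: xi2.
  by apply: bmL1; bmt.
- by move=> j jK; rewrite /t; case: (j != i); [exact: xi0|exact: Excst].
move=> _.
have eqT w : \sum_(j < K) t j (xi j w) = T_ w - xi i w.
  rewrite /T_ [in RHS](bigD1 (Ordinal iK))//= addrAC subrr add0r [RHS]big_mkcond/=.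
  by apply: eq_bigr => j _; rewrite /t -val_eqE/=.
under eq_fun do rewrite eqT; move=> L ->.
split=> //; rewrite -xiv; apply: ler_sum => j _.
rewrite /t; case: (nat_of_ord j != i) => //.
by rewrite expr0n Excst; apply: Ex_ge0 => w; exact: sqr_ge0.
Qed.

Let Tv : L1 P (fun w => T_ w ^+ 2) /\ E (fun w => T_ w ^+ 2) = 1.
Proof. by have [_ ? h] := var_sum ixi xi1 xi2 xi0; rewrite h xiv. Qed.

Let mT : measurable_fun [set: T] T_.
Proof. by have [h _ _] := var_sum ixi xi1 xi2 xi0; exact: L1m h. Qed.

(** A summand beyond one is independent of the rest of the sum. What remains to be
required of the rest, in the two ways in which [x] can be exceeded, has
probability O(1 / (1 + x^2)) by a second or an exponential moment. *)
Let large_summand i x : (i < K)%N -> 0 <= x ->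
  L1 P (fun w => 7 / (1 + x ^+ 2) * (a i w * (2 + (T_ w - xi i w) ^+ 2))
      + expR (- x) * (expR (S w - z i w) * a i w)) /\
  E (fun w => 7 / (1 + x ^+ 2) * (a i w * (2 + (T_ w - xi i w) ^+ 2))
      + expR (- x) * (expR (S w - z i w) * a i w)) <=
  (21 + 4 * (expR 1 * Cexp R)) / (1 + x ^+ 2) * E (a i).
Proof.
move=> iK x0; have [Gm mxi xii _] := ixi iK; have bzi := bz iK.
have ma : measurable_fun [set: R] (fun u : R => `|u| `^ (2 + delta)).
  apply: (measurableT_comp (measurable_powR _)); exact: normr_measurable.
have [LT ET] := var_rem iK.
have p0 : 0 < 1 + x ^+ 2 by rewrite ltr_wpDr// sqr_ge0.
have mT2 : (G i).-meas (fun w => 2 + (T_ w - xi i w) ^+ 2).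
  by apply: measurable_funD => //; apply: measurable_funX; exact: (meas_sum_rem ixi iK).
have mS : (G i).-meas (fun w => expR (S w - z i w)).
  by apply: measurableT_comp => //; exact: (meas_sum_rem iz iK).
have L2 : L1 P (fun w => 2 + (T_ w - xi i w) ^+ 2) by apply: L1D => //; exact: bmL1.
have LS : L1 P (fun w => expR (S w - z i w)) by apply: bmL1; bmt.
have [L3 E3] := indep_mul Gm mxi xii mT2 ma L2 (xia iK).
have [L4 E4] := indep_mul Gm mxi xii mS ma LS (xia iK).
have L3' : L1 P (fun w => a i w * (2 + (T_ w - xi i w) ^+ 2)).
  by under eq_fun do rewrite mulrC.
split; first by apply: L1D; exact: L1Z.
rewrite ExD; [|exact: L1Z..].
rewrite !ExZ//; rewrite E4.
rewrite [E (fun w => a i w * _)](_ : _ = (2 + E (fun w => (T_ w - xi i w) ^+ 2)) * E (a i)).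
  have Ea : 0 <= E (a i) by exact: Ex_ge0.
  have ES : E (fun w => expR (S w - z i w)) <= expR 1 * Cexp R.
    apply: (@le_trans _ _ (expR 1 * E (fun w => expR (1 * S w)))).
      rewrite -ExZ; last by apply: bmL1; bmt.
      apply: Ex_le => //; first by apply: bmL1; bmt.
      move=> w; rewrite mul1r -expRD ler_expR.
      have := zb w iK; rewrite ler_norml => /andP[]; lra.
    rewrite ler_wpM2l ?expR_ge0//.
    apply: (@exp_moment2 _ _ _ _ _ _ _ 1 iz zb (lexx 1) zm1 zv 1).
    by rewrite normr1; lra.
  have ES0 : 0 <= E (fun w => expR (S w - z i w)) by apply: Ex_ge0 => w; exact: expR_ge0.
  have := quad_exp_inv x0.
  set e := expR (- x) => ee.
  have h1 : 7 / (1 + x ^+ 2) * ((2 + E (fun w => (T_ w - xi i w) ^+ 2)) * E (a i)) <=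
      21 / (1 + x ^+ 2) * E (a i).
    rewrite mulrA ler_wpM2r// mulrAC ler_wpM2r ?invr_ge0 ?(ltW p0)//; lra.
  have h2 : e * (E (fun w => expR (S w - z i w)) * E (a i)) <=
      4 / (1 + x ^+ 2) * ((expR 1 * Cexp R) * E (a i)).
    apply: ler_pM; rewrite ?expR_ge0//; first exact: mulr_ge0.
    by rewrite ler_wpM2r.
  apply: le_trans (lerD h1 h2) _.
  by rewrite le_eqVlt; apply/orP; left; apply/eqP; field; rewrite gt_eqF.
transitivity (E (fun w => (2 + (T_ w - xi i w) ^+ 2) * a i w)).
  by congr Ex; apply/funext => w; rewrite mulrC.
by rewrite E3 ExD ?Excst//; exact: bmL1.
Qed.

(** Let [S] be the sum of the truncated summands. The event [A] differs from
[S > x] only if the perturbation exceeds [1 + x / 4], or [S] lies within the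
perturbation of [x], or some summand is truncated. Chebyshev's inequality handles
the first case, [concentration] the second and [large_summand] the third, and
[stein_berry_esseen] compares [S > x] with the normal tail. If [beta] is above
[1/4], second moments alone suffice.

That [A] is only pinned between the strict and the weak inequality makes the
statement apply to both tails. *)
Theorem nonlinear_berry_esseen (x : R) (A : set T) : 0 <= x -> measurable A ->
  (forall w, x < T_ w + Dl w -> A w) -> (forall w, A w -> x <= T_ w + Dl w) ->
  `|fine (P A) - tailN x| <= Cnl * (beta + b + b ^+ 2) / (1 + x ^+ 2).
Proof.
move=> x0 mA TA AT.
have [b0' be0 d01] := And3 b0 beta0 delta01; have C1 := Cexp_ge1 R.
have p0 : 0 < 1 + x ^+ 2 by rewrite ltr_wpDr// sqr_ge0.
have ip0 : 0 <= (1 + x ^+ 2)^-1 by rewrite invr_ge0 ltW.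
have e0 := expR_ge0 (1 : R); have e20 := expR_ge0 (2 : R).
have Cc0 : 0 <= Cconc R.
  by apply: mulr_ge0; [apply: mulr_ge0|lra].
have k0 : 0 <= kS R by apply: mulr_ge0 => //; exact: cS_ge0.
have Cb0 : 0 <= Cbe R.
  apply: addr_ge0; last exact: mulr_ge0.
  apply: mulr_ge0; last by lra.
  by apply: mulr_ge0; [exact: mulr_ge0|lra].
have eC0 : 0 <= expR 1 * Cexp R by apply: mulr_ge0 => //; lra.
have tail : tailN x <= 4 * expR 1 / (1 + x ^+ 2).
  apply: le_trans (tailN_le_exp x0) _.
  by rewrite [4 * _]mulrC -mulrA ler_wpM2l// quad_exp_inv.
have bb : 0 <= b ^+ 2 by exact: sqr_ge0.
have [T2 ET2] := Tv.
have [beta4|beta4] := leP beta (1 / 4); last first.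
  have PA : fine (P A) <= (3 + 2 * b ^+ 2) / (1 + x ^+ 2).
    apply: (@le_trans _ _ ((1 + x ^+ 2)^-1 * E (fun w => 1 + (2 * T_ w ^+ 2 + 2 * Dl w ^+ 2)))).
      apply: markovE => //.
      - by apply: L1D; [exact: bmL1|apply: L1D; exact: L1Z].
      - move=> w; have := sqr_ge0 (T_ w); have := sqr_ge0 (Dl w); lra.
      - move=> w /AT h; rewrite mulrC ler_pdivlMr// mul1r.
        have := sqr_ge0 (T_ w - Dl w).
        have : x ^+ 2 <= (T_ w + Dl w) ^+ 2 by rewrite lerXn2r ?nnegrE//; lra.
        nra.
    rewrite mulrC ler_wpM2r//.
    rewrite ExD; [|exact: bmL1|by apply: L1D; exact: L1Z].
    rewrite ExD; [|exact: L1Z|exact: L1Z].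
    by rewrite Excst !ExZ// ET2; have := Dlb; lra.
  have PA0 : 0 <= fine (P A) by rewrite fine_ge0.
  have t0 := tailN_ge0 x.
  apply: (@le_trans _ _ ((3 + 2 * b ^+ 2 + 4 * expR 1) / (1 + x ^+ 2))).
    rewrite mulrDl ler_norml; apply/andP; split; first by lra.
    have : 0 <= 4 * expR 1 / (1 + x ^+ 2) by apply: mulr_ge0 => //; exact: mulr_ge0.
    lra.
  rewrite ler_wpM2r// /Cnl; nra.
pose D w := Num.min `|Dl w| (1 + x / 4).
pose Dt i w := Num.min `|Di i w| (1 + x / 4).
have x4 : 0 <= 1 + x / 4 by lra.
have min_lip (u v c : R) : `|Num.min `|u| c - Num.min `|v| c| <= `|u - v|.
  have key (s t : R) : Num.min `|s| c - Num.min `|t| c <= `|s - t|.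
    rewrite lerBlDl; rewrite addrC -lerBlDl le_min; apply/andP; split.
      rewrite lerBlDl ge_min; apply/orP; left; rewrite addrC.
      by rewrite addrC; have := ler_normD (s - t) t; rewrite subrK.
    by rewrite lerBlDl ge_min; apply/orP; right; rewrite lerDr.
  rewrite ler_norml; have := key u v; have := key v u; rewrite [`|v - u|]distrC; lra.
have bD : bm D.
  split; first by apply: measurable_minr => //; apply: measurableT_comp => //; exact: normr_measurable.
  exists (1 + x / 4) => w; rewrite ger0_norm ?le_min ?normr_ge0//.
  by rewrite ge_min lexx orbT.
have D01 w : 0 <= D w <= 1 + x / 4.
  by rewrite le_min normr_ge0 x4 ge_min lexx orbT.
have mDt i : (i < K)%N -> (G i).-meas (Dt i).
  move=> iK; apply: measurable_minr => //; apply: measurableT_comp; last exact: mDi.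
  exact: normr_measurable.
have bDt i : (i < K)%N -> bm (Dt i).
  move=> iK; have [Gm _ _ _] := ixi iK; split; first exact: (meas_sub Gm (mDt i iK)).
  exists (1 + x / 4) => w; rewrite ger0_norm ?le_min ?normr_ge0//.
  by rewrite ge_min lexx orbT.
have conc : fine (P [set w | `|S w - x| <= D w]) <=
    44 * expR 2 * Cexp R * expR (- (x / 4)) * (beta + b).
  apply: (@concentration _ _ _ P K G z beta iz zb (ltW beta0) _ zm zv x b D Dt di) => //.
  - lra.
  - by have h := @quad_mean_lb _ _ _ P K G z beta iz zb beta0 beta4 zvl z3 xpredT; apply: h.
  - exact: bmm.
  - by move=> i w _; rewrite le_min normr_ge0 x4 ge_min lexx orbT.
  - apply: le_trans Dlb; apply: Ex_le => //; first by apply: bmL1; bmt.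
    move=> w; rewrite -(real_normK (num_real (Dl w))) lerXn2r ?nnegrE//.
      by have /andP[] := D01 w.
    by rewrite ge_min lexx.
  - move=> i iK; apply: le_trans (Dib iK).
    have bDti := bDt i iK; apply: Ex_le; [by apply: bmL1; bmt|exact: Di2|] => w.
    rewrite -(real_normK (num_real (D w - _))) -(real_normK (num_real (Dl w - _))).
    by rewrite lerXn2r ?nnegrE// min_lip.
have be := @stein_berry_esseen _ _ _ P K G z beta iz zb zm1 zv beta0 beta4 zm zvl z3 x x0.
pose B := [set w | x < S w].
have mB : measurable B by apply: measurable_lt_set => //; exact: bmm.
pose Cn := [set w | `|S w - x| <= D w].
have mC : measurable Cn by apply: measurable_le_set; apply: bmm; bmt.
pose big i w := 7 / (1 + x ^+ 2) * (a i w * (2 + (T_ w - xi i w) ^+ 2))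
      + expR (- x) * (expR (S w - z i w) * a i w).
have bigL i (iK : (i < K)%N) := proj1 (large_summand iK x0).
have bigE i (iK : (i < K)%N) := proj2 (large_summand iK x0).
have big0 i w : 0 <= big i w.
  apply: addr_ge0; apply: mulr_ge0; rewrite ?expR_ge0//.
  - exact: mulr_ge0.
  - by apply: mulr_ge0 => //; rewrite addr_ge0// sqr_ge0.
  - by apply: mulr_ge0 => //; exact: expR_ge0.
have sumbig0 w : 0 <= \sum_(i < K) big i w by exact: sumr_ge0.
have pw w : `|\1_A w - \1_B w : R| <=
   16 / (1 + x ^+ 2) * Dl w ^+ 2 + \1_Cn w + \sum_(i < K) big i w.
  have c1 : 0 <= 16 / (1 + x ^+ 2) * Dl w ^+ 2 by rewrite mulr_ge0 ?sqr_ge0// mulr_ge0.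
  have c2 : 0 <= \1_Cn w :> R by [].
  have one : `|\1_A w - \1_B w : R| <= 1.
    rewrite !indicE; case: (w \in A); case: (w \in B) => /=; rewrite ?subrr ?subr0 ?sub0r ?normrN ?normr1 ?normr0//.
  have [Dbig|Dsmall] := ltP (1 + x / 4) `|Dl w|.
    apply: (le_trans one).
    rewrite -addrA ler_wpDr ?large_remainder_le//.
    by rewrite addr_ge0.
  have DE : D w = `|Dl w| by rewrite /D min_l.
  have [/forallP allsmall|] := boolP [forall i : 'I_K, `|xi i w| <= 1].
    have ST : S w = T_ w.
      by apply: eq_bigr => i _; rewrite /z truncE allsmall.
    have [wC|wC] := boolP (w \in Cn).
      by rewrite [\1_Cn w]indicE wC; apply: (le_trans one); rewrite ler_wpDr// ler_wpDl.
    suff AB : (w \in A) = (w \in B).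
      by rewrite [\1_A w]indicE AB [\1_B w]indicE subrr normr0 !addr_ge0.
    move: wC; rewrite notin_setE /Cn/= => /negP; rewrite -ltNge DE ST => far.
    have [h1 h2] := far_from_threshold far.
    by apply/idP/idP; rewrite !inE /B /= ST; [move=> /AT/h1|move=> /h2/TA].
  rewrite negb_forall => /existsP[i]; rewrite -ltNge => ilarge.
  have iK := ltn_ord i.
  have zi0 : z i w = 0 by rewrite /z truncE leNgt ilarge.
  have a1 : 1 <= a i w.
    by have := @large_pow _ _ delta01 0 (xi i w) (leq0n _) (ltW ilarge); rewrite expr0.
  have a2 : xi i w ^+ 2 <= a i w.
    have := @large_pow _ _ delta01 2 (xi i w) (leqnn _) (ltW ilarge).
    by rewrite real_normK ?num_real.
  suff : `|\1_A w - \1_B w : R| <= big i w.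
    move=> h; apply: (le_trans h).
    have : big i w <= \sum_(j < K) big j w.
      by rewrite (bigD1 i)//= lerDl; exact: sumr_ge0.
    by move=> /le_trans; apply; rewrite lerDr addr_ge0.
  have s1 : 0 <= 7 / (1 + x ^+ 2) * (a i w * (2 + (T_ w - xi i w) ^+ 2)).
    by apply: mulr_ge0; [exact: mulr_ge0|apply: mulr_ge0 => //; rewrite addr_ge0// sqr_ge0].
  have s2 : 0 <= expR (- x) * (expR (S w - z i w) * a i w).
    by apply: mulr_ge0; rewrite ?expR_ge0//; apply: mulr_ge0 => //; exact: expR_ge0.
  have [wB|wB] := boolP (w \in B).
    apply: (le_trans one); rewrite /big.
    rewrite ler_wpDl// zi0 subr0 mulrA -expRD.
    move: wB; rewrite inE /B /= => xS.
    have e1 : 1 <= expR (- x + S w) by rewrite -[leLHS]expR0 ler_expR addrC subr_ge0 ltW.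
    by rewrite -[leLHS]mulr1 ler_pM.
  have [wA|wA] := boolP (w \in A); last first.
    by rewrite !indicE (negbTE wA) (negbTE wB) subrr normr0.
  apply: (le_trans one); rewrite /big.
  move: wA; rewrite inE => /AT h.
  by rewrite ler_wpDr// (large_rest_le x0 Dsmall h a1 a2).
have diff : `|fine (P A) - fine (P B)| <=
   16 / (1 + x ^+ 2) * b ^+ 2 + fine (P Cn) +
   \sum_(i < K) (21 + 4 * (expR 1 * Cexp R)) / (1 + x ^+ 2) * E (a i).
  have LA : L1 P (fun w => \1_A w : R) by apply/bmL1/bm_indic.
  have LB : L1 P (fun w => \1_B w : R) by apply/bmL1/bm_indic.
  have LC : L1 P (fun w => \1_Cn w : R) by apply/bmL1/bm_indic.
  have Lsum : L1 P (fun w => \sum_(i < K) big i w) by apply: L1_sum => i _; exact: bigL.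
  rewrite -!Ex_indic// -ExB//.
  have LAB : L1 P (fun w => \1_A w - \1_B w : R) by apply: L1D => //; exact: L1N.
  apply: le_trans (Ex_norm LAB) _.
  apply: (@le_trans _ _ (E (fun w => 16 / (1 + x ^+ 2) * Dl w ^+ 2 + \1_Cn w + \sum_(i < K) big i w))).
    apply: Ex_le => //; first exact: L1_norm.
    by apply: L1D => //; apply: L1D => //; exact: L1Z.
  rewrite ExD//; last by apply: L1D => //; exact: L1Z.
  rewrite ExD//; last exact: L1Z.
  rewrite ExZ// Ex_sum; last by move=> i _; exact: bigL.
  apply: lerD; last by apply: ler_sum => i _; exact: bigE.
  by rewrite lerD2r ler_wpM2l// mulr_ge0.
have sumE : \sum_(i < K) (21 + 4 * (expR 1 * Cexp R)) / (1 + x ^+ 2) * E (a i) <=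
   (21 + 4 * (expR 1 * Cexp R)) / (1 + x ^+ 2) * beta.
  by rewrite -mulr_sumr ler_wpM2l// mulr_ge0// addr_ge0// mulr_ge0.
have ex := quad_exp_inv4 x0.
have conc' : fine (P Cn) <= Cconc R * (64 / (1 + x ^+ 2)) * (beta + b).
  apply: (le_trans conc); apply: ler_wpM2r; first by rewrite addr_ge0// ltW.
  exact: ler_wpM2l.
have be' : `|fine (P B) - tailN x| <= Cbe R * (64 / (1 + x ^+ 2)) * beta.
  apply: (le_trans be); apply: ler_wpM2r; first exact: ltW.
  exact: ler_wpM2l.
have -> : fine (P A) - tailN x = (fine (P A) - fine (P B)) + (fine (P B) - tailN x) by ring.
apply: le_trans (ler_normD _ _) _; apply: le_trans (lerD diff be') _.
have sum3 : 16 / (1 + x ^+ 2) * b ^+ 2 + fine (P Cn) +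
   \sum_(i < K) (21 + 4 * (expR 1 * Cexp R)) / (1 + x ^+ 2) * E (a i) <=
   16 / (1 + x ^+ 2) * b ^+ 2 + Cconc R * (64 / (1 + x ^+ 2)) * (beta + b) +
   (21 + 4 * (expR 1 * Cexp R)) / (1 + x ^+ 2) * beta.
  by apply: lerD => //; rewrite lerD2l.
apply: le_trans (lerD sum3 (lexx _)) _.
have -> : 16 / (1 + x ^+ 2) * b ^+ 2 + Cconc R * (64 / (1 + x ^+ 2)) * (beta + b) +
   (21 + 4 * (expR 1 * Cexp R)) / (1 + x ^+ 2) * beta + Cbe R * (64 / (1 + x ^+ 2)) * beta =
   (16 * b ^+ 2 + 64 * Cconc R * (beta + b) + (21 + 4 * (expR 1 * Cexp R)) * beta +
    64 * Cbe R * beta) / (1 + x ^+ 2) by field; rewrite gt_eqF.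
rewrite ler_wpM2r// /Cnl.
by apply: constants_le => //; exact: ltW.
Qed.

End NonlinearBerryEsseen.

(** * Conditional probabilities and generating pi-systems *)

Section PiSystems.
Context d (T : measurableType d) (R : realType) (P : probability T R).
Local Notation "G .-meas f" := (measurable_fun [set: g_sigma_algebraType G] (f : g_sigma_algebraType G -> _)) (at level 2).
Local Open Scope ereal_scope.

(** Both sides are finite measures in [A] that agree on a generating pi-system. *)
Lemma sigma_indep_pi (C : set_system T) d' (T' : measurableType d') (U : T -> T') :
  C `<=` measurable -> setI_closed C -> C setT -> measurable_fun [set: T] U ->
  (forall A B, C A -> measurable B -> P (A `&` U @^-1` B) = P A * P (U @^-1` B)) ->
  sigma_indep P C U.
Proof.
move=> Cm CI CT mU CU A B sA mB.
have mUB : measurable (U @^-1` B) by rewrite -[X in measurable X]setTI; exact: mU.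
have PU0 : (0 <= fine (P (U @^-1` B)))%R by rewrite fine_ge0.
have PUE : (fine (P (U @^-1` B)))%:E = P (U @^-1` B).
  by rewrite fineK// fin_num_measure.
have := @g_sigma_algebra_measure_unique d R T C Cm (fun=> setT) (fun=> CT) _
  (mrestr P mUB) (mscale (NngNum PU0) P) CI.
move=> /(_ _ _ _ A sA); rewrite /= /mrestr /mscale/= PUE => ->; first by rewrite muleC.
- by apply/seteqP; split => // w _; exists 0%N.
- by move=> D CD; rewrite CU// muleC.
- by move=> _; rewrite setTI -PUE ltry.
Qed.

Section density.
Context (q : T -> R) (mq : measurable_fun [set: T] q) (q0 : forall w, (0 <= q w)%R).

(** Measurability and sign are arguments in order that the measure structure below
can be attached to the function. *)
Definition density (_ : measurable_fun [set: T] q) (_ : forall w, (0 <= q w)%R)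
  (A : set T) : \bar R := \int[P]_(w in A) (q w)%:E.

Local Notation dens := (density mq q0).

Let density0 : dens set0 = 0. Proof. exact: integral_set0. Qed.
Let density_ge0 A : 0 <= dens A.
Proof. by apply: integral_ge0 => w _; rewrite lee_fin. Qed.
Let density_sigma_additive : semi_sigma_additive dens.
Proof.
apply: semi_sigma_additive_nng_induced; first exact/measurable_EFinP.
by move=> w; rewrite lee_fin.
Qed.

HB.instance Definition _ := isMeasure.Build _ _ _ dens density0 density_ge0
  density_sigma_additive.
End density.

Lemma cond_prob_pi (C : set_system T) (A : set T) (q : T -> R) :
  C `<=` measurable -> setI_closed C -> C setT -> measurable A ->
  measurable_fun [set: T] q -> (forall w, 0 <= q w)%R ->
  (forall D, C D -> P (D `&` A) = \int[P]_(w in D) (q w)%:E) ->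
  forall D, <<s C >> D -> P (D `&` A) = \int[P]_(w in D) (q w)%:E.
Proof.
move=> Cm CI CT mA mq q0 CA D sD.
have := @g_sigma_algebra_measure_unique d R T C Cm (fun=> setT) (fun=> CT) _
  (mrestr P mA) (density mq q0) CI.
move=> /(_ _ _ _ D sD); rewrite /= /mrestr /density/= => -> //.
- by apply/seteqP; split => // w _; exists 0%N.
- by move=> _; rewrite setTI (le_lt_trans (probability_le1 P mA))// ltry.
Qed.

Import HBNNSimple.

(** Linearity gives the case of simple [F], and monotone convergence the general
one. *)
Lemma cond_prob_integral (G : set_system T) (A : set T) (q F : T -> R) :
  G `<=` measurable -> measurable A ->
  measurable_fun [set: T] q -> (forall w, 0 <= q w)%R ->
  (forall D, <<s G >> D -> P (D `&` A) = \int[P]_(w in D) (q w)%:E) ->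
  G.-meas F -> (forall w, 0 <= F w)%R ->
  \int[P]_w (F w * \1_A w)%:E = \int[P]_w (F w * q w)%:E.
Proof.
move=> Gm mA mq q0 GA mF F0.
pose TG := g_sigma_algebraType G.
have mFe : measurable_fun [set: TG] (EFin \o F) by exact/measurable_EFinP.
pose h := nnsfun_approx measurableT mFe.
have hm n : measurable_fun [set: T] (h n : T -> R).
  by apply: (meas_sub Gm); exact/measurable_funP.
have hF w : EFin \o (h ^~ w) @ \oo --> (F w)%:E.
  by apply: cvg_nnsfun_approx => // ? _; rewrite lee_fin.
have lim (p : T -> R) : measurable_fun [set: T] p -> (forall w, 0 <= p w)%R ->
    \int[P]_w (F w * p w)%:E = limn (fun n => \int[P]_w (h n w * p w)%:E).
  move=> mp p0.
  rewrite -monotone_convergence//.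
  - apply: eq_integral => w _; apply/esym/cvg_lim => //.
    under eq_fun do rewrite EFinM; rewrite EFinM.
    by apply: cvgeZr => //; exact: hF.
  - by move=> n; apply/measurable_EFinP/measurable_funM.
  - by move=> n w _; rewrite lee_fin mulr_ge0.
  - move=> w _ n m nm; rewrite lee_fin ler_wpM2r//.
    by have /lefP := nd_nnsfun_approx measurableT mFe nm; apply.
have mi : measurable_fun [set: T] (\1_A : T -> R) by exact: measurable_indic.
have i0 w : (0 <= \1_A w :> R)%R by rewrite indicE ler0n.
rewrite (lim _ mi i0).
rewrite (lim q)//; congr (limn _); apply/funext => n.
have sumE (p : T -> R) : measurable_fun [set: T] p -> (forall w, 0 <= p w)%R ->
    \int[P]_w (h n w * p w)%:E = \sum_(y \in range (h n))
      \int[P]_w (y * (\1_(h n @^-1` [set y]) w * p w))%:E.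
  move=> mp p0; rewrite -ge0_integral_fsum//.
  - apply: eq_integral => w _; rewrite fsumEFin//.
    rewrite [in LHS]fimfunE; congr (_%:E).
    rewrite !fsbig_finite//= mulr_suml; apply: eq_bigr => y _; by rewrite mulrA.
  - move=> y; apply/measurable_EFinP/measurable_funM => //; apply: measurable_funM => //.
    apply: measurable_indic; rewrite -[X in measurable X]setTI; exact: hm.
  - move=> y w _; rewrite mulrA EFinM mule_ge0 ?lee_fin//.
    exact: nnfun_muleindic_ge0.
rewrite (sumE _ mi i0).
rewrite (sumE q)//; apply: eq_fsbigr => y /[!inE] -[w0 _ hy].
have y0 : (0 <= y)%R by rewrite -hy.
have my : d.-measurable (h n @^-1` [set y]).
  by have := hm n measurableT [set y] (measurable_set1 y); rewrite setTI.
have sy : <<s G >> (h n @^-1` [set y]).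
  have : (G.-sigma).-measurable ((h n : TG -> R) @^-1` [set y]).
    by rewrite -[X in measurable X]setTI; exact: measurable_funP.
  by [].
have pullE (p : T -> R) : measurable_fun [set: T] p -> (forall w, 0 <= p w)%R ->
    \int[P]_w (y * (\1_(h n @^-1` [set y]) w * p w))%:E =
    y%:E * \int[P]_(w in h n @^-1` [set y]) (p w)%:E.
  move=> mp p0; under eq_integral do rewrite EFinM.
  rewrite ge0_integralZl ?lee_fin//; last 2 first.
  - by apply/measurable_EFinP/measurable_funM => //; exact: measurable_indic.
  - by move=> w _; rewrite lee_fin mulr_ge0.
  congr (_ * _); rewrite [RHS]integral_mkcond; apply: eq_integral => w _.
  rewrite patchE indicE; case: (w \in _); by rewrite ?mul1r ?mul0r.
rewrite (pullE _ mi i0).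
rewrite pullE// -GA//; congr (_ * _).
by rewrite integral_indic// setIC.
Qed.

End PiSystems.

(** * Independence in the branching processes *)

Section BranchingIndependence.
Context d (T : measurableType d) (R : realType) (P : probability T R).
Context (law : R.-pker R ~> nat) (xi : nat -> {RV P >-> (R * R)%type}).
Context (X : bool -> nat -> nat -> {RV P >-> nat}).
Hypotheses (Hxi : iid_environment xi) (HX : offspring_given_environment law xi X).
Local Notation E := (Ex P).
Local Notation "G .-meas f" := (measurable_fun [set: g_sigma_algebraType G] (f : g_sigma_algebraType G -> _)) (at level 2).
Local Notation J := (bool * nat * nat)%type.

Definition Xj (j : J) (w : T) : nat := X j.1.1 j.1.2 j.2 w.

Definition cyl (s : seq J) (B : J -> set nat) : set T :=
  [set w | forall j, j \in s -> B j (Xj j w)].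

Definition ecyl (s : seq nat) (B : nat -> set (R * R)) : set T :=
  [set w | forall n, n \in s -> B n (xi n w)].

Definition env_sets : set_system T :=
  \bigcup_n preimage_set_system [set: T] (xi n) measurable.

Definition env_except (i : nat) : set_system T :=
  [set D | exists s B, [/\ uniq s, i \notin s, forall n, measurable (B n) & D = ecyl s B]].

(** It determines both processes up to generation [i] and every environment but
the [i]-th, and it is independent of the latter ([past_indep]): these are the
sigma-algebras of the leave-one-out arguments. *)
Definition past (i : nat) : set_system T :=
  [set A | exists D s B, [/\ <<s env_except i >> D, uniq s,
    forall j : J, j \in s -> (j.1.2 < i)%N & A = D `&` cyl s B]].

(** Everything but one offspring number, which therefore follows its law given its
environment ([rest_cond]). *)
Definition rest (j0 : J) : set_system T :=
  [set A | exists D s B, [/\ <<s env_sets >> D, uniq s, j0 \notin s & A = D `&` cyl s B]].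

Definition off_prob (j : J) (B : set nat) (w : T) : R :=
  fine (law (env xi j.1.1 j.1.2 w) B).

Lemma measurable_Xj j : measurable_fun [set: T] (Xj j).
Proof. exact: measurable_funP. Qed.

Lemma measurable_pre d2 (T2 : measurableType d2) (f : T -> T2) B :
  measurable_fun [set: T] f -> measurable B -> measurable (f @^-1` B).
Proof. by move=> mf mB; rewrite -[X in measurable X]setTI; exact: mf. Qed.

Lemma measurable_cyl s B : measurable (cyl s B).
Proof.
rewrite (_ : cyl s B = \big[setI/setT]_(j <- s) (Xj j @^-1` B j)).
  by apply: big_ind => // [|j _]; [exact: measurableI|apply: measurable_pre => //; exact: measurable_Xj].
apply/seteqP; split => w; rewrite /cyl/= -bigcap_seq/=.
  by move=> h j js; exact: h.
by move=> h j js; exact: h.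
Qed.

Lemma off_prob_ge0 j B w : 0 <= off_prob j B w.
Proof. by rewrite fine_ge0. Qed.

Lemma off_probE j B w : (off_prob j B w)%:E = law (env xi j.1.1 j.1.2 w) B.
Proof.
rewrite /off_prob fineK// ge0_fin_numE//.
apply: le_lt_trans (ltry 1); rewrite -(@prob_kernel _ _ _ _ _ law (env xi j.1.1 j.1.2 w)).
by apply: le_measure; rewrite ?inE.
Qed.

Lemma measurable_law B : measurable_fun [set: R] (fun x => fine (law x B)).
Proof. by apply: (measurableT_comp (fine_measurable measurableT)); exact: measurable_kernel. Qed.

Section meas_env.
Context (G : set_system T).

Lemma meas_env l n : G.-meas (xi n : T -> R * R) -> G.-meas (env xi l n).
Proof.
move=> mxi; case: l; rewrite /env.
  exact: (measurableT_comp measurable_snd mxi).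
exact: (measurableT_comp measurable_fst mxi).
Qed.

Lemma meas_off_prob j B : G.-meas (xi j.1.2 : T -> R * R) -> G.-meas (off_prob j B).
Proof. by move=> mxi; exact: (measurableT_comp (measurable_law B) (meas_env _ mxi)). Qed.

Lemma meas_prod_off_prob s (B : J -> set nat) :
  (forall j, j \in s -> G.-meas (xi j.1.2 : T -> R * R)) ->
  G.-meas (fun w => \prod_(j <- s) off_prob j (B j) w).
Proof.
elim: s => [|j s IH] mxi.
  by under eq_fun do rewrite big_nil; exact: measurable_cst.
under eq_fun do rewrite big_cons; apply: measurable_funM.
  by apply: meas_off_prob; apply: mxi; rewrite mem_head.
by apply: IH => k ks; apply: mxi; rewrite in_cons ks orbT.
Qed.
End meas_env.

Lemma env_sets_meas n : env_sets.-meas (xi n : T -> R * R).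
Proof.
move=> _ B mB; apply: sub_sigma_algebra; exists n => //; exists B => //.
Qed.

Lemma env_setsm : env_sets `<=` measurable.
Proof. by move=> A [n _ [B mB <-]]; apply: measurable_funP. Qed.

Lemma ecylE s B : ecyl s B = \big[setI/setT]_(n <- s) (xi n @^-1` B n).
Proof.
apply/seteqP; split => w; rewrite /ecyl/= -bigcap_seq/=.
  by move=> h j js; exact: h.
by move=> h j js; exact: h.
Qed.

Lemma env_except_sub i : env_except i `<=` <<s env_sets >>.
Proof.
move=> D [s [B [us iS mB ->]]]; rewrite ecylE.
apply: (@bigsetI_measurable _ (g_sigma_algebraType env_sets)) => n _.
by apply: sub_sigma_algebra; exists n => //; exists (B n) => //; rewrite setTI.
Qed.

Lemma env_exceptm i : env_except i `<=` measurable.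
Proof. by move=> D /env_except_sub; apply: sub_sigma; exact: env_setsm. Qed.

Lemma env_except_meas i n : n != i -> (env_except i).-meas (xi n : T -> R * R).
Proof.
move=> ni _ B mB; rewrite setTI; apply: sub_sigma_algebra.
exists [:: n], (fun=> B); split => //; first by rewrite inE eq_sym.
by apply/seteqP; split => w /= h => [m|]; [rewrite inE => /eqP ->|apply: h; rewrite inE].
Qed.

Lemma env_exceptI i : setI_closed (env_except i).
Proof.
move=> D1 D2 [s1 [B1 [u1 i1 m1 ->]]] [s2 [B2 [u2 i2 m2 ->]]].
exists (undup (s1 ++ s2)), (fun n => (if n \in s1 then B1 n else setT) `&`
  (if n \in s2 then B2 n else setT)); split.
- exact: undup_uniq.
- by rewrite mem_undup mem_cat negb_or i1.
- by move=> n; apply: measurableI; case: ifP.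
apply/seteqP; split => w /=.
  move=> [h1 h2] n; rewrite mem_undup mem_cat => _.
  by split; case: ifP => // /[dup] ? ?; [exact: h1|exact: h2].
move=> h; split => n ns.
  by have := h n; rewrite mem_undup mem_cat ns /= => /(_ isT) [].
by have := h n; rewrite mem_undup mem_cat ns orbT /= => /(_ isT) [].
Qed.

Lemma env_exceptT i : env_except i setT.
Proof. by exists [::], (fun=> setT); split => //; apply/seteqP; split. Qed.

Lemma env_except_indep i : sigma_indep P (env_except i) (xi i).
Proof.
have [Hind _] := Hxi.
apply: sigma_indep_pi.
- exact: env_exceptm.
- exact: env_exceptI.
- exact: env_exceptT.
- exact: measurable_funP.
move=> A B [s [Bs [us iS mBs ->]]] mB.
have h1 := Hind s Bs us mBs.
pose B' n := if n == i then B else Bs n.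
have mB' n : measurable (B' n) by rewrite /B'; case: ifP.
have := Hind (i :: s) B'; rewrite /= iS us => /(_ isT mB').
rewrite big_cons {2}/B' eqxx (eq_big_seq (fun n => P (xi n @^-1` Bs n))); last first.
  by move=> n ns; rewrite /B'; case: eqP => // ni; move: iS; rewrite -ni ns.
rewrite -h1 muleC => <-; congr (P _); apply/seteqP; split => w /=.
  move=> [h2 h3] n; rewrite inE => /orP[/eqP ->|ns]; rewrite /B' ?eqxx//.
  by case: eqP => [->//|_]; exact: h2.
move=> h; split; last by have := h i; rewrite inE eqxx /B' eqxx; apply.
move=> n ns; have := h n; rewrite inE ns orbT /B' => /(_ isT).
by case: eqP => // ni; move: iS; rewrite -ni ns.
Qed.

Lemma cond_cyl s (B : J -> set nat) D : uniq s -> <<s env_sets >> D ->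
  P (D `&` cyl s B) = (\int[P]_(w in D) (\prod_(j <- s) off_prob j (B j) w)%:E)%E.
Proof.
move=> us sD; have [_ /(_ D sD)] := HX B us.
rewrite [X in P (_ `&` X)](_ : _ = cyl s B)// => ->; apply: eq_integral => w _.
by rewrite -prodEFin; apply: eq_bigr => j _; rewrite off_probE.
Qed.

Lemma prod_off_prob_ge0 s (B : J -> set nat) w : 0 <= \prod_(j <- s) off_prob j (B j) w.
Proof. by apply: prodr_ge0 => j _; exact: off_prob_ge0. Qed.

Lemma measurable_prod_off_prob s (B : J -> set nat) :
  measurable_fun [set: T] (fun w => \prod_(j <- s) off_prob j (B j) w).
Proof.
apply: (meas_sub env_setsm); apply: meas_prod_off_prob => j _; exact: env_sets_meas.
Qed.

Lemma cylI s1 s2 B1 B2 : exists B, cyl s1 B1 `&` cyl s2 B2 = cyl (undup (s1 ++ s2)) B.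
Proof.
exists (fun j => [set y | (j \in s1 -> B1 j y) /\ (j \in s2 -> B2 j y)]).
apply/seteqP; split => w /=.
  by move=> [h1 h2] j _; split => js; [exact: h1|exact: h2].
move=> h; split => j js.
  by have := h j; rewrite mem_undup mem_cat js /= => /(_ isT) [h1 _]; exact: h1.
by have := h j; rewrite mem_undup mem_cat js orbT /= => /(_ isT) [_ h1]; exact: h1.
Qed.

Lemma pastm i : past i `<=` measurable.
Proof.
move=> A [D [s [B [sD us si ->]]]]; apply: measurableI; last exact: measurable_cyl.
exact: (sub_sigma (@env_exceptm i)).
Qed.

Lemma restm j0 : rest j0 `<=` measurable.
Proof.
move=> A [D [s [B [sD us si ->]]]]; apply: measurableI; last exact: measurable_cyl.
exact: (sub_sigma env_setsm).
Qed.

Lemma pastI i : setI_closed (past i).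
Proof.
move=> A1 A2 [D1 [s1 [B1 [sD1 u1 j1 ->]]]] [D2 [s2 [B2 [sD2 u2 j2 ->]]]].
have [B BE] := cylI s1 s2 B1 B2.
exists (D1 `&` D2), (undup (s1 ++ s2)), B; split.
- exact: (@measurableI _ (g_sigma_algebraType (env_except i))).
- exact: undup_uniq.
- by move=> j; rewrite mem_undup mem_cat => /orP[/j1|/j2].
- by rewrite -BE setIACA.
Qed.

Lemma restI j0 : setI_closed (rest j0).
Proof.
move=> A1 A2 [D1 [s1 [B1 [sD1 u1 j1 ->]]]] [D2 [s2 [B2 [sD2 u2 j2 ->]]]].
have [B BE] := cylI s1 s2 B1 B2.
exists (D1 `&` D2), (undup (s1 ++ s2)), B; split.
- exact: (@measurableI _ (g_sigma_algebraType env_sets)).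
- exact: undup_uniq.
- by rewrite mem_undup mem_cat negb_or j1.
- by rewrite -BE setIACA.
Qed.

Lemma cyl0 B : cyl [::] B = setT.
Proof. by apply/seteqP; split. Qed.

Lemma pastT i : past i setT.
Proof.
exists setT, [::], (fun=> setT); split => //; last by rewrite cyl0 setIT.
exact: (@measurableT _ (g_sigma_algebraType (env_except i))).
Qed.

Lemma restT j0 : rest j0 setT.
Proof.
exists setT, [::], (fun=> setT); split => //; last by rewrite cyl0 setIT.
exact: (@measurableT _ (g_sigma_algebraType env_sets)).
Qed.

Lemma past_meas_env i n : n != i -> (past i).-meas (xi n : T -> R * R).
Proof.
move=> ni _ B mB; apply: sub_sigma_algebra.
exists (setT `&` xi n @^-1` B), [::], (fun=> setT); split => //; last by rewrite cyl0 setIT.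
exact: (env_except_meas ni measurableT mB).
Qed.

Lemma past_meas_X i l g k : (g < i)%N -> (past i).-meas (X l g k : T -> nat).
Proof.
move=> gi _ B mB; apply: sub_sigma_algebra; rewrite setTI.
exists setT, [:: (l, g, k)], (fun=> B); split => //.
- exact: (@measurableT _ (g_sigma_algebraType (env_except i))).
- by move=> j; rewrite inE => /eqP ->.
- rewrite setTI; apply/seteqP; split => w /= h => [j|].
    by rewrite inE => /eqP ->.
  by apply: (h (l, g, k)); rewrite inE.
Qed.

Lemma rest_meas_env j0 n : (rest j0).-meas (xi n : T -> R * R).
Proof.
move=> _ B mB; apply: sub_sigma_algebra.
exists (setT `&` xi n @^-1` B), [::], (fun=> setT); split => //; last by rewrite cyl0 setIT.
exact: (env_sets_meas n measurableT mB).
Qed.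

Lemma rest_meas_X j0 l g k : (l, g, k) != j0 -> (rest j0).-meas (X l g k : T -> nat).
Proof.
move=> jj0 _ B mB; apply: sub_sigma_algebra; rewrite setTI.
exists setT, [:: (l, g, k)], (fun=> B); split => //.
- exact: (@measurableT _ (g_sigma_algebraType env_sets)).
- by rewrite inE eq_sym.
- rewrite setTI; apply/seteqP; split => w /= h => [j|].
    by rewrite inE => /eqP ->.
  by apply: (h (l, g, k)); rewrite inE.
Qed.

(** Given the environments, events about generations before [i] have a probability
that depends on the environments before [i] only. *)
Lemma past_indep i : sigma_indep P (past i) (xi i).
Proof.
apply: sigma_indep_pi.
- exact: pastm.
- exact: pastI.
- exact: pastT.
- exact: measurable_funP.
move=> A B [D [s [Bs [sD us si ->]]]] mB.
have sD' : <<s env_sets >> D.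
  apply: (smallest_sub (smallest_sigma_algebra _ _) (@env_except_sub i)) sD.
have mD := sub_sigma env_setsm sD'.
have mxB : measurable (xi i @^-1` B) by apply: measurable_pre => //; exact: measurable_funP.
have sxB : <<s env_sets >> (xi i @^-1` B).
  by have := env_sets_meas i measurableT mB; rewrite setTI.
have sDB : <<s env_sets >> (D `&` xi i @^-1` B).
  exact: (@measurableI _ (g_sigma_algebraType env_sets)).
rewrite setIAC (cond_cyl Bs us sDB) (cond_cyl Bs us sD').
pose g w := \prod_(j <- s) off_prob j (Bs j) w.
have mg : (env_except i).-meas g.
  apply: meas_prod_off_prob => j js; apply: env_except_meas.
  by rewrite ltn_eqF// si.
have g0 w : 0 <= g w by exact: prod_off_prob_ge0.
have i0 (A' : set T) w : 0 <= \1_A' w :> R by rewrite indicE ler0n.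
have := @indep_mul_ge0 _ _ _ P (env_except i) _ _ (xi i) (@env_exceptm i) _ (@env_except_indep i)
  (fun w => \1_D w * g w) (\1_B : _ -> R).
rewrite -/g => H.
rewrite integral_mkcond [in RHS]integral_mkcond.
transitivity (\int[P]_w (\1_D w * g w * \1_B (xi i w))%:E)%E.
  apply: eq_integral => w _; rewrite patchE.
  rewrite [\1_D w]indicE [\1_B _]indicE.
  rewrite in_setI [w \in xi i @^-1` B](_ : _ = (xi i w \in B)).
    by case: (w \in D); case: (xi i w \in B); rewrite /= ?mul1r ?mulr1 ?mulr0 ?mul0r.
  by apply/idP/idP; rewrite !inE.
rewrite H.
- congr (_ * _)%E.
    by apply: eq_integral => w _; rewrite patchE indicE; case: (w \in D); rewrite /= ?mul1r ?mul0r.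
  rewrite -[in RHS](setIT (xi i @^-1` B)) -integral_indic//.
- exact: measurable_funP.
- exact: measurable_funM.
- exact: measurable_indic.
- by move=> w; rewrite mulr_ge0.
- by move=> u; rewrite indicE ler0n.
Qed.

(** Given the environments the offspring numbers are independent, so knowing the
others as well does not change the conditional law. *)
Lemma rest_cond j0 (B0 : set nat) A : <<s rest j0 >> A ->
  P (A `&` (Xj j0 @^-1` B0)) = (\int[P]_(w in A) (off_prob j0 B0 w)%:E)%E.
Proof.
move=> sA.
have mX : measurable (Xj j0 @^-1` B0) by apply: measurable_pre => //; exact: measurable_Xj.
have mq : measurable_fun [set: T] (off_prob j0 B0).
  by apply: (meas_sub env_setsm); apply: meas_off_prob; exact: env_sets_meas.
apply: (@cond_prob_pi _ _ _ P (rest j0)) sA => //.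
- exact: restm.
- exact: restI.
- exact: restT.
- by move=> w; exact: off_prob_ge0.
move=> _ [D [s [B [sD us sj ->]]]].
have mD := sub_sigma env_setsm sD.
pose B' j := if j == j0 then B0 else B j.
have us' : uniq (j0 :: s) by rewrite /= sj.
have -> : D `&` cyl s B `&` Xj j0 @^-1` B0 = D `&` cyl (j0 :: s) B'.
  rewrite -setIA; congr (_ `&` _); apply/seteqP; split => w /=.
    move=> [h1 h2] j; rewrite inE => /orP[/eqP ->|js]; rewrite /B' ?eqxx//.
    by case: eqP => [->//|_]; exact: h1.
  move=> h; split; last by have := h j0; rewrite inE eqxx /B' eqxx; apply.
  move=> j js; have := h j; rewrite inE js orbT /B' => /(_ isT).
  by case: eqP => // jj; move: sj; rewrite -jj js.
rewrite (cond_cyl B' us' sD).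
have i0 (A' : set T) w : 0 <= \1_A' w :> R by rewrite indicE ler0n.
have F := @cond_prob_integral _ _ _ P env_sets (cyl s B)
  (fun w => \prod_(j <- s) off_prob j (B j) w) (fun w => \1_D w * off_prob j0 B0 w)
  env_setsm (measurable_cyl s B) (measurable_prod_off_prob s B)
  (prod_off_prob_ge0 s B) (fun D' sD' => cond_cyl B us sD').
rewrite integral_mkcond [in RHS]integral_mkcond.
transitivity (\int[P]_w (\1_D w * off_prob j0 B0 w * \prod_(j <- s) off_prob j (B j) w)%:E)%E.
  apply: eq_integral => w _; rewrite patchE indicE big_cons {1}/B' eqxx.
  rewrite (eq_big_seq (fun j => off_prob j (B j) w)); last first.
    by move=> j js; rewrite /B'; case: eqP => // jj; move: sj; rewrite -jj js.
  by case: (w \in D); rewrite /= ?mul1r ?mul0r.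
rewrite -F.
- apply: eq_integral => w _; rewrite patchE in_setI [\1_D w]indicE [\1_(cyl s B) w]indicE.
  by case: (w \in D); case: (w \in cyl s B); rewrite /= ?mul1r ?mulr1 ?mulr0 ?mul0r.
- apply: measurable_funM; first exact: (@measurable_indic _ (g_sigma_algebraType env_sets)).
  by apply: meas_off_prob; exact: env_sets_meas.
- by move=> w; rewrite mulr_ge0 ?off_prob_ge0.
Qed.

Lemma rest_integral j0 (B0 : set nat) (F : T -> R) : (rest j0).-meas F ->
  (forall w, 0 <= F w) ->
  (\int[P]_w (F w * \1_(Xj j0 @^-1` B0) w)%:E = \int[P]_w (F w * off_prob j0 B0 w)%:E)%E.
Proof.
move=> mF F0; apply: (@cond_prob_integral _ _ _ P (rest j0)) => //.
- exact: restm.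
- by apply: measurable_pre => //; exact: measurable_Xj.
- by apply: (meas_sub env_setsm); apply: meas_off_prob; exact: env_sets_meas.
- by move=> w; exact: off_prob_ge0.
- by move=> D; exact: rest_cond.
Qed.

(** Conditionally on everything else, [X_{j0}] has the law given by its
environment; being discrete it can be integrated out by a series. *)
Lemma rest_series j0 (k : nat -> T -> R) : (forall b, (rest j0).-meas (k b)) ->
  (forall b w, 0 <= k b w) ->
  (\int[P]_w (k (Xj j0 w) w)%:E =
   \int[P]_w \sum_(0 <= b <oo) (k b w * off_prob j0 [set b] w)%:E)%E.
Proof.
move=> mk k0.
have mkT b : measurable_fun [set: T] (k b) by exact: (meas_sub (@restm j0) (mk b)).
have mq b : measurable_fun [set: T] (off_prob j0 [set b]).
  by apply: (meas_sub env_setsm); apply: meas_off_prob; exact: env_sets_meas.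
have mX b : measurable (Xj j0 @^-1` [set b]) by apply: measurable_pre => //; exact: measurable_Xj.
have i0 (A' : set T) w : 0 <= \1_A' w :> R by rewrite indicE ler0n.
rewrite integral_nneseries//; last 2 first.
- by move=> b; apply/measurable_EFinP/measurable_funM.
- by move=> b w _; rewrite lee_fin mulr_ge0 ?off_prob_ge0.
transitivity (\int[P]_w \sum_(0 <= b <oo) (k b w * \1_(Xj j0 @^-1` [set b]) w)%:E)%E; last first.
  rewrite integral_nneseries//; last 2 first.
  - by move=> b; apply/measurable_EFinP/measurable_funM => //; exact: measurable_indic.
  - by move=> b w _; rewrite lee_fin mulr_ge0.
  by apply: eq_eseriesr => b _; exact: rest_integral.
apply: eq_integral => w _.
rewrite (nneseries_split _ (Xj j0 w).+1); last by move=> b _; rewrite lee_fin mulr_ge0.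
rewrite big_nat_recr//= big_nat big1 ?add0e; last first.
  move=> b /andP[_ bX]; rewrite indicE memNset ?mulr0//=.
  by move=> h; rewrite h ltnn in bX.
rewrite eseries0 ?adde0.
  by rewrite indicE mem_set//= mulr1.
move=> b Xb _; rewrite indicE memNset ?mulr0//=.
by move=> h; rewrite h add0n ltnn in Xb.
Qed.

End BranchingIndependence.

(** * Elementary inequalities *)

Section ElementaryInequalities.
Context (R : realType).
Implicit Types x y t a b p : R.

Lemma ln_le_sub1 x : 0 < x -> ln x <= x - 1.
Proof. by move=> x0; have := expR_ge1Dx (ln x); rewrite lnK ?posrE//; lra. Qed.

(** The concave function [x^a] lies below its tangent at [1]. *)
Lemma powR_le_affine x a : 0 < x -> 0 <= a <= 1 -> x `^ a <= 1 + a * (x - 1).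
Proof.
move=> x0 /andP[a0 a1].
set A := 1 + a * (x - 1).
have A0 : 0 < A.
  rewrite /A; have [->|/eqP an] := eqVneq a 1; first by lra.
  have a1' : a < 1 by rewrite lt_neqAle a1 andbT; apply/eqP.
  nra.
rewrite -(@lnK _ A) ?posrE// /powR gt_eqF// ler_expR.
have h1 := ln_le_sub1 (divr_gt0 x0 A0).
have h2 : ln A^-1 <= A^-1 - 1 by apply: ln_le_sub1; rewrite invr_gt0.
rewrite ln_div ?posrE// in h1; rewrite lnV ?posrE// in h2.
(* [A] is the value at which the two logarithmic bounds cancel *)
have h3 : a * (x / A - 1) + (1 - a) * (A^-1 - 1) = 0.
  have -> : a * (x / A - 1) + (1 - a) * (A^-1 - 1) = (1 + a * (x - 1)) / A - 1 by field; rewrite gt_eqF.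
  by rewrite divff ?subrr// gt_eqF.
nra.
Qed.

(** The exponent [p - 1] lies in [0, 1], so [(1 + t)^(p-1)] is below its tangent. *)
Lemma powR_1D_le p t : 1 <= p <= 2 -> -1 <= t -> (1 + t) `^ p <= 1 + p * t + (p - 1) * t ^+ 2.
Proof.
move=> /andP[p1 p2] t1; have [t1'|t1'] := eqVneq t (-1).
  rewrite t1' subrr powR0 ?gt_eqF//; first by lra.
  by apply: lt_le_trans p1.
have t0 : 0 < 1 + t.
  have : -1 < t by rewrite lt_neqAle eq_sym t1'.
  lra.
rewrite -[p in X in X <= _](subrK 1) powRD ?(gt_eqF t0) ?implybT// powRr1 ?(ltW t0)//.
have := @powR_le_affine (1 + t) (p - 1) t0; rewrite subr_ge0 p1 lerBlDr p2 => /(_ isT).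
move=> h; nra.
Qed.

(** The derivative of [|a|^p] divided by [p]. *)
Definition sgpow a p : R := Num.sg a * `|a| `^ (p - 1).

Lemma powR_2_le p t : 1 <= p <= 2 -> 0 <= t -> (2 * t) `^ p <= 4 * t `^ p.
Proof.
move=> /andP[p1 p2] t0; rewrite powRM// ler_wpM2r ?powR_ge0//.
have -> : 4 = 2 `^ 2 :> R by rewrite powR_mulrn//; ring.
by rewrite ler_powR// ler1n.
Qed.

(** The term linear in [b] has mean zero when [b] is a centred variable independent
of [a], which is the induction step of the von Bahr--Esseen inequality. *)
Lemma vonBahr_Esseen_step p a b : 1 <= p <= 2 ->
  `|a + b| `^ p <= `|a| `^ p + p * (sgpow a p * b) + 6 * `|b| `^ p.
Proof.
move=> /[dup] p12 /andP[p1 p2]; have p0 : 0 < p by apply: lt_le_trans p1.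
have [->|a0] := eqVneq a 0.
  rewrite add0r /sgpow sgr0 !mul0r mulr0 addr0 normr0 powR0 ?gt_eqF// add0r.
  by rewrite ler_peMl ?powR_ge0// ler1n.
suff H t : `|1 + t| `^ p <= 1 + p * t + 6 * `|t| `^ p.
  have na : 0 < `|a| by rewrite normr_gt0.
  have -> : a + b = a * (1 + b / a) by field.
  rewrite normrM powRM//.
  have -> : `|a| `^ p + p * (sgpow a p * b) + 6 * `|b| `^ p =
     `|a| `^ p * (1 + p * (b / a) + 6 * `|b / a| `^ p).
    have -> : `|b| = `|a| * `|b / a| by rewrite -normrM mulrC divfK.
    rewrite powRM//.
    have -> : sgpow a p * b = `|a| `^ p * (b / a).
      rewrite /sgpow -[p in RHS](subrK 1) [in RHS]powRD ?(gt_eqF na) ?implybT// powRr1//.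
      by rewrite [X in _ * X * (b / a)]normrEsg; field.
    by ring.
  by rewrite ler_wpM2l ?powR_ge0.
have [t1|t1] := leP `|t| 1.
  have t2 : t ^+ 2 <= `|t| `^ p.
    rewrite -real_normK ?num_real// -powR_mulrn//.
    have [->|t0] := eqVneq t 0; first by rewrite normr0 !powR0// ?gt_eqF.
    by apply: ger_powR => //; rewrite normr_gt0 t0.
  have t1' : -1 <= t by move: t1; rewrite ler_norml => /andP[].
  rewrite ger0_norm; last by lra.
  apply: (le_trans (powR_1D_le p12 t1')).
  have := powR_ge0 `|t| p; have := sqr_ge0 t; nra.
have h1 : `|1 + t| <= 2 * `|t|.
  by apply: (le_trans (ler_normD _ _)); rewrite normr1; lra.
have h2 : `|1 + t| `^ p <= 4 * `|t| `^ p.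
  apply: le_trans (powR_2_le p12 (normr_ge0 t)).
  apply: ge0_ler_powR => //; first exact: ltW.
  by rewrite nnegrE mulr_ge0.
have h3 : `|t| <= `|t| `^ p by rewrite -[X in X <= _]powRr1// ler_powR// ltW.
have h4 : - `|t| <= t by rewrite lerNl -normrN ler_norm.
have nt := normr_ge0 t; nra.
Qed.

(** Near [1] the logarithm is Lipschitz and [(y - 1)^2 <= |y - 1|^p]; beyond [2],
[ln y] is twice the logarithm of the square root. *)
Lemma sqr_ln_le p y : 1 <= p <= 2 -> 2^-1 <= y -> ln y ^+ 2 <= 4 * `|y - 1| `^ p.
Proof.
move=> /andP[p1 p2] y2; have y0 : 0 < y by lra.
have p0 : 0 < p by apply: lt_le_trans p1.
have [y1|y1] := leP `|y - 1| 1.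
  have h1 := ln_le_sub1 y0.
  have h2 : - ln y <= y^-1 - 1 by rewrite -lnV ?posrE//; apply: ln_le_sub1; rewrite invr_gt0.
  have h3 : y^-1 - 1 <= 2 * `|y - 1|.
    have -> : y^-1 - 1 = y^-1 * (1 - y) by field; rewrite gt_eqF.
    apply: le_trans (_ : y^-1 * `|y - 1| <= _).
      by rewrite ler_wpM2l ?invr_ge0 ?(ltW y0)// distrC ler_norm.
    rewrite ler_wpM2r// -[leRHS]invrK lef_pV2 ?posrE ?invr_gt0//.
  have h4 : `|ln y| <= 2 * `|y - 1|.
    rewrite ler_norml lerNl (le_trans h2 h3)/=.
    apply: (le_trans h1); have := ler_norm (y - 1); have := normr_ge0 (y - 1); lra.
  have h5 : ln y ^+ 2 <= 4 * `|y - 1| ^+ 2.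
    rewrite -real_normK ?num_real//; have := normr_ge0 (ln y); have := normr_ge0 (y - 1); nra.
  apply: (le_trans h5); rewrite ler_wpM2l//.
  rewrite -powR_mulrn//; have [->|t0] := eqVneq (y - 1) 0; first by rewrite normr0 !powR0// ?gt_eqF.
  by apply: ger_powR => //; rewrite normr_gt0 t0.
have y3 : 2 < y.
  move: y1; case: (leP 1 y) => yy; first by rewrite ger0_norm ?subr_ge0//; lra.
  by rewrite ltr0_norm ?subr_lt0//; lra.
rewrite ger0_norm; last by lra.
have s1 : 1 <= Num.sqrt y by rewrite -[leLHS]sqrtr1 ler_sqrt//; lra.
have ss : Num.sqrt y ^+ 2 = y by rewrite sqr_sqrtr// ltW.
have h1 : ln y = 2 * ln (Num.sqrt y).
  by rewrite -{1}ss lnXn ?posrE; [rewrite mulr_natl|lra].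
have h2 : ln (Num.sqrt y) <= Num.sqrt y - 1 by apply: ln_le_sub1; lra.
have h3 : 0 <= ln (Num.sqrt y) by exact: ln_ge0.
have h4 : ln y ^+ 2 <= 4 * (y - 1).
  rewrite h1 -[y in leRHS]ss; nra.
apply: (le_trans h4); rewrite ler_wpM2l// -[X in X <= _]powRr1 ?ler_powR//; lra.
Qed.

(** Integrated with [E u <= e] this gives [E u^a <= 2 e^a], which is Jensen's
inequality up to the factor two. *)
Lemma split_powR a u e : 0 <= a <= 1 -> 0 < e -> 0 <= u -> u `^ a <= e `^ a * (1 + u / e).
Proof.
move=> /andP[a0 a1] e0 u0.
have [ue|ue] := leP u e.
  apply: (le_trans (_ : _ <= e `^ a)); first by apply: ge0_ler_powR => //; rewrite nnegrE// ltW.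
  by rewrite ler_peMr ?powR_ge0// lerDl divr_ge0// ltW.
have h : u = e * (u / e) by field; rewrite gt_eqF.
rewrite {1}h powRM ?divr_ge0 ?(ltW e0)// ler_wpM2l ?powR_ge0//.
apply: (le_trans (_ : _ <= (u / e) `^ 1)).
  by rewrite ler_powR// ler_pdivlMr// mul1r ltW.
by rewrite powRr1 ?divr_ge0 ?(ltW e0)// lerDr.
Qed.

(** Truncation at [K]: the part above [K] is paid for by a moment of order
[2 + delta]. *)
Lemma split_square (delta x K : R) (B : bool) : 0 < delta -> 0 < K -> 0 <= x ->
  x ^+ 2 * B%:R <= K ^+ 2 * B%:R + K `^ (- delta) * x `^ (2 + delta).
Proof.
move=> d0 K0 x0; have [xK|xK] := leP x K.
  apply: (le_trans (_ : _ <= K ^+ 2 * B%:R)).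
    by rewrite ler_wpM2r// ler_pXn2r ?nnegrE// ltW.
  by rewrite lerDl mulr_ge0 ?powR_ge0.
have x1 : 0 < x by apply: lt_trans xK.
apply: (le_trans (_ : _ <= x ^+ 2)).
  by case: B; rewrite ?mulr1// mulr0 sqr_ge0.
apply: (le_trans (_ : _ <= K `^ (- delta) * x `^ (2 + delta))); last by rewrite lerDr mulr_ge0// sqr_ge0.
rewrite powRD ?(gt_eqF x1) ?implybT// powR_mulrn// mulrCA ler_peMr ?sqr_ge0//.
rewrite powRN ler_pdivlMl ?powR_gt0// mulr1.
by apply: ge0_ler_powR; rewrite ?nnegrE ltW.
Qed.

(** Convexity of the square. Iterated with the ratio [s] of a geometric series, it
takes the place of Minkowski's inequality. *)
Lemma sqrD_le_weighted (s u v : R) : 0 < s < 1 -> (u + v) ^+ 2 <= u ^+ 2 / (1 - s) + v ^+ 2 / s.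
Proof.
move=> /andP[s0 s1]; have s1' : 0 < 1 - s by lra.
rewrite -subr_ge0.
have -> : u ^+ 2 / (1 - s) + v ^+ 2 / s - (u + v) ^+ 2 = (s * u - (1 - s) * v) ^+ 2 / (s * (1 - s)).
  by field; rewrite !gt_eqF.
by rewrite divr_ge0 ?sqr_ge0// mulr_ge0// ltW.
Qed.

End ElementaryInequalities.

(** * A version of the processes that never loses individuals *)

Lemma measurable_index d (T : measurableType d) d2 (T2 : measurableType d2)
  (a : T -> nat) (f : nat -> T -> T2) :
  measurable_fun [set: T] a -> (forall n, measurable_fun [set: T] (f n)) ->
  measurable_fun [set: T] (fun w => f (a w) w).
Proof.
move=> ma mf _ B mB; rewrite setTI.
rewrite (_ : _ @^-1` B = \bigcup_n (a @^-1` [set n] `&` f n @^-1` B)).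
  apply: bigcup_measurable => n _; apply: measurableI.
    by rewrite -[X in measurable X]setTI; exact: ma.
  by rewrite -[X in measurable X]setTI; exact: mf.
apply/seteqP; split => w /=; first by move=> h; exists (a w).
by move=> [n _ [/= <-]].
Qed.

Section PositiveProcess.
Context d (T : measurableType d) (R : realType) (P : probability T R).
Context (law : R.-pker R ~> nat) (xi : nat -> {RV P >-> (R * R)%type}).
Context (X : bool -> nat -> nat -> {RV P >-> nat}).
Hypotheses (Hxi : iid_environment xi) (HX : offspring_given_environment law xi X)
  (Hst : standing_assumptions law xi X).
Local Notation E := (Ex P).
Local Notation "G .-meas f" := (measurable_fun [set: g_sigma_algebraType G] (f : g_sigma_algebraType G -> _)) (at level 2).
Local Notation past := (past xi X).
Local Notation rest := (rest xi X).
Local Notation off_prob := (off_prob law xi).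

(** Since almost surely no individual dies without offspring, forcing the offspring
numbers and their means to be at least one changes nothing up to null sets. In
return, monotonicity of the population and nonnegativity of [M] hold pointwise. *)
Definition Xp l g k (w : T) : nat := maxn 1 (X l g k w).

Fixpoint Zp l n (w : T) : nat :=
  if n is n'.+1 then (\sum_(i < Zp l n' w) Xp l n' i w)%N else 1%N.

Definition mp_of (x : R) : R := Num.max 1 (fine (mean_offspring law x)).
Definition mp l n w := mp_of (env xi l n w).
Definition Mp l n w := ln (mp l n w).

Lemma mp_of_ge1 x : 1 <= mp_of x.
Proof. by rewrite /mp_of le_max lexx. Qed.

Lemma mp_ge1 l n w : 1 <= mp l n w. Proof. exact: mp_of_ge1. Qed.

Lemma mp_gt0 l n w : 0 < mp l n w. Proof. exact: lt_le_trans (mp_ge1 l n w). Qed.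

Lemma Mp_ge0 l n w : 0 <= Mp l n w. Proof. exact/ln_ge0/mp_ge1. Qed.

Lemma Xp_gt0 l g k w : (0 < Xp l g k w)%N. Proof. by rewrite leq_max. Qed.

Lemma Zp_le l n w : (Zp l n w <= Zp l n.+1 w)%N.
Proof.
rewrite /= -[leqLHS]card_ord -sum1_card; apply: leq_sum => i _; exact: Xp_gt0.
Qed.

Lemma Zp_gt0 l n w : (0 < Zp l n w)%N.
Proof. by elim: n => // n IH; exact: leq_trans (Zp_le l n w). Qed.

Lemma measurable_mean_offspring : measurable_fun [set: R] (mean_offspring law).
Proof.
apply: ge0_emeasurable_sum => [k x _ _|k _]; first by rewrite mule_ge0// lee_fin.
by apply: emeasurable_funM => //; exact: measurable_kernel.
Qed.

Lemma measurable_mp_of : measurable_fun [set: R] mp_of.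
Proof.
apply: measurable_maxr => //; apply: (measurableT_comp (fine_measurable measurableT)).
exact: measurable_mean_offspring.
Qed.

Lemma mpVE l n w : (mp l n w)^-1 = expR (- Mp l n w).
Proof. by rewrite expRN lnK// posrE mp_gt0. Qed.

Section meas.
Context (G : set_system T).

Lemma meas_mp l n : G.-meas (xi n : T -> R * R) -> G.-meas (mp l n).
Proof. by move=> h; apply: (measurableT_comp measurable_mp_of); exact: meas_env. Qed.

Lemma meas_Mp l n : G.-meas (xi n : T -> R * R) -> G.-meas (Mp l n).
Proof. by move=> h; apply: (measurableT_comp (@measurable_ln _)); exact: meas_mp. Qed.

Lemma meas_mpV l n : G.-meas (xi n : T -> R * R) -> G.-meas (fun w => (mp l n w)^-1).
Proof.
move=> h; under eq_fun do rewrite mpVE; apply: measurableT_comp => //.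
by apply: measurable_funN; exact: meas_Mp.
Qed.

Lemma meas_Xp l g k : G.-meas (X l g k : T -> nat) -> G.-meas (Xp l g k).
Proof.
move=> mX _ B mB; rewrite setTI; have := mX measurableT [set n | B (maxn 1 n)].
by rewrite setTI; apply.
Qed.

Lemma meas_addn (a b : T -> nat) : G.-meas a -> G.-meas b -> G.-meas (fun w => (a w + b w)%N).
Proof.
move=> ma mb; apply: (@measurable_index _ (g_sigma_algebraType G) _ _ a (fun n w => (n + b w)%N)) => // n.
move=> _ B mB; rewrite setTI; have := mb measurableT [set k | B (n + k)%N].
by rewrite setTI; apply.
Qed.

Lemma meas_random_sum (a : T -> nat) (Y : nat -> T -> nat) :
  G.-meas a -> (forall i, G.-meas (Y i)) -> G.-meas (fun w => (\sum_(i < a w) Y i w)%N).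
Proof.
move=> ma mY; apply: (@measurable_index _ (g_sigma_algebraType G) _ _ a
  (fun N w => (\sum_(i < N) Y i w)%N)) => //.
elim=> [|N IHN]; first by under eq_fun do rewrite big_ord0; exact: measurable_cst.
by under eq_fun do rewrite big_ord_recr; exact: meas_addn.
Qed.

Lemma meas_Zp l n : (forall g k, (g < n)%N -> G.-meas (X l g k : T -> nat)) -> G.-meas (Zp l n).
Proof.
elim: n => [|n IH] mX; first exact: measurable_cst.
apply: (meas_random_sum (a := Zp l n) (Y := Xp l n)) => [|i]; last by apply: meas_Xp; exact: mX.
by apply: IH => g k gn; apply: mX; exact: ltnW.
Qed.

Lemma meas_Z l n : (forall g k, (g < n)%N -> G.-meas (X l g k : T -> nat)) -> G.-meas (Z X l n).
Proof.
elim: n => [|n IH] mX; first exact: measurable_cst.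
apply: (meas_random_sum (a := Z X l n) (Y := X l n)) => [|i]; last exact: mX.
by apply: IH => g k gn; apply: mX; exact: ltnW.
Qed.

Lemma meas_natR (f : nat -> R) (a : T -> nat) : G.-meas a -> G.-meas (fun w => f (a w)).
Proof.
move=> ma; apply: (@measurable_index _ (g_sigma_algebraType G) _ _ a (fun n _ => f n)) => // n.
Qed.

End meas.

Lemma past_Zp i l n : (n <= i)%N -> (past i).-meas (Zp l n).
Proof. by move=> ni; apply: meas_Zp => g k gn; apply: past_meas_X; exact: leq_trans ni. Qed.

Lemma rest_Zp l i k l' : (rest (l, i, k)).-meas (Zp l' i).
Proof.
apply: meas_Zp => g h gi; apply: rest_meas_X.
by apply/eqP => -[_ gi']; rewrite gi' ltnn in gi.
Qed.

Lemma rest_Xp l i k h : h != k -> (rest (l, i, k)).-meas (Xp l i h).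
Proof.
move=> hk; apply: meas_Xp; apply: rest_meas_X.
by apply/eqP => -[hk']; rewrite hk' eqxx in hk.
Qed.

Lemma rest_mp l i k n l' : (rest (l, i, k)).-meas (mp l' n).
Proof. by apply: meas_mp; exact: rest_meas_env. Qed.

Lemma past_Mp i n l : n != i -> (past i).-meas (Mp l n).
Proof. by move=> ni; apply: meas_Mp; exact: past_meas_env. Qed.

Lemma measT_Zp l n : measurable_fun [set: T] (Zp l n).
Proof. by apply: (meas_sub (@pastm _ _ _ _ xi X n)); exact: past_Zp. Qed.

Lemma measT_Z l n : measurable_fun [set: T] (Z X l n).
Proof.
apply: (meas_sub (@pastm _ _ _ _ xi X n)); apply: meas_Z => g k gn; exact: past_meas_X.
Qed.

Lemma measT_Mp l n : measurable_fun [set: T] (Mp l n).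
Proof. by apply: (meas_sub (@restm _ _ _ _ xi X (l, 0, 0)%N)); apply: meas_Mp; exact: rest_meas_env. Qed.

Lemma measT_mp l n : measurable_fun [set: T] (mp l n).
Proof. by apply: (meas_sub (@restm _ _ _ _ xi X (l, 0, 0)%N)); exact: rest_mp. Qed.

Lemma measT_Xp l i h : measurable_fun [set: T] (Xp l i h).
Proof. by apply: (meas_sub (@restm _ _ _ _ xi X (l, i, h.+1)%N)); apply: rest_Xp; rewrite ltn_eqF. Qed.

Lemma measT_natR (f : nat -> R) (a : T -> nat) : measurable_fun [set: T] a ->
  measurable_fun [set: T] (fun w => f (a w)).
Proof. by move=> ma; apply: (@measurable_index _ T _ _ a (fun n _ => f n)). Qed.

Lemma measurable_envT l n : measurable_fun [set: T] (env xi l n).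
Proof. by apply: (meas_sub (@env_setsm _ _ _ _ xi)); apply: meas_env; exact: env_sets_meas. Qed.

Lemma env_law l n (B : set R) : measurable B ->
  P (env xi l n @^-1` B) = P (env xi l 0 @^-1` B).
Proof.
move=> mB; have [_ Hid] := Hxi.
pose D := (if l then snd else fst) @^-1` B : set (R * R).
have mD : measurable D.
  rewrite /D; case: (l).
    by rewrite -[X in measurable X]setTI; exact: measurable_snd.
  by rewrite -[X in measurable X]setTI; exact: measurable_fst.
have h k : env xi l k @^-1` B = xi k @^-1` D by rewrite /D /env; case: (l).
by rewrite !h; exact: Hid.
Qed.

Lemma integral_env l n (f : R -> \bar R) : measurable_fun [set: R] f ->
  (forall x, 0 <= f x)%E -> (\int[P]_w f (env xi l n w) = \int[P]_w f (env xi l 0%N w))%E.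
Proof.
move=> mf f0.
pose U k : {mfun T >-> R} := mfun_Sub (mem_set (measurable_envT l k)).
have h k : (\int[P]_w f (env xi l k w) = \int[distribution P (U k)]_y f y)%E.
  by rewrite ge0_integral_distribution.
rewrite !h; apply: eq_measure_integral => A mA _; exact: env_law.
Qed.

Lemma ae_env l n (Q : set R) : measurable Q ->
  {ae P, forall w, Q (env xi l 0%N w)} -> {ae P, forall w, Q (env xi l n w)}.
Proof.
move=> mQ h.
have mC k : measurable (env xi l k @^-1` ~` Q).
  by rewrite -[X in measurable X]setTI; apply: measurable_envT => //; exact: measurableC.
have : P.-negligible (env xi l 0%N @^-1` ~` Q) by [].
move/(negligibleP _ (mC _)) => h0.
apply: (negligibleS (A := env xi l n @^-1` ~` Q)) => //.
apply/(negligibleP _ (mC _)); apply: etrans h0.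
by apply: env_law; exact: measurableC.
Qed.

(** Environments in which [mp_of] is the mean of the offspring law. *)
Definition good_env (x : R) : Prop :=
  (mean_offspring law x < +oo)%E /\ law x [set 0%N] = 0%E.

Lemma measurable_good : measurable good_env.
Proof.
apply: measurableI.
  rewrite -[X in measurable X]setTI.
  exact: (emeasurable_fun_infty_o measurableT measurable_mean_offspring).
have := measurable_kernel law [set 0%N] I measurableT _ (emeasurable_set1 0%R).
by rewrite setTI.
Qed.

Lemma ae_good l n : {ae P, forall w, good_env (env xi l n w)}.
Proof.
apply: ae_env; first exact: measurable_good.
have [h1 _ _ h2 _] := Hst.
by apply: filterS2 (h1 l) (h2 l) => w; split.
Qed.

Lemma sum_law x : (\sum_(0 <= b <oo) law x [set b] = 1)%E.
Proof.
rewrite -(@prob_kernel _ _ _ _ _ law x) -measure_semi_bigcup//.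
- by congr (law x _); apply/seteqP; split => // n _; exists n.
- by move=> i j _ _ [n [-> ->]].
Qed.

Lemma good_mean_ge1 x : good_env x -> (1 <= mean_offspring law x)%E.
Proof.
move=> [_ l0]; rewrite -(sum_law x); apply: lee_nneseries => // b _.
case: b => [|b]; first by rewrite l0 mule0.
by rewrite -[leLHS]mul1e lee_wpmul2r// lee_fin ler1n.
Qed.

Lemma good_meanE x : good_env x -> mean_offspring law x = (mp_of x)%:E.
Proof.
move=> gx; have h1 := good_mean_ge1 gx; have [h2 _] := gx.
have hf : mean_offspring law x \is a fin_num.
  by rewrite ge0_fin_numE// (le_trans _ h1).
rewrite /mp_of max_r ?fineK//.
by rewrite -lee_fin fineK.
Qed.

Lemma good_sum x : good_env x ->
  (\sum_(0 <= b <oo) ((maxn 1 b)%:R)%:E * law x [set b] = (mp_of x)%:E)%E.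
Proof.
move=> gx; rewrite -good_meanE//; apply: eq_eseriesr => b _.
by case: b => [|b]; [case: gx => _ ->; rewrite !mule0|rewrite (maxn_idPr _)].
Qed.

Lemma ae_Xp l g k : {ae P, forall w, Xp l g k w = X l g k w}.
Proof.
suff h : P (Xj X (l, g, k) @^-1` [set 0%N]) = 0%E.
  apply: (negligibleS (A := Xj X (l, g, k) @^-1` [set 0%N])); last first.
    apply/negligibleP => //; apply: measurable_pre => //; exact: measurable_Xj.
  move=> w /=; rewrite /Xp /Xj/=; case: (X l g k w) => // n.
  by rewrite (maxn_idPr _).
have := @rest_cond _ _ _ _ _ _ _ HX (l, g, k) [set 0%N] setT.
rewrite setTI => ->; last exact: (@measurableT _ (g_sigma_algebraType (rest (l, g, k)))).
rewrite (ae_eq_integral (cst 0%E))//; first exact: integral0.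
  apply/measurable_EFinP.
  by apply: (meas_sub (@env_setsm _ _ _ _ xi)); apply: meas_off_prob; exact: env_sets_meas.
apply: filterS (ae_good l g) => w [_ h] _.
by rewrite off_probE h.
Qed.

Lemma ae_Zp : {ae P, forall w, forall l n, Zp l n w = Z X l n w}.
Proof.
have h : {ae P, forall w, forall g k, forall l, Xp l g k w = X l g k w}.
  apply: ae_foralln => g; apply: ae_foralln => k.
  apply: filterS2 (ae_Xp false g k) (ae_Xp true g k) => w h1 h2.
  by case.
apply: filterS h => w h l; elim=> [//|n IH] /=; rewrite IH.
by apply: eq_bigr => i _; exact: h.
Qed.

Lemma ae_mp l n : {ae P, forall w, mp l n w = m law xi l n w}.
Proof. by apply: filterS (ae_good l n) => w g; rewrite /m good_meanE. Qed.

(** The factor [H] is any function of the environments and the other offspring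
numbers: conditionally on these, [X / m] has mean one. *)
Lemma offspring_mean_one l i k (H : T -> R) : (rest (l, i, k)).-meas H -> (forall w, 0 <= H w) ->
  (\int[P]_w (H w * ((Xp l i k w)%:R / mp l i w))%:E = \int[P]_w (H w)%:E)%E.
Proof.
move=> mH H0.
have mHT := meas_sub (@restm _ _ _ _ xi X _) mH.
have mmp := measT_mp l i.
have := rest_series HX (j0 := (l, i, k)) (k := fun b w => H w * ((maxn 1 b)%:R / mp l i w)).
rewrite /Xj/= -/(Xp l i k _) => ->; last 2 first.
- move=> b; apply: measurable_funM => //; apply: measurable_funM => //.
  by apply: meas_mpV; exact: rest_meas_env.
- by move=> b w; rewrite mulr_ge0 ?divr_ge0// ltW// mp_gt0.
have m0 w b : 0 <= H w * ((maxn 1 b)%:R / mp l i w) by rewrite mulr_ge0 ?divr_ge0// ltW// mp_gt0.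
apply: ge0_ae_eq_integral => //.
- apply: ge0_emeasurable_sum => b; first by move=> w _ _; rewrite lee_fin mulr_ge0 ?off_prob_ge0.
  move=> _; apply/measurable_EFinP; apply: (meas_sub (@restm _ _ _ _ xi X (l, i, k))).
  apply: measurable_funM; last by apply: meas_off_prob; exact: rest_meas_env.
  apply: measurable_funM => //; apply: measurable_funM => //.
  by apply: meas_mpV; exact: rest_meas_env.
- exact/measurable_EFinP.
- by move=> w _; apply: nneseries_ge0 => b _ _; rewrite lee_fin mulr_ge0 ?off_prob_ge0.
- by move=> w _; rewrite lee_fin.
apply: filterS (ae_good l i) => w g _.
transitivity ((H w / mp l i w)%:E * \sum_(0 <= b <oo) ((maxn 1 b)%:R)%:E * law (env xi l i w) [set b])%E.
  rewrite -nneseriesZl//.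
  apply: eq_eseriesr => b _; rewrite EFinM off_probE/= muleA -!EFinM; congr (_%:E * _)%E.
  by rewrite mulrAC mulrA.
by rewrite good_sum// -EFinM divfK// gt_eqF// mp_gt0.
Qed.

End PositiveProcess.

(** * Integration with respect to one offspring number *)

Section LimitTools.
Context d (T : measurableType d) (R : realType) (P : probability T R).
Local Notation E := (Ex P).

Lemma L1_integral_le (f : T -> R) c : measurable_fun [set: T] f -> (forall w, 0 <= f w) ->
  (\int[P]_w (f w)%:E <= c%:E)%E -> L1 P f /\ E f <= c.
Proof.
move=> mf f0 fc; have f1 : L1 P f.
  apply/integrableP; split; first exact/measurable_EFinP.
  under eq_integral do rewrite /= ger0_norm//.
  by apply: le_lt_trans fc _; rewrite ltry.
by split => //; rewrite -lee_fin -ExE.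
Qed.

(** Monotone convergence along the sets where [a] is bounded. For [a] the size of a
generation, it reduces random sums to sums of a fixed number of terms. *)
Lemma L1_trunc_le (f : T -> R) (a : T -> nat) c : measurable_fun [set: T] f ->
  measurable_fun [set: T] a -> (forall w, 0 <= f w) ->
  (forall k, L1 P (fun w => f w * (a w <= k)%N%:R) /\ E (fun w => f w * (a w <= k)%N%:R) <= c) ->
  L1 P f /\ E f <= c.
Proof.
move=> mf ma f0 H; apply: L1_integral_le => //.
pose g k w := (f w * (a w <= k)%N%:R)%:E.
have gf w : limn (g ^~ w) = (f w)%:E.
  apply/cvg_lim => //; apply: cvg_near_cst.
  by exists (a w) => // k /= ak; rewrite /g ak mulr1.
under eq_integral do rewrite -gf.
rewrite monotone_convergence//; last 3 first.
- by move=> k; exact: (measurable_int P (H k).1).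
- by move=> k w _; rewrite lee_fin mulr_ge0.
- move=> w _ j k jk; rewrite lee_fin ler_wpM2l// ler_nat.
  by case: (leqP (a w) j) => // aj; rewrite (leq_trans aj).
apply: lime_le; last first.
  by near=> k; rewrite /g ExE ?lee_fin; have [] := H k.
apply: ereal_nondecreasing_is_cvgn => j k jk.
apply: ge0_le_integral => //.
- by move=> w _; rewrite lee_fin mulr_ge0.
- exact: (measurable_int P (H j).1).
- exact: (measurable_int P (H k).1).
move=> w _; rewrite lee_fin ler_wpM2l// ler_nat.
by case: (leqP (a w) j) => // aj; rewrite (leq_trans aj).
Unshelve. all: by end_near.
Qed.

(** The convex function [1 / y] lies above its tangent at the arithmetic mean. *)
Lemma harmonic_mean_le n (x : nat -> R) : (0 < n)%N -> (forall i, 0 < x i) ->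
  (\sum_(i < n) x i)^-1 <= (n%:R ^+ 2)^-1 * \sum_(i < n) (x i)^-1.
Proof.
move=> n0 x0; set S := \sum_(i < n) x i.
have S0 : 0 < S.
  rewrite /S; case: n n0 @S => // n _; rewrite big_ord_recl ltr_pwDl//.
  by apply: sumr_ge0 => i _; exact: ltW.
have N0 : 0 < n%:R :> R by rewrite ltr0n.
pose A := S / n%:R; have A0 : 0 < A by rewrite divr_gt0.
have tangent y : 0 < y -> 2 / A - y / A ^+ 2 <= y^-1.
  move=> y0; rewrite -subr_ge0.
  have -> : y^-1 - (2 / A - y / A ^+ 2) = (A - y) ^+ 2 / (y * A ^+ 2) by field; rewrite !gt_eqF.
  by rewrite divr_ge0 ?sqr_ge0// mulr_ge0 ?sqr_ge0// ltW.
have : \sum_(i < n) (2 / A - x i / A ^+ 2) <= \sum_(i < n) (x i)^-1.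
  by apply: ler_sum => i _; exact: tangent.
rewrite sumrB sumr_const card_ord -mulr_suml -/S => h.
rewrite ler_pdivlMl ?exprn_gt0//; apply: le_trans h.
rewrite le_eqVlt; apply/orP; left; apply/eqP.
by rewrite -mulr_natl /A; field; rewrite !gt_eqF.
Qed.

End LimitTools.

Section OffspringMoments.
Context d (T : measurableType d) (R : realType) (P : probability T R).
Context (law : R.-pker R ~> nat) (xi : nat -> {RV P >-> (R * R)%type}).
Context (X : bool -> nat -> nat -> {RV P >-> nat}).
Hypotheses (Hxi : iid_environment xi) (HX : offspring_given_environment law xi X)
  (Hst : standing_assumptions law xi X).
Local Notation E := (Ex P).
Local Notation "G .-meas f" := (measurable_fun [set: g_sigma_algebraType G] (f : g_sigma_algebraType G -> _)) (at level 2).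
Local Notation past := (past xi X).
Local Notation rest := (rest xi X).
Local Notation off_prob := (off_prob law xi).
Local Notation Xp := (Xp X).
Local Notation Zp := (Zp X).
Local Notation mp := (mp law xi).
Local Notation Mp := (Mp law xi).

Lemma past_rest l i k (F : T -> R) : (past i).-meas F -> (rest (l, i, k)).-meas F.
Proof.
move=> mF _ B mB; have := mF measurableT B mB.
apply: sub_smallest2r; first exact: smallest_sigma_algebra.
move=> A [D [s [C [sD us si ->]]]]; exists D, s, C; split => //.
  apply: (smallest_sub (smallest_sigma_algebra _ _) (@env_except_sub _ _ _ _ _ i)) sD.
by apply/negP => /si; rewrite ltnn.
Qed.

(** Given everything else the offspring number follows the law of its environment,
and the latter is independent of the past and distributed as in generation
[0]. *)
Lemma integral_offspring_past l i k (F : T -> R) (psi : nat -> R -> R) :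
  (past i).-meas F -> (forall w, 0 <= F w) ->
  (forall b, measurable_fun [set: R] (psi b)) -> (forall b x, 0 <= psi b x) ->
  (\int[P]_w (F w * psi (Xp l i k w) (env xi l i w))%:E =
   (\int[P]_w (F w)%:E) * \int[P]_w (psi (Xp l 0%N 0%N w) (env xi l 0%N w))%:E)%E.
Proof.
move=> mF F0 mpsi psi0.
pose Psi x := (\sum_(0 <= b <oo) (psi (maxn 1 b) x)%:E * law x [set b])%E.
have Psi0 x : (0 <= Psi x)%E.
  by apply: nneseries_ge0 => b _ _; rewrite mule_ge0 ?lee_fin.
have mPsi : measurable_fun [set: R] Psi.
  apply: ge0_emeasurable_sum => [b x _ _|b _]; first by rewrite mule_ge0 ?lee_fin.
  by apply: emeasurable_funM; [exact/measurable_EFinP|exact: measurable_kernel].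
have key i' k' (H : T -> R) : (rest (l, i', k')).-meas H -> (forall w, 0 <= H w) ->
    (\int[P]_w (H w * psi (Xp l i' k' w) (env xi l i' w))%:E =
     \int[P]_w ((H w)%:E * Psi (env xi l i' w)))%E.
  move=> mH H0.
  have := rest_series HX (j0 := (l, i', k')) (k := fun b w => H w * psi (maxn 1 b) (env xi l i' w)).
  rewrite /Xj/= -/(Xp l i' k' _) => ->; last 2 first.
  - move=> b; apply: measurable_funM => //; apply: (measurableT_comp (mpsi _)).
    by apply: meas_env; exact: rest_meas_env.
  - by move=> b w; rewrite mulr_ge0.
  apply: eq_integral => w _; rewrite -nneseriesZl//; last by move=> b _; rewrite mule_ge0 ?lee_fin.
  by apply: eq_eseriesr => b _; rewrite EFinM off_probE/= EFinM muleA.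
rewrite key//; last exact: past_rest.
have -> : (\int[P]_w (psi (Xp l 0%N 0%N w) (env xi l 0%N w))%:E = \int[P]_w Psi (env xi l 0%N w))%E.
  transitivity (\int[P]_w (1 * psi (Xp l 0%N 0%N w) (env xi l 0%N w))%:E)%E.
    by apply: eq_integral => w _; rewrite mul1r.
  rewrite (key 0%N 0%N (fun=> 1))//.
  by apply: eq_integral => w _; rewrite mul1e.
rewrite -(integral_env Hxi l i mPsi Psi0).
pose pr (v : R * R) := if l then v.2 else v.1.
have mpr : measurable_fun [set: R * R] pr.
  by rewrite /pr; case: (l); [exact: measurable_snd|exact: measurable_fst].
have prE w : env xi l i w = pr (xi i w) by rewrite /env /pr; case: (l).
have mxi : measurable_fun [set: T] (xi i) by exact: measurable_funP.
have := @indep_integral _ _ _ P (past i) _ _ (xi i) (@pastm _ _ _ _ xi X i) mxi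
  (past_indep Hxi HX (i:=i)) (fun u => (F u.1)%:E * Psi (pr u.2))%E.
rewrite /= => h.
under eq_integral do rewrite prE.
rewrite h//.
- rewrite -ge0_integralZl//.
  + apply: eq_integral => v _; rewrite ge0_integralZr// ?prE//; last by move=> w _; rewrite lee_fin.
    by apply/measurable_EFinP; apply: (meas_sub (@pastm _ _ _ _ xi X i)).
  + apply: (measurableT_comp mPsi); exact: measurable_envT.
  + by apply: integral_ge0 => w _; rewrite lee_fin.
- apply: emeasurable_funM.
    by apply/measurable_EFinP; apply: (measurableT_comp mF); exact: measurable_fst.
  by apply: (measurableT_comp mPsi); apply: (measurableT_comp mpr); exact: measurable_snd.
- by move=> u; rewrite mule_ge0// lee_fin.
Qed.

Lemma offspring_past l i k (F : T -> R) (psi : nat -> R -> R) :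
  (past i).-meas F -> (forall w, 0 <= F w) -> L1 P F ->
  (forall b, measurable_fun [set: R] (psi b)) -> (forall b x, 0 <= psi b x) ->
  L1 P (fun w => psi (Xp l 0%N 0%N w) (env xi l 0%N w)) ->
  L1 P (fun w => F w * psi (Xp l i k w) (env xi l i w)) /\
  E (fun w => F w * psi (Xp l i k w) (env xi l i w)) =
    E F * E (fun w => psi (Xp l 0%N 0%N w) (env xi l 0%N w)).
Proof.
move=> mF F0 F1 mpsi psi0 psi1.
have H := integral_offspring_past l k mF F0 mpsi psi0.
rewrite (ExE F1) (ExE psi1) -EFinM in H.
have mprod : measurable_fun [set: T] (fun w => F w * psi (Xp l i k w) (env xi l i w)).
  apply: measurable_funM; first exact: (L1m F1).
  apply: (@measurable_index _ T _ _ (Xp l i k) (fun b w => psi b (env xi l i w))).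
    exact: measT_Xp.
  by move=> b; apply: (measurableT_comp (mpsi b)); exact: measurable_envT.
have prod0 w : 0 <= F w * psi (Xp l i k w) (env xi l i w) by rewrite mulr_ge0.
have [h1 _] : L1 P (fun w => F w * psi (Xp l i k w) (env xi l i w)) /\ _ :=
  L1_integral_le mprod prod0 (eq_ind_r (fun z => z <= _)%E (lexx _) H).
split => //; apply: EFin_inj; rewrite -H ExE//.
Qed.

(** The signed factor will be the derivative term of the von Bahr--Esseen
inequality. *)
Lemma offspring_mean_one_L1 l i k (H : T -> R) : (rest (l, i, k)).-meas H -> L1 P H ->
  L1 P (fun w => H w * ((Xp l i k w)%:R / mp l i w)) /\
  E (fun w => H w * ((Xp l i k w)%:R / mp l i w)) = E H.
Proof.
move=> mH H1.
pose x w := (Xp l i k w)%:R / mp l i w.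
have x0 w : 0 <= x w by rewrite divr_ge0// ltW// mp_gt0.
have mx : measurable_fun [set: T] x.
  apply: measurable_funM; first exact: measT_natR (measT_Xp _ _ _ _ _).
  apply: (meas_sub (@restm _ _ _ _ xi X (l, i, k))).
  by apply: meas_mpV; exact: rest_meas_env.
have pos (h : T -> R) : (rest (l, i, k)).-meas h -> L1 P h -> (forall w, 0 <= h w) ->
    L1 P (fun w => h w * x w) /\ E (fun w => h w * x w) = E h.
  move=> mh h1 h0; have I := offspring_mean_one Hxi HX Hst mh h0.
  rewrite (ExE h1) in I.
  have mhx : measurable_fun [set: T] (fun w => h w * x w).
    by apply: measurable_funM => //; exact: (L1m h1).
  have hx0 w : 0 <= h w * x w by rewrite mulr_ge0.
  have [hx1 _] := L1_integral_le mhx hx0 (eq_ind_r (fun z => z <= _)%E (lexx _) I).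
  by split => //; apply: EFin_inj; rewrite -ExE.
have mHT := L1m H1.
pose Hp w := Num.max (H w) 0; pose Hn w := Num.max (- H w) 0.
have HE w : H w = Hp w - Hn w by rewrite /Hp /Hn; case: (leP (H w) 0); case: (leP (- H w) 0); lra.
have p1 : L1 P Hp.
  apply: L1_le (L1_norm H1); first exact: measurable_maxr.
  by move=> w; rewrite ger0_norm ?le_max ?lexx ?orbT// ge_max ler_norm normr_ge0.
have n1 : L1 P Hn.
  apply: L1_le (L1_norm H1); first by apply: measurable_maxr => //; exact: measurable_funN.
  by move=> w; rewrite ger0_norm ?le_max ?lexx ?orbT// ge_max -normrN ler_norm normr_ge0.
have [p2 pE] : L1 P (fun w => Hp w * x w) /\ E (fun w => Hp w * x w) = E Hp.
  by apply: pos => //; [exact: measurable_maxr|move=> w; rewrite le_max lexx orbT].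
have [n2 nE] : L1 P (fun w => Hn w * x w) /\ E (fun w => Hn w * x w) = E Hn.
  apply: pos => //; last by move=> w; rewrite le_max lexx orbT.
  by apply: measurable_maxr => //; exact: measurable_funN.
have -> : (fun w => H w * x w) = (fun w => Hp w * x w - Hn w * x w).
  by apply/funext => w; rewrite HE mulrBl.
rewrite [in E H](_ : H = fun w => Hp w - Hn w); last by apply/funext.
rewrite !ExB// pE nE; split => //.
by apply: L1D => //; exact: L1N.
Qed.

End OffspringMoments.

(** * Inverse moments and the ratio of successive generations *)

Section LogMoments.
Context d (T : measurableType d) (R : realType) (P : probability T R).
Context (law : R.-pker R ~> nat) (xi : nat -> {RV P >-> (R * R)%type}).
Context (X : bool -> nat -> nat -> {RV P >-> nat}).
Hypotheses (Hxi : iid_environment xi) (HX : offspring_given_environment law xi X)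
  (Hst : standing_assumptions law xi X).
Local Notation E := (Ex P).
Local Notation "G .-meas f" := (measurable_fun [set: g_sigma_algebraType G] (f : g_sigma_algebraType G -> _)) (at level 2).
Local Notation past := (past xi X).
Local Notation rest := (rest xi X).
Local Notation Xp := (Xp X).
Local Notation Zp := (Zp X).
Local Notation mp := (mp law xi).
Local Notation Mp := (Mp law xi).

Context (l : bool).

Lemma powR_le1 (x a : R) : 0 <= x <= 1 -> 0 <= a -> x `^ a <= 1.
Proof.
move=> /andP[x0 x1] a0; have e : 1 `^ a = 1 :> R by rewrite powR1.
by rewrite -[leRHS]e; apply: ge0_ler_powR; rewrite ?nnegrE.
Qed.

Definition Zi i (w : T) : R := ((Zp l i w)%:R)^-1.

Lemma Zi_gt0 i w : 0 < Zi i w. Proof. by rewrite invr_gt0 ltr0n Zp_gt0. Qed.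

Lemma Zi_le1 i w : Zi i w <= 1.
Proof. by rewrite invf_le1 ?ltr0n ?ler1n Zp_gt0. Qed.

Lemma Zi_powR_le1 i w a : 0 <= a -> Zi i w `^ a <= 1.
Proof. by move=> a0; apply: powR_le1 => //; rewrite Zi_le1 ltW// Zi_gt0. Qed.

Lemma past_natZ i (f : nat -> R) : (past i).-meas (fun w => f (Zp l i w)).
Proof. by apply: meas_natR; exact: past_Zp. Qed.

Lemma rest_natZ i k (f : nat -> R) : (rest (l, i, k)).-meas (fun w => f (Zp l i w)).
Proof. by apply: meas_natR; exact: rest_Zp. Qed.

Lemma measT_natZ i (f : nat -> R) : measurable_fun [set: T] (fun w => f (Zp l i w)).
Proof. by apply: measT_natR; exact: measT_Zp. Qed.

(** A random number [N] of terms, written as a sum of fixed length. *)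
Lemma sum_ltn_minn k N (g : nat -> R) :
  \sum_(j < k) (j < N)%N%:R * g j = \sum_(j < minn k N) g j.
Proof.
elim: k => [|k IH]; first by rewrite min0n !big_ord0.
rewrite big_ord_recr/= IH; case: (leqP N k) => Nk.
  by rewrite mul0r addr0 (minn_idPr (leqW Nk)).
by rewrite mul1r (minn_idPl Nk) big_ord_recr.
Qed.

Lemma bm01 (f : T -> R) : measurable_fun [set: T] f -> (forall w, 0 <= f w <= 1) -> bm f.
Proof. by move=> mf f01; split => //; exists 1 => w; have /andP[? ?] := f01 w; rewrite ger0_norm. Qed.

Lemma bmZi i : bm (Zi i).
Proof. by apply: bm01; [exact: (measT_natZ i (fun n => n%:R^-1))|move=> w; rewrite ltW ?Zi_gt0 ?Zi_le1]. Qed.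

Lemma Zi_Z i w : Zi i w * (Zp l i w)%:R = 1.
Proof. by rewrite mulVf// pnatr_eq0 -lt0n Zp_gt0. Qed.

Section inverse.
Context (theta : R).
Hypotheses (theta0 : 0 < theta) (HXinv : E (fun w => ((Xp l 0 0 w)%:R)^-1) <= theta).

(** The harmonic mean inequality bounds [1 / Z_{i+1}] by [Z_i^(-2)] times the sum of
the [1 / X] over generation [i], and the offspring numbers are independent of
[Z_i]. *)
Lemma inverse_moment_step i : E (Zi i.+1) <= theta * E (Zi i).
Proof.
have [h0 h1] := conj theta0 HXinv.
apply: (L1_trunc_le (a := Zp l i) _ _ _ _).2 => //.
- by have [] := bmZi i.+1.
- exact: measT_Zp.
- by move=> w; exact/ltW/Zi_gt0.
move=> k.
have bt : bm (fun w => (Zp l i w <= k)%N%:R : R).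
  apply: bm01; first exact: (measT_natZ i (fun n => (n <= k)%N%:R)).
  by move=> w; case: leqP; rewrite ?lexx ler01.
split; first by apply: bmL1; apply: bmM => //; exact: bmZi.
pose F (j : nat) w := Zi i w ^+ 2 * (j < Zp l i w)%N%:R.
have F0 j w : 0 <= F j w by rewrite mulr_ge0 ?sqr_ge0.
have F1 j w : F j w <= 1.
  by rewrite mulr_ile1 ?sqr_ge0 ?exprn_ile1 ?Zi_le1//; [exact/ltW/Zi_gt0|case: ltnP].
have mF j : (past i).-meas (F j).
  exact: (@past_natZ i (fun n => (n%:R^-1) ^+ 2 * (j < n)%N%:R)).
have F1' j : L1 P (F j).
  by apply/bmL1/bm01; [exact: (meas_sub (@pastm _ _ _ _ xi X i) (mF j))|move=> w; rewrite F0 F1].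
have mXinv j : measurable_fun [set: T] (fun w => (Xp l i j w)%:R^-1 : R).
  by apply: (measT_natR (fun n => n%:R^-1)); exact: measT_Xp.
have X01 i' j w : 0 <= ((Xp l i' j w)%:R : R)^-1 <= 1.
  by rewrite invr_ge0 ler0n invf_le1 ?ltr0n ?ler1n Xp_gt0.
have XL : L1 P (fun w => ((Xp l 0 0 w)%:R)^-1 : R).
  apply/bmL1/bm01 => //; by apply: (measT_natR (fun n => n%:R^-1)); exact: measT_Xp.
have FX j : L1 P (fun w => F j w * ((Xp l i j w)%:R)^-1) /\
    E (fun w => F j w * ((Xp l i j w)%:R)^-1) = E (F j) * E (fun w => ((Xp l 0 0 w)%:R)^-1).
  by apply: (offspring_past Hxi HX j (psi := fun b _ => b%:R^-1)) => // b x; rewrite invr_ge0.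
apply: (@le_trans _ _ (E (fun w => \sum_(j < k) F j w * ((Xp l i j w)%:R)^-1))).
  apply: Ex_le.
  - by apply: bmL1; apply: bmM => //; exact: bmZi.
  - by apply: L1_sum => j _; exact: (FX j).1.
  move=> w; have [Zk|Zk] := leqP (Zp l i w) k; last first.
    by rewrite mulr0; apply: sumr_ge0 => j _; rewrite mulr_ge0 ?invr_ge0.
  rewrite mulr1; under eq_bigr do rewrite -mulrA.
  rewrite -mulr_sumr (sum_ltn_minn k (Zp l i w) (fun j => (Xp l i j w)%:R^-1)) (minn_idPr Zk).
  rewrite /Zi/= natr_sum exprVn.
  apply: (harmonic_mean_le (x := fun j => (Xp l i j w)%:R)); first exact: Zp_gt0.
  by move=> j; rewrite ltr0n Xp_gt0.
rewrite Ex_sum; last by move=> j _; exact: (FX j).1.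
apply: (@le_trans _ _ (\sum_(j < k) theta * E (F j))).
  by apply: ler_sum => j _; rewrite (FX j).2 mulrC ler_wpM2r// Ex_ge0.
rewrite -mulr_sumr ler_wpM2l ?(ltW theta0)// -Ex_sum//.
apply: Ex_le; [exact: L1_sum|exact/bmL1/bmZi|move=> w].
rewrite -mulr_sumr; under eq_bigr do rewrite -[(_ < _)%N%:R]mulr1.
rewrite (sum_ltn_minn k (Zp l i w) (fun=> 1)) sumr_const card_ord.
have ZE : Zi i w = Zi i w ^+ 2 * (Zp l i w)%:R by rewrite expr2 -mulrA Zi_Z mulr1.
by rewrite [leRHS]ZE ler_wpM2l ?sqr_ge0// ler_nat geq_minr.
Qed.

Lemma inverse_moment i : E (Zi i) <= theta ^+ i.
Proof.
elim: i => [|i IH].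
  by rewrite expr0 /Zi/= (_ : (fun=> _) = fun=> 1) ?Excst//; apply/funext => w; rewrite invr1.
apply: (le_trans (inverse_moment_step i)); rewrite exprS ler_wpM2l//; exact: ltW theta0.
Qed.

End inverse.

Lemma add_moment_step (u e f k kap : R) : u <= 6 * kap * e -> 0 <= f -> k <= kap ->
  u + 6 * (f * k) <= 6 * kap * (e + f).
Proof. by move=> ue f0 kk; have := ler_wpM2l f0 kk; lra. Qed.

Section vonBahrEsseen.
Context (p kappa : R).
Hypotheses (p12 : 1 < p <= 2)
  (kap1 : L1 P (fun w => `|(Xp l 0 0 w)%:R / mp l 0 w - 1| `^ p))
  (kapE : E (fun w => `|(Xp l 0 0 w)%:R / mp l 0 w - 1| `^ p) <= kappa).

Lemma measurable_sgpow : measurable_fun [set: R] (fun a => sgpow a p).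
Proof.
apply: measurable_funM.
  rewrite (_ : Num.sg = fun a : R => (0 <= a)%R%:R - (a <= 0)%R%:R).
    apply: measurable_funB.
      by apply: (@measurable_leb _ _ _ (fun=> 0) id).
    by apply: (@measurable_leb _ _ _ id (fun=> 0)).
  apply/funext => a; case: (ltgtP a 0) => a0.
  - by rewrite ltr0_sg// sub0r.
  - by rewrite gtr0_sg// subr0.
  - by rewrite a0 sgr0 subrr.
by apply: (measurableT_comp (measurable_powR _)); exact: normr_measurable.
Qed.

Lemma sgpow_le a : `|sgpow a p| <= 1 + `|a| `^ p.
Proof.
have /andP[p1 p2] := p12.
have [->|a0] := eqVneq a 0; first by rewrite /sgpow sgr0 mul0r normr0 addr_ge0 ?powR_ge0.
rewrite /sgpow normrM normr_sg a0 mul1r ger0_norm ?powR_ge0//.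
have [a1|a1] := leP `|a| 1.
  apply: (@le_trans _ _ 1); last by rewrite lerDl powR_ge0.
  by apply: powR_le1; rewrite ?normr_ge0//; lra.
apply: (@le_trans _ _ (`|a| `^ p)); last by rewrite lerDr.
by apply: ler_powR; [exact: ltW|lra].
Qed.

Section fixed_generation.
Context (i : nat).

Let x k (w : T) : R := (Xp l i k w)%:R / mp l i w.
(* the contribution of the first [k] individuals to [W_{i+1} / W_i - 1] *)
Let U k (w : T) : R := Zi i w * \sum_(j < k) (j < Zp l i w)%N%:R * (x j w - 1).

Let mxr k h : h != k -> (rest (l, i, k)).-meas (x h).
Proof.
move=> hk; apply: measurable_funM.
  by apply: meas_natR; exact: rest_Xp.
by apply: meas_mpV; exact: rest_meas_env.
Qed.

Let mUr k : (rest (l, i, k)).-meas (U k).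
Proof.
apply: measurable_funM; first exact: (@rest_natZ i k (fun n => n%:R^-1)).
apply: measurable_sum => j; apply: measurable_funM.
  exact: (@rest_natZ i k (fun n => (j < n)%N%:R)).
by apply: measurable_funB => //; apply: mxr; rewrite ltn_eqF.
Qed.

(** Individuals are added one at a time: [X / m - 1] has mean zero given the
previous ones, so [vonBahr_Esseen_step] loses its linear term. *)
Lemma centred_sum_moment k : L1 P (fun w => `|U k w| `^ p) /\
  E (fun w => `|U k w| `^ p) <= 6 * kappa * E (fun w => Zi i w `^ p * (minn k (Zp l i w))%:R).
Proof.
have [/andP[p1 p2] hk1 hkE] := And3 p12 kap1 kapE.
have p0 : 0 < p by lra.
have kap0 : 0 <= kappa by apply: le_trans hkE; apply: Ex_ge0 => w; exact: powR_ge0.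
have bmin k' : bm (fun w => Zi i w `^ p * (minn k' (Zp l i w))%:R).
  split; first exact: (measT_natZ i (fun n => n%:R^-1 `^ p * (minn k' n)%:R)).
  exists k'%:R => w; rewrite ger0_norm ?mulr_ge0 ?powR_ge0//.
  rewrite -[leRHS]mul1r ler_pM ?powR_ge0 ?ler_nat ?geq_minl//.
  by apply: Zi_powR_le1; exact: ltW.
elim: k => [|k [IH1 IH2]].
  have -> : (fun w => `|U 0%N w| `^ p) = fun=> 0.
    by apply/funext => w; rewrite /U big_ord0 mulr0 normr0 powR0// gt_eqF.
  rewrite Excst; split; first exact/bmL1/bmcst.
  by rewrite !mulr_ge0//; apply: Ex_ge0 => w; rewrite mulr_ge0 ?powR_ge0.
pose G w := Zi i w * (k < Zp l i w)%N%:R.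
pose F w := Zi i w `^ p * (k < Zp l i w)%N%:R.
have G0 w : 0 <= G w by rewrite mulr_ge0// ltW// Zi_gt0.
have G1 w : G w <= 1.
  by rewrite mulr_ile1 ?Zi_le1//; [exact/ltW/Zi_gt0|case: ltnP].
have F0 w : 0 <= F w by rewrite mulr_ge0 ?powR_ge0.
have F1 w : F w <= 1.
  rewrite mulr_ile1 ?powR_ge0//; last by case: ltnP.
  by apply: Zi_powR_le1; exact: ltW.
have mF : (past i).-meas F by exact: (@past_natZ i (fun n => n%:R^-1 `^ p * (k < n)%N%:R)).
have F1' : L1 P F.
  by apply/bmL1/bm01; [exact: (meas_sub (@pastm _ _ _ _ xi X i) mF)|move=> w; rewrite F0 F1].
pose H w := sgpow (U k w) p * G w.
have mH : (rest (l, i, k)).-meas H.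
  apply: measurable_funM; last exact: (@rest_natZ i k (fun n => n%:R^-1 * (k < n)%N%:R)).
  by apply: (measurableT_comp measurable_sgpow); exact: mUr.
have mHT := meas_sub (@restm _ _ _ _ xi X _) mH.
have H1 : L1 P H.
  apply: (L1_le (g := fun w => 1 + `|U k w| `^ p)) => //.
    move=> w; rewrite normrM -[leRHS]mulr1 ler_pM// ?sgpow_le//.
    by rewrite ger0_norm.
  by apply: L1D => //; exact/bmL1/bmcst.
have [Hx HxE] := offspring_mean_one_L1 Hxi HX Hst mH H1.
have [Fx FxE] : L1 P (fun w => F w * `|x k w - 1| `^ p) /\
    E (fun w => F w * `|x k w - 1| `^ p) = E F * E (fun w => `|(Xp l 0 0 w)%:R / mp l 0 w - 1| `^ p).
  apply: (offspring_past Hxi HX k (psi := fun b e => `|b%:R / mp_of law e - 1| `^ p)) => //.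
  move=> b; apply: (measurableT_comp (measurable_powR _)).
  apply: (measurableT_comp (@normr_measurable _ _)); apply: measurable_funB => //.
  apply: measurable_funM => //.
  rewrite (_ : (fun e => _) = fun e => expR (- ln (mp_of law e))).
    apply: measurableT_comp => //; apply: measurable_funN.
    by apply: (measurableT_comp (@measurable_ln _)); exact: measurable_mp_of.
  by apply/funext => e; rewrite expRN lnK// posrE (lt_le_trans _ (mp_of_ge1 _ _)).
pose S w := `|U k w| `^ p + (p * (H w * x k w - H w) + 6 * (F w * `|x k w - 1| `^ p)).
have S1 : L1 P S.
  apply: L1D => //; apply: L1D; apply: L1Z => //.
  by apply: L1D => //; exact: L1N.
have US w : `|U k.+1 w| `^ p <= S w.
  have -> : U k.+1 w = U k w + G w * (x k w - 1).
    by rewrite /U big_ord_recr/= mulrDr /G; ring.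
  apply: (le_trans (vonBahr_Esseen_step _ _ _)); first by rewrite ltW.
  rewrite -addrA lerD2l lerD//.
    by rewrite (_ : sgpow _ _ * _ = H w * x k w - H w)// /H; ring.
  rewrite ler_wpM2l// normrM (ger0_norm (G0 w)) powRM// ler_wpM2r ?powR_ge0//.
  rewrite /G /F; case: ltnP => _; first by rewrite !mulr1.
  by rewrite !mulr0 powR0// gt_eqF.
have mU1 : measurable_fun [set: T] (fun w => `|U k.+1 w| `^ p).
  apply: (measurableT_comp (measurable_powR _)).
  apply: (measurableT_comp (@normr_measurable _ _)).
  exact: (meas_sub (@restm _ _ _ _ xi X (l, i, k.+1)) (@mUr k.+1)).
have U1 : L1 P (fun w => `|U k.+1 w| `^ p).
  by apply: L1_le S1 => // w; rewrite ger0_norm ?powR_ge0.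
split => //; apply: (le_trans (Ex_le U1 S1 US)).
have -> : E S = E (fun w => `|U k w| `^ p) + 6 * (E F * E (fun w => `|(Xp l 0 0 w)%:R / mp l 0 w - 1| `^ p)).
  rewrite /S ExD//; last by apply: L1D; apply: L1Z => //; apply: L1D => //; exact: L1N.
  rewrite ExD; [|by apply: L1Z; apply: L1D => //; exact: L1N|exact: L1Z].
  by rewrite !ExZ ?ExB ?HxE ?subrr ?mulr0 ?add0r ?FxE//; apply: L1D => //; exact: L1N.
have -> : E (fun w => Zi i w `^ p * (minn k.+1 (Zp l i w))%:R) =
    E (fun w => Zi i w `^ p * (minn k (Zp l i w))%:R) + E F.
  rewrite -ExD//; last exact: bmL1.
  congr E; apply/funext => w; rewrite -mulrDr; congr (_ * _); rewrite -natrD; congr (_%:R).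
  case: (leqP (Zp l i w) k) => kZ; first by rewrite addn0; exact/minn_idPr/leqW.
  by rewrite addn1; exact/minn_idPl.
have EF0 : 0 <= E F by exact: Ex_ge0.
exact: add_moment_step.
Qed.

(** The quotient [W_{i+1} / W_i] of the normalised populations. *)
Definition ratio (w : T) : R := (Zp l i.+1 w)%:R / ((Zp l i w)%:R * mp l i w).

Lemma ratio_gt0 w : 0 < ratio w.
Proof. by rewrite divr_gt0 ?mulr_gt0 ?mp_gt0 ?ltr0n ?Zp_gt0. Qed.

Lemma measurable_ratio : measurable_fun [set: T] ratio.
Proof.
apply: measurable_funM; first exact: (measT_natR (fun n => n%:R) (measT_Zp _ _ _ _)).
under eq_fun do rewrite invfM.
apply: measurable_funM; first exact: (measT_natZ i (fun n => n%:R^-1)).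
apply: (meas_sub (@restm _ _ _ _ xi X (l, i, 0)%N)).
by apply: meas_mpV; exact: rest_meas_env.
Qed.

(** Each of the [Z_i] individuals contributes [Z_i^(-p)]. *)
Lemma ratio_moment : L1 P (fun w => `|ratio w - 1| `^ p) /\
  E (fun w => `|ratio w - 1| `^ p) <= 6 * kappa * E (fun w => Zi i w `^ (p - 1)).
Proof.
have [/andP[p1 p2] hk1 hkE] := And3 p12 kap1 kapE.
have kap0 : 0 <= kappa by apply: le_trans hkE; apply: Ex_ge0 => w; exact: powR_ge0.
have p0 : 0 < p by lra.
have mY := measurable_ratio.
have bz : bm (fun w => Zi i w `^ (p - 1)).
  apply: bm01; first exact: (measT_natZ i (fun n => n%:R^-1 `^ (p - 1))).
  by move=> w; rewrite powR_ge0 Zi_powR_le1//; lra.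
apply: (L1_trunc_le (a := Zp l i)).
- apply: (measurableT_comp (measurable_powR _)).
  by apply: (measurableT_comp (@normr_measurable _ _)); exact: measurable_funB.
- exact: measT_Zp.
- by move=> w; exact: powR_ge0.
move=> k; have [U1 UE] := centred_sum_moment k.
have le w : `|ratio w - 1| `^ p * (Zp l i w <= k)%N%:R <= `|U k w| `^ p.
  case: leqP => [Zk|_]; last by rewrite mulr0 powR_ge0.
  rewrite mulr1 (_ : ratio w - 1 = U k w)//.
  rewrite /U (sum_ltn_minn k (Zp l i w) (fun j => x j w - 1)) (minn_idPr Zk).
  rewrite sumrB sumr_const card_ord -mulr_suml mulrBr Zi_Z /ratio/= natr_sum invfM /Zi.
  by congr (_ - _); rewrite mulrCA.
have L : L1 P (fun w => `|ratio w - 1| `^ p * (Zp l i w <= k)%N%:R).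
  apply: L1_le U1.
    apply: measurable_funM; last exact: (measT_natZ i (fun n => (n <= k)%N%:R)).
    apply: (measurableT_comp (measurable_powR _)).
    by apply: (measurableT_comp (@normr_measurable _ _)); exact: measurable_funB.
  by move=> w; rewrite ger0_norm// mulr_ge0 ?powR_ge0.
split => //; apply: (le_trans (Ex_le L U1 le)); apply: (le_trans UE).
have pt w : Zi i w `^ p * (minn k (Zp l i w))%:R <= Zi i w `^ (p - 1).
  rewrite -(mulr_powRB1 (ltW (Zi_gt0 i w)) p0) mulrAC -[leRHS]mul1r ler_wpM2r ?powR_ge0//.
  by rewrite -[leRHS](Zi_Z i w) ler_wpM2l ?ler_nat ?geq_minr// ltW// Zi_gt0.
rewrite ler_wpM2l ?mulr_ge0//; apply: Ex_le => //; last exact: bmL1.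
apply: (L1_le (g := fun w => Zi i w `^ (p - 1))); last exact: bmL1.
  exact: (measT_natZ i (fun n => n%:R^-1 `^ p * (minn k n)%:R)).
by move=> w; rewrite ger0_norm// mulr_ge0 ?powR_ge0.
Qed.

End fixed_generation.

End vonBahrEsseen.
End LogMoments.

(** * Logarithm of the normalised population *)

Section NumericSteps.
Context (R : realType).

Lemma small_ratio_step (a y k2 c : R) : 0 <= y -> 0 <= k2 -> 0 <= c -> a <= 4 * y ->
  a <= (4 + 4 * k2) * y + c.
Proof. by move=> y0 k0 c0 ay; have := mulr_ge0 k0 y0; lra. Qed.

Lemma large_ratio_step (a b y k2 c : R) : 0 <= y -> 0 <= k2 -> a <= b -> b <= k2 + c ->
  1 <= 4 * y -> a <= (4 + 4 * k2) * y + c.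
Proof. by move=> y0 k0 ab bk y1; have := ler_wpM2l k0 y1; lra. Qed.

Lemma collect_moment (k2 y q nu kappa r2 r4 m z : R) : 0 <= k2 -> 0 <= kappa -> y <= 6 * kappa * z ->
  z <= 2 * r4 -> k2 * r4 = r2 -> r4 <= r2 -> r2 <= q -> m <= nu * q ->
  (4 + 4 * k2) * y + m <= (96 * kappa + nu) * q.
Proof.
move=> k0 kap0 yz zr kr r42 rq mq.
have h1 := ler_wpM2l kap0 zr.
have y1 : y <= 12 * kappa * r4 by lra.
have h2 : (4 + 4 * k2) * y <= (4 + 4 * k2) * (12 * kappa * r4) by rewrite ler_wpM2l//; lra.
have h3 : (4 + 4 * k2) * (12 * kappa * r4) = 48 * kappa * (r4 + r2) by rewrite -kr; ring.
have h4 : kappa * (r4 + r2) <= kappa * (q + q) by rewrite ler_wpM2l//; lra.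
lra.
Qed.

Lemma far_from_one (y : R) : y < 2^-1 -> 1 <= 2 * `|y - 1|.
Proof. by move=> y2; rewrite ltr0_norm; lra. Qed.

Lemma sqr_le_of_neg (a b : R) : - b <= a -> a <= 0 -> a ^+ 2 <= b ^+ 2.
Proof. by move=> h1 h2; nra. Qed.

Lemma expr_inv_cancel (u : R) : 0 < u -> u^-1 ^+ 2 * u ^+ 4 = u ^+ 2.
Proof. by move=> u0; field; rewrite gt_eqF. Qed.

Lemma geometric_step (C s u : R) : 0 < s < 1 ->
  (1 - s)^-1 * (C * u ^+ 2) + s^-1 * (C * (s * u / (1 - s)) ^+ 2) = C * (u / (1 - s)) ^+ 2.
Proof. by move=> /andP[s0 s1]; field; rewrite !gt_eqF//; lra. Qed.

End NumericSteps.

Section LogRatio.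
Context d (T : measurableType d) (R : realType) (P : probability T R).
Context (law : R.-pker R ~> nat) (xi : nat -> {RV P >-> (R * R)%type}).
Context (X : bool -> nat -> nat -> {RV P >-> nat}).
Hypotheses (Hxi : iid_environment xi) (HX : offspring_given_environment law xi X)
  (Hst : standing_assumptions law xi X).
Local Notation E := (Ex P).
Local Notation "G .-meas f" := (measurable_fun [set: g_sigma_algebraType G] (f : g_sigma_algebraType G -> _)) (at level 2).
Local Notation past := (past xi X).
Local Notation rest := (rest xi X).
Local Notation Xp := (Xp X).
Local Notation Zp := (Zp X).
Local Notation mp := (mp law xi).
Local Notation Mp := (Mp law xi).

Context (l : bool).

Local Notation Zi := (Zi (R := R) X l).
Local Notation ratio := (ratio law xi X l).
Context (p kappa : R).
Hypotheses (p12 : 1 < p <= 2)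
  (kap1 : L1 P (fun w => `|(Xp l 0 0 w)%:R / mp l 0 w - 1| `^ p))
  (kapE : E (fun w => `|(Xp l 0 0 w)%:R / mp l 0 w - 1| `^ p) <= kappa).
Context (theta delta nu : R).
Hypotheses (theta01 : 0 < theta < 1) (HXinv : E (fun w => ((Xp l 0 0 w)%:R)^-1) <= theta)
  (delta01 : 0 < delta <= 1)
  (nu1 : L1 P (fun w => Mp l 0 w `^ (2 + delta)))
  (nuE : E (fun w => Mp l 0 w `^ (2 + delta)) <= nu).

(** The logarithm of [Z_n / (m_0 ... m_{n-1})]. *)
Definition lnW n (w : T) : R := ln (Zp l n w)%:R - \sum_(g < n) Mp l g w.

Lemma lnW_ratio i w : lnW i.+1 w - lnW i w = ln (ratio i w).
Proof.
rewrite /lnW big_ord_recr/= /ratio ln_div ?posrE ?mulr_gt0 ?mp_gt0 ?ltr0n ?Zp_gt0//.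
by rewrite lnM ?posrE ?mp_gt0 ?ltr0n ?Zp_gt0// /Mp; ring.
Qed.

(** The population never decreases. *)
Lemma ln_ratio_ge i w : - Mp l i w <= ln (ratio i w).
Proof.
rewrite -lnW_ratio /lnW big_ord_recr/=.
have : ln (Zp l i w)%:R <= ln (Zp l i.+1 w)%:R :> R.
  by rewrite ler_ln ?posrE ?ltr0n ?Zp_gt0// ler_nat Zp_le.
rewrite /=; lra.
Qed.

Lemma Mp_moment i : L1 P (fun w => Mp l i w `^ (2 + delta)) /\
  E (fun w => Mp l i w `^ (2 + delta)) <= nu.
Proof.
have [h1 h2] : L1 P (fun w => 1 * ln (mp_of law (env xi l i w)) `^ (2 + delta)) /\
    E (fun w => 1 * ln (mp_of law (env xi l i w)) `^ (2 + delta)) =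
    E (fun=> 1) * E (fun w => Mp l 0 w `^ (2 + delta)).
  apply: (offspring_past Hxi HX 0%N (F := fun=> 1) (psi := fun _ e => ln (mp_of law e) `^ (2 + delta))) => //.
  - exact/bmL1/bmcst.
  - move=> _; apply: (measurableT_comp (measurable_powR _)).
    by apply: (measurableT_comp (@measurable_ln _)); exact: measurable_mp_of.
  - by move=> _ e; exact: powR_ge0.
have e : (fun w => Mp l i w `^ (2 + delta)) =
    (fun w => 1 * (ln (mp_of law (env xi l i w)) `^ (2 + delta))).
  by apply/funext => w; rewrite mul1r.
by rewrite e; split => //; rewrite h2 Excst mul1r.
Qed.

(** With [r = theta^((p - 1) / 4)] the centred moment of the ratio decays like
[r^(4 i)]. Cutting [M_i] at the level [r^(- i)] then leaves [r^(2 i)] from below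
the cut and [r^(delta i)] from above it, and the latter dominates. *)
Definition log_rate : R := (theta `^ ((p - 1) / 4)) `^ delta.

(** Where the ratio is at least [1/2], [sqr_ln_le] applies. Elsewhere the logarithm
lies between [- M_i] and [0], on an event whose probability is bounded by the
centred moment; [split_square] decouples the event from [M_i]. *)
Lemma ln_ratio_sqr i : L1 P (fun w => ln (ratio i w) ^+ 2) /\
  E (fun w => ln (ratio i w) ^+ 2) <= (96 * kappa + nu) * log_rate ^+ i.
Proof.
have [/andP[p1 p2] hk1 hkE /andP[t0 t1] /andP[d0 d1]] := And5 p12 kap1 kapE theta01 delta01.
have kap0 : 0 <= kappa by apply: le_trans hkE; apply: Ex_ge0 => w; exact: powR_ge0.
have [Y1 YE] := ratio_moment Hxi HX Hst p12 kap1 kapE i.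
have [M1 ME] := Mp_moment i.
have nu0 : 0 <= nu by apply: le_trans ME; apply: Ex_ge0 => w; exact: powR_ge0.
have [r rE] : {r | r = theta `^ ((p - 1) / 4)} by eexists.
have r0 : 0 < r by rewrite rE powR_gt0.
have r1 : r <= 1 by rewrite rE; apply: powR_le1; [rewrite !ltW|rewrite divr_ge0// subr_ge0 ltW].
have ri0 : 0 < r ^+ i by exact: exprn_gt0.
have [q qdef] : {q | q = log_rate} by exists log_rate.
have qE : q = r `^ delta by rewrite qdef rE.
have qi : q ^+ i = (r ^+ i) `^ delta.
  have e1 : q ^+ i = q `^ i%:R by rewrite powR_mulrn// qE powR_ge0.
  have e2 : r ^+ i = r `^ i%:R by rewrite powR_mulrn// ltW.
  by rewrite e1 e2 qE; exact: powRAC.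
have ri1 : r ^+ i <= 1 by rewrite exprn_ile1// ltW.
have rq : (r ^+ i) ^+ 2 <= q ^+ i.
  have e2 : (r ^+ i) ^+ 2 = (r ^+ i) `^ 2 by rewrite powR_mulrn// ltW.
  by rewrite qi e2; apply: ger_powR; [rewrite ri0|rewrite (le_trans d1)// ler1n].
have thE : (theta ^+ i) `^ (p - 1) = (r ^+ i) ^+ 4.
  have e1 : theta ^+ i = theta `^ i%:R by rewrite powR_mulrn// ltW.
  have e2 : theta `^ (p - 1) = r ^+ 4.
    have -> : r ^+ 4 = r `^ 4 by rewrite powR_mulrn// ltW.
    by rewrite rE -powRrM; congr (_ `^ _); field.
  rewrite e1 powRAC e2 powR_mulrn//; last by rewrite exprn_ge0// ltW.
  by rewrite -exprM mulnC exprM.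
have zE : E (fun w => Zi i w `^ (p - 1)) <= 2 * (r ^+ i) ^+ 4.
  have ti0 : 0 < theta ^+ i by exact: exprn_gt0.
  apply: (@le_trans _ _ (E (fun w => (r ^+ i) ^+ 4 * (1 + (theta ^+ i)^-1 * Zi i w)))).
    apply: Ex_le.
    - apply/bmL1/bm01; first exact: (measT_natZ xi X l i (fun n => n%:R^-1 `^ (p - 1))).
      by move=> w; rewrite powR_ge0 Zi_powR_le1// subr_ge0 ltW.
    - by apply: L1Z; apply: L1D; [exact/bmL1/bmcst|apply: L1Z; exact: (bmL1 P (bmZi xi X l i))].
    move=> w; rewrite -thE [_^-1 * _]mulrC; apply: split_powR => //.
      by rewrite subr_ge0 ltW//= lerBlDr.
    exact/ltW/Zi_gt0.
  rewrite ExZ; last by apply: L1D; [exact/bmL1/bmcst|apply: L1Z; exact: (bmL1 P (bmZi xi X l i))].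
  rewrite ExD; [|exact/bmL1/bmcst|apply: L1Z; exact: (bmL1 P (bmZi xi X l i))].
  rewrite Excst ExZ; last exact: (bmL1 P (bmZi xi X l i)).
  rewrite mulrC ler_wpM2r//; first by rewrite exprn_ge0// ltW.
  have h : (theta ^+ i)^-1 * E (Zi i) <= 1.
    by rewrite ler_pdivrMl// mulr1; exact: (inverse_moment Hxi HX t0 HXinv).
  by apply: (le_trans (lerD (lexx 1) h)).
pose K := (r ^+ i)^-1; have K0 : 0 < K by rewrite invr_gt0.
have Kd : K `^ (- delta) = q ^+ i.
  have -> : K = (r ^+ i) `^ (-1) by rewrite powR_inv1// ltW.
  by rewrite qi -powRrM mulrNN mul1r.
have pt w : ln (ratio i w) ^+ 2 <=
    (4 + 4 * K ^+ 2) * `|ratio i w - 1| `^ p + q ^+ i * Mp l i w `^ (2 + delta).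
  have Y0 := ratio_gt0 law xi X l i w.
  have P0 : 0 <= `|ratio i w - 1| `^ p by exact: powR_ge0.
  have Q0 : 0 <= q ^+ i * Mp l i w `^ (2 + delta) by rewrite mulr_ge0 ?powR_ge0// qi powR_ge0.
  have K2 : 0 <= K ^+ 2 by exact: sqr_ge0.
  have [Y2|Y2] := leP (2^-1) (ratio i w).
    by apply: small_ratio_step => //; apply: sqr_ln_le => //; rewrite ltW.
  have B1 : 1 <= 4 * `|ratio i w - 1| `^ p.
    have p12' : 1 <= p <= 2 by rewrite ltW.
    apply: le_trans (powR_2_le p12' (normr_ge0 _)).
    have e1 : 1 = 1 `^ p :> R by rewrite powR1.
    rewrite [leLHS]e1; apply: ge0_ler_powR; rewrite ?nnegrE ?mulr_ge0//.
      by rewrite ltW// (lt_trans _ p1).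
    exact: far_from_one.
  have l1 : ln (ratio i w) ^+ 2 <= Mp l i w ^+ 2.
    have h1 := ln_ratio_ge i w.
    have h2 : ln (ratio i w) <= 0 by rewrite ln_le0// (le_trans (ltW Y2))// invf_le1// ler1n.
    exact: sqr_le_of_neg.
  have := split_square true d0 K0 (Mp_ge0 law xi l i w); rewrite !mulr1 Kd => h3.
  exact: large_ratio_step l1 h3 B1.
have mL : measurable_fun [set: T] (fun w => ln (ratio i w) ^+ 2).
  apply: measurable_funX; apply: (measurableT_comp (@measurable_ln _)).
  exact: (measurable_ratio law xi X l i).
have B1 : L1 P (fun w => (4 + 4 * K ^+ 2) * `|ratio i w - 1| `^ p + q ^+ i * Mp l i w `^ (2 + delta)).
  by apply: L1D; exact: L1Z.
have L : L1 P (fun w => ln (ratio i w) ^+ 2).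
  by apply: L1_le B1 => // w; rewrite ger0_norm ?sqr_ge0.
split => //; apply: (le_trans (Ex_le L B1 pt)).
rewrite ExD; [|exact: L1Z|exact: L1Z].
rewrite !ExZ// -qdef.
have q0 : 0 <= q ^+ i by rewrite qi powR_ge0.
have h1 : q ^+ i * E (fun w => Mp l i w `^ (2 + delta)) <= nu * q ^+ i by rewrite mulrC ler_wpM2r.
apply: (collect_moment (sqr_ge0 K) kap0 YE zE _ _ rq h1).
  exact: expr_inv_cancel.
by rewrite (exprM _ 2 2) -[leRHS]expr1; apply: ler_wiXn2l => //; rewrite ?sqr_ge0// exprn_ile1// ltW.
Qed.

Lemma log_rate01 : 0 < log_rate < 1.
Proof.
have [/andP[p1 p2] /andP[t0 t1] /andP[d0 d1]] := And3 p12 theta01 delta01.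
have aux (x a : R) : 0 < x < 1 -> 0 < a -> 0 < x `^ a < 1.
  move=> /andP[x0 x1] a0; rewrite powR_gt0//=.
  have e1 : 1 = 1 `^ a :> R by rewrite powR1.
  by rewrite [ltRHS]e1; apply: gt0_ltr_powR => //; rewrite nnegrE ltW.
apply: (aux _ _) => //; apply: (aux _ _); first by rewrite t0.
by rewrite divr_gt0// subr_gt0.
Qed.

(** Minkowski's inequality for a geometric series, in the form of
[sqrD_le_weighted] applied one generation at a time. *)
Lemma lnW_increment i n : (i <= n)%N ->
  L1 P (fun w => (lnW n w - lnW i w) ^+ 2) /\
  E (fun w => (lnW n w - lnW i w) ^+ 2) <=
    (96 * kappa + nu) * (Num.sqrt log_rate ^+ i / (1 - Num.sqrt log_rate)) ^+ 2.
Proof.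
move=> ni; rewrite -(subnKC ni); move: (n - i)%N => j {ni n}; elim: j i => [|j IH] i.
  rewrite addn0 (_ : (fun w => _) = fun=> 0).
    rewrite Excst; split; first exact/bmL1/bmcst.
    rewrite mulr_ge0 ?sqr_ge0// addr_ge0 ?mulr_ge0//.
      by apply: le_trans kapE; apply: Ex_ge0 => w; exact: powR_ge0.
    by apply: le_trans nuE; apply: Ex_ge0 => w; exact: powR_ge0.
  by apply/funext => w; rewrite subrr expr0n.
have [I1 IE] := IH i.+1; have [L1' LE] := ln_ratio_sqr i.
have /andP[q0 q1] := log_rate01.
set C := 96 * kappa + nu; set s := Num.sqrt log_rate; rewrite -/s -/C in IE *.
have s0 : 0 < s by rewrite sqrtr_gt0.
have ss : s ^+ 2 = log_rate by rewrite sqr_sqrtr// ltW.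
have s1 : s < 1 by rewrite -sqrtr1 ltr_sqrt// ltr01.
have s01 : 0 < s < 1 by rewrite s0.
rewrite addSnnS in I1 IE *.
pose B w := (1 - s)^-1 * ln (ratio i w) ^+ 2 + s^-1 * (lnW (i + j.+1) w - lnW i.+1 w) ^+ 2.
have pt w : (lnW (i + j.+1) w - lnW i w) ^+ 2 <= B w.
  have -> : lnW (i + j.+1) w - lnW i w = ln (ratio i w) + (lnW (i + j.+1) w - lnW i.+1 w).
    by rewrite -lnW_ratio; ring.
  by rewrite /B [_^-1 * _]mulrC [s^-1 * _]mulrC; exact: sqrD_le_weighted.
have B1 : L1 P B by apply: L1D; exact: L1Z.
have mW n' : measurable_fun [set: T] (lnW n').
  apply: measurable_funB; first exact: (measT_natZ xi X l n' (fun n => ln n%:R)).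
  by apply: measurable_sum => g; exact: (measT_Mp law xi X l g).
have L : L1 P (fun w => (lnW (i + j.+1) w - lnW i w) ^+ 2).
  apply: L1_le B1; first by apply: measurable_funX; exact: measurable_funB.
  by move=> w; rewrite ger0_norm ?sqr_ge0.
split => //; apply: (le_trans (Ex_le L B1 pt)).
rewrite /B ExD; [|exact: L1Z|exact: L1Z]; rewrite !ExZ//.
have s1' : 0 < 1 - s by lra.
have h1 : (1 - s)^-1 * E (fun w => ln (ratio i w) ^+ 2) <= (1 - s)^-1 * (C * (s ^+ i) ^+ 2).
  rewrite ler_wpM2l ?invr_ge0 ?(ltW s1')//.
  by rewrite -exprM mulnC exprM ss.
have h2 : s^-1 * E (fun w => (lnW (i + j.+1) w - lnW i.+1 w) ^+ 2) <=
    s^-1 * (C * (s ^+ i.+1 / (1 - s)) ^+ 2) by rewrite ler_wpM2l ?invr_ge0 ?(ltW s0).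
apply: (le_trans (lerD h1 h2)); by rewrite [s ^+ i.+1]exprS geometric_step.
Qed.

End LogRatio.

(** * Consequences of the moment hypotheses *)

Section MomentHypotheses.
Context d (T : measurableType d) (R : realType) (P : probability T R).
Context (law : R.-pker R ~> nat) (xi : nat -> {RV P >-> (R * R)%type}).
Context (X : bool -> nat -> nat -> {RV P >-> nat}).
Hypotheses (Hxi : iid_environment xi) (HX : offspring_given_environment law xi X)
  (Hst : standing_assumptions law xi X).
Local Notation E := (Ex P).
Local Notation Xp := (Xp X).
Local Notation Zp := (Zp X).
Local Notation mp := (mp law xi).
Local Notation Mp := (Mp law xi).
Local Notation lnW := (lnW law xi X).

Lemma L1_ae_le (f g : T -> R) : measurable_fun [set: T] f -> measurable_fun [set: T] g ->
  (forall w, 0 <= f w) -> (forall w, 0 <= g w) -> {ae P, forall w, f w <= g w} ->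
  (\int[P]_w (g w)%:E < +oo)%E -> L1 P f.
Proof.
move=> mf mg f0 g0 fg goo; apply/integrableP; split; first exact/measurable_EFinP.
under eq_integral do rewrite /= ger0_norm//.
apply: le_lt_trans goo; apply: ae_ge0_le_integral => //.
- by move=> w _; rewrite lee_fin.
- exact/measurable_EFinP.
- by move=> w _; rewrite lee_fin.
- exact/measurable_EFinP.
by apply: filterS fg => w h _; rewrite lee_fin.
Qed.

Lemma ae_eq0_Ex (f : T -> R) : L1 P f -> (forall w, 0 <= f w) -> E f = 0 ->
  {ae P, forall w, f w = 0}.
Proof.
move=> f1 f0 Ef; have mf := L1m f1.
have : (\int[P]_w `|(f w)%:E| = 0)%E.
  by under eq_integral do rewrite /= ger0_norm//; rewrite ExE// Ef.
move/(ae_eq_integral_abs _ measurableT).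
have mfe : measurable_fun [set: T] (EFin \o f) by exact/measurable_EFinP.
move=> /(_ mfe); apply: filterS => w /(_ I) /= [].
by [].
Qed.

Lemma Ex_ae_eq (f g : T -> R) : measurable_fun [set: T] f -> measurable_fun [set: T] g ->
  {ae P, forall w, f w = g w} -> E f = E g.
Proof.
move=> mf mg fg; rewrite /Ex /Rintegral; congr fine; apply: ae_eq_integral => //.
- exact/measurable_EFinP.
- exact/measurable_EFinP.
by apply: filterS fg => w h _; rewrite /= h.
Qed.

Lemma measurable_m l n : measurable_fun [set: T] (m law xi l n).
Proof.
apply: (measurableT_comp (fine_measurable measurableT)).
apply: (measurableT_comp (measurable_mean_offspring law)); exact: measurable_envT.
Qed.

Lemma measurable_M l n : measurable_fun [set: T] (M law xi l n).
Proof. by apply: (measurableT_comp (@measurable_ln _)); exact: measurable_m. Qed.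

Lemma ae_Mp l n : {ae P, forall w, Mp l n w = M law xi l n w}.
Proof. by apply: filterS (ae_mp Hxi Hst l n) => w h; rewrite /Mp h. Qed.

Lemma Mp_L1_powR delta l :
  ('E_P[(fun w => M law xi false 0 w `^ (2 + delta) + M law xi true 0 w `^ (2 + delta))%R]
    < +oo)%E ->
  L1 P (fun w => Mp l 0 w `^ (2 + delta)).
Proof.
rewrite unlock => HM; apply: L1_ae_le HM => //.
- by apply: (measurableT_comp (measurable_powR _)); exact: measT_Mp.
- by apply: measurable_funD; apply: (measurableT_comp (measurable_powR _)); exact: measurable_M.
- by move=> w; exact: powR_ge0.
- by move=> w; rewrite addr_ge0 ?powR_ge0.
apply: filterS (ae_Mp l 0) => w ->.
by case: (l); [rewrite lerDr|rewrite lerDl]; exact: powR_ge0.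
Qed.

Lemma Z1E l w : Z X l 1 w = X l 0 0 w.
Proof. by rewrite /= big_ord_recl big_ord0 addn0. Qed.

Lemma abs_sub1_powR_le (p q x : R) : 0 < q <= p -> 0 <= x -> `|x - 1| `^ q <= 2 + x `^ p.
Proof.
move=> /andP[q0 qp] x0; have xp := powR_ge0 x p.
have [x1|x1] := leP x 1.
  apply: (@le_trans _ _ 1); last by lra.
  apply: powR_le1; last exact: ltW.
  by rewrite normr_ge0 ler0_norm ?subr_le0// opprB lerBlDr lerDl.
apply: (@le_trans _ _ (x `^ q)).
  by apply: ge0_ler_powR; rewrite ?nnegrE ?normr_ge0 ?(ltW q0)// ger0_norm; lra.
apply: (@le_trans _ _ (x `^ p)); last by lra.
by apply: ler_powR => //; exact: ltW.
Qed.

Lemma Xp_L1_powR p q l : 0 < q <= p ->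
  ('E_P[(fun w =>
     (Z X false 1 w)%:R `^ p / m law xi false 0 w `^ p
   + (Z X true 1 w)%:R `^ p / m law xi true 0 w `^ p)%R] < +oo)%E ->
  L1 P (fun w => `|(Xp l 0 0 w)%:R / mp l 0 w - 1| `^ q).
Proof.
move=> qp; rewrite unlock => HZ.
pose g w : R := (Z X false 1 w)%:R `^ p / m law xi false 0 w `^ p
   + (Z X true 1 w)%:R `^ p / m law xi true 0 w `^ p.
have goo : (\int[P]_w (g w)%:E < +oo)%E by [].
have mXmp : measurable_fun [set: T] (fun w => (Xp l 0 0 w)%:R / mp l 0 w).
  apply: measurable_funM; first exact: (measT_natR (fun n => n%:R) (measT_Xp xi X _ _ _)).
  apply: (meas_sub (@restm _ _ _ _ xi X (l, 0, 0)%N)).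
  by apply: meas_mpV; exact: rest_meas_env.
have mterm l' : measurable_fun [set: T]
    (fun w => (Z X l' 1 w)%:R `^ p / m law xi l' 0 w `^ p).
  apply: measurable_funM.
    apply: (measT_natR (fun n => n%:R `^ p)).
    rewrite (_ : Z X l' 1 = X l' 0%N 0%N); last by apply/funext => w; rewrite Z1E.
    exact: measurable_funP.
  rewrite (_ : (fun w => _) = fun w => m law xi l' 0 w `^ (- p)).
    by apply: (measurableT_comp (measurable_powR _)); exact: measurable_m.
  by apply/funext => w; rewrite powRN.
have g0 w : 0 <= g w by rewrite /g addr_ge0// divr_ge0 ?powR_ge0.
have mg : measurable_fun [set: T] g by exact: measurable_funD.
apply: (L1_ae_le (g := fun w => 2 + g w)).
- apply: (measurableT_comp (measurable_powR _)).
  by apply: (measurableT_comp (@normr_measurable _ _)); exact: measurable_funB.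
- exact: measurable_funD.
- by move=> w; exact: powR_ge0.
- by move=> w; rewrite addr_ge0.
- apply: filterS2 (ae_Xp Hxi HX Hst l 0 0) (ae_mp Hxi Hst l 0) => w hX hm.
  have x0 : 0 <= (Xp l 0 0 w)%:R / mp l 0 w by rewrite divr_ge0// ltW// mp_gt0.
  apply: (le_trans (abs_sub1_powR_le qp x0)); rewrite lerD2l.
  have e : (Z X l 1 w)%:R `^ p / m law xi l 0 w `^ p = ((Xp l 0 0 w)%:R / mp l 0 w) `^ p.
    have m0 := mp_gt0 law xi l 0 w.
    rewrite Z1E -hX -hm -{1}[(Xp l 0 0 w)%:R](divfK (lt0r_neq0 m0)) powRM// ?(ltW m0)//.
    by rewrite mulfK// gt_eqF// powR_gt0.
  by rewrite -e /g; case: (l); [rewrite lerDr|rewrite lerDl]; rewrite divr_ge0 ?powR_ge0.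
under eq_integral do rewrite EFinD.
rewrite ge0_integralD//.
- rewrite integral_cst//= probability_setT mule1 lte_add_pinfty// ltry//.
- by move=> w _; rewrite lee_fin.
- exact/measurable_EFinP.
Qed.

(** Were [E (1 / X) = 1], the offspring numbers would all be one and [M] would
vanish, contrary to its positive variance. *)
Lemma inverse_mean_lt1 l : exists2 theta : R, 0 < theta < 1 &
  E (fun w => ((Xp l 0 0 w)%:R)^-1) <= theta.
Proof.
set e := E _.
have mX : measurable_fun [set: T] (fun w => ((Xp l 0 0 w)%:R)^-1 : R).
  exact: (measT_natR (fun n => n%:R^-1) (measT_Xp xi X _ _ _)).
have X01 w : 0 <= ((Xp l 0 0 w)%:R : R)^-1 <= 1.
  by rewrite invr_ge0 ler0n invf_le1 ?ltr0n ?ler1n Xp_gt0.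
have XL : L1 P (fun w => ((Xp l 0 0 w)%:R)^-1 : R) by apply/bmL1/bm01.
suff e1 : e < 1.
  exists (Num.max e 2^-1); last by rewrite le_max lexx.
  by rewrite lt_max gt_max e1 invr_gt0 ltr0n orbT/= invf_lt1 ?ltr1n.
have e1 : e <= 1.
  rewrite -[leRHS](Excst P 1); apply: Ex_le => //; first exact/bmL1/bmcst.
  by move=> w; case/andP: (X01 w).
rewrite lt_neqAle e1 andbT; apply/negP => /eqP eE.
have one : L1 P (fun=> 1 : R) by exact/bmL1/bmcst.
have ae1 : {ae P, forall w, 1 - ((Xp l 0 0 w)%:R)^-1 = 0 :> R}.
  apply: ae_eq0_Ex.
  - by apply: L1D => //; exact: L1N.
  - by move=> w; rewrite subr_ge0; case/andP: (X01 w).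
  - by rewrite ExB// Excst -/e eE subrr.
have m01 w : 0 <= (mp l 0 w)^-1 <= 1.
  by rewrite invr_ge0 invf_le1 ?mp_gt0// mp_ge1 ltW// mp_gt0.
have mmp : measurable_fun [set: T] (fun w => (mp l 0 w)^-1).
  apply: (meas_sub (@restm _ _ _ _ xi X (l, 0, 0)%N)).
  by apply: meas_mpV; exact: rest_meas_env.
have mL : L1 P (fun w => (mp l 0 w)^-1) by apply/bmL1/bm01.
have [x1 xE] := offspring_mean_one_L1 Hxi HX Hst (H := fun=> 1) (l := l) (i := 0) (k := 0)
  (@measurable_cst _ _ _ _ _ _) one.
have Em : E (fun w => (mp l 0 w)^-1) = 1.
  rewrite -[RHS](Excst P 1) -xE; apply: Ex_ae_eq => //; first exact: L1m x1.
  apply: filterS ae1 => w /subr0_eq h.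
  have -> : (Xp l 0 0 w)%:R = 1 :> R by rewrite -[LHS]invrK -h invr1.
  by rewrite !mul1r.
have ae2 : {ae P, forall w, 1 - (mp l 0 w)^-1 = 0}.
  apply: ae_eq0_Ex.
  - by apply: L1D => //; exact: L1N.
  - by move=> w; rewrite subr_ge0; case/andP: (m01 w).
  - by rewrite ExB// Excst Em subrr.
have aeM : {ae P, forall w, M law xi l 0 w = 0}.
  apply: filterS2 ae2 (ae_Mp l 0) => w /subr0_eq h <-.
  by rewrite /Mp -[mp l 0 w]invrK -h invr1 ln1.
have [_ /(_ l) /andP[V0 _] _ _ _] := Hst.
have EM : fine (\int[P]_w (M law xi l 0 w)%:E) = 0.
  rewrite -[fine _]/(E (M law xi l 0)) -(Excst P 0).
  by apply: Ex_ae_eq => //; exact: measurable_M.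
move: V0; rewrite /variance unlock unlock.
rewrite (ae_eq_integral (cst 0%E)) ?integral0 ?ltxx//.
- apply/measurable_EFinP; apply: measurable_funM; apply: measurable_funB => //; exact: measurable_M.
- apply: filterS aeM => w h _ /=.
  rewrite -[LHS]/(((M law xi l 0 w - fine (\int[P]_w (M law xi l 0 w)%:E)) *
    (M law xi l 0 w - fine (\int[P]_w (M law xi l 0 w)%:E)))%:E).
  by rewrite EM h subrr mul0r.
Qed.

Lemma lnW_increment_both delta p : 0 < delta <= 1 ->
  ('E_P[(fun w => M law xi false 0 w `^ (2 + delta) + M law xi true 0 w `^ (2 + delta))%R]
    < +oo)%E -> 1 < p ->
  ('E_P[(fun w =>
     (Z X false 1 w)%:R `^ p / m law xi false 0 w `^ p
   + (Z X true 1 w)%:R `^ p / m law xi true 0 w `^ p)%R] < +oo)%E ->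
  exists C s : R, [/\ 0 < C, 0 < s < 1 & forall l i n, (i <= n)%N ->
    L1 P (fun w => (lnW l n w - lnW l i w) ^+ 2) /\
    E (fun w => (lnW l n w - lnW l i w) ^+ 2) <= (C * s ^+ i) ^+ 2].
Proof.
move=> d01 HM p1 HZ.
(* the von Bahr--Esseen inequality asks for an exponent of at most two *)
pose q := Num.min p 2.
have q12 : 1 < q <= 2 by rewrite /q lt_min p1 ge_min lexx orbT ltr1n.
have qp : 0 < q <= p.
  by have /andP[q1 _] := q12; rewrite (lt_trans _ q1)// /q ge_min lexx.
suff one l : exists C s : R, [/\ 0 < C, 0 < s < 1 & forall i n, (i <= n)%N ->
    L1 P (fun w => (lnW l n w - lnW l i w) ^+ 2) /\
    E (fun w => (lnW l n w - lnW l i w) ^+ 2) <= (C * s ^+ i) ^+ 2].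
  have [C1 [s1 [C10 /andP[s10 s11] H1]]] := one false.
  have [C2 [s2 [C20 /andP[s20 s21] H2]]] := one true.
  exists (Num.max C1 C2), (Num.max s1 s2); split.
  - by rewrite lt_max C10.
  - by rewrite lt_max s10 gt_max s11 s21.
  have up (C s : R) i : 0 < C -> 0 < s -> C <= Num.max C1 C2 -> s <= Num.max s1 s2 ->
      (C * s ^+ i) ^+ 2 <= (Num.max C1 C2 * Num.max s1 s2 ^+ i) ^+ 2.
    move=> C0 s0 CC ss; have Cm : 0 < Num.max C1 C2 by rewrite lt_max C10.
    have sm : 0 < Num.max s1 s2 by rewrite lt_max s10.
    rewrite ler_pXn2r ?nnegrE ?mulr_ge0 ?exprn_ge0 ?(ltW C0) ?(ltW s0) ?(ltW Cm) ?(ltW sm)//.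
    rewrite ler_pM ?exprn_ge0 ?(ltW C0) ?(ltW s0)//.
    by rewrite lerXn2r ?nnegrE ?(ltW s0) ?(ltW sm).
  move=> [] i n ni; [have [h1 h2] := H2 i n ni|have [h1 h2] := H1 i n ni]; split => //;
    by apply: (le_trans h2); apply: up => //; rewrite le_max lexx ?orbT.
have [theta th01 thE] := inverse_mean_lt1 l.
have M1 := Mp_L1_powR l HM.
have X1 := Xp_L1_powR l qp HZ.
pose kappa := E (fun w => `|(Xp l 0 0 w)%:R / mp l 0 w - 1| `^ q).
pose nu := E (fun w => Mp l 0 w `^ (2 + delta)).
have A0 : 0 <= 96 * kappa + nu.
  by rewrite addr_ge0// ?mulr_ge0//; apply: Ex_ge0 => w; exact: powR_ge0.
pose s := Num.sqrt (log_rate q theta delta).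
have /andP[r0 r1] := log_rate01 q12 th01 d01.
have s0 : 0 < s by rewrite sqrtr_gt0.
have s1 : s < 1 by rewrite -sqrtr1 ltr_sqrt// ltr01.
exists (Num.sqrt (96 * kappa + nu) / (1 - s) + 1), s; split.
- by rewrite ltr_wpDl// divr_ge0 ?sqrtr_ge0// subr_ge0 ltW.
- by rewrite s0.
move=> i n ni.
have [h1 h2] := lnW_increment Hxi HX Hst q12 X1 (lexx kappa) th01 thE d01 M1 (lexx nu) ni.
split => //; apply: (le_trans h2).
rewrite -/s -{1}(sqr_sqrtr A0) -exprMn.
have si : 0 <= s ^+ i by rewrite exprn_ge0// ltW.
have c0 : 0 <= Num.sqrt (96 * kappa + nu) / (1 - s) by rewrite divr_ge0 ?sqrtr_ge0// subr_ge0 ltW.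
rewrite ler_pXn2r ?nnegrE ?mulr_ge0 ?sqrtr_ge0 ?invr_ge0 ?subr_ge0 ?(ltW s1) ?addr_ge0//.
by rewrite mulrA mulrAC ler_wpM2r// lerDl.
Qed.

End MomentHypotheses.

(** * Centred logarithmic means *)

Section CentredLogMeans.
Context d (T : measurableType d) (R : realType) (P : probability T R).
Context (law : R.-pker R ~> nat) (xi : nat -> {RV P >-> (R * R)%type}).
Context (X : bool -> nat -> nat -> {RV P >-> nat}).
Hypotheses (Hxi : iid_environment xi) (HX : offspring_given_environment law xi X)
  (Hst : standing_assumptions law xi X).
Local Notation E := (Ex P).
Local Notation Mp := (Mp law xi).
Local Notation mu := (mu law xi).
Local Notation sigma := (sigma law xi).
Local Notation rho := (rho law xi).
Context (delta : R).
Hypotheses (delta01 : 0 < delta <= 1)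
  (HM : ('E_P[(fun w => M law xi false 0 w `^ (2 + delta) + M law xi true 0 w `^ (2 + delta))%R]
    < +oo)%E).

Definition Mc l i (w : T) : R := Mp l i w - mu l.

Definition psi_Mc l (v : R * R) : R := ln (mp_of law (if l then v.2 else v.1)) - mu l.

Lemma McE l i w : Mc l i w = psi_Mc l (xi i w).
Proof. by rewrite /Mc /psi_Mc /Mp /mp /env; case: l. Qed.

Lemma measurable_psi_Mc l : measurable_fun [set: R * R] (psi_Mc l).
Proof.
apply: measurable_funB => //; apply: (measurableT_comp (@measurable_ln _)).
apply: (measurableT_comp (measurable_mp_of law)).
by case: l; [exact: measurable_snd|exact: measurable_fst].
Qed.

Lemma measT_Mc l i : measurable_fun [set: T] (Mc l i).
Proof. by apply: measurable_funB => //; exact: measT_Mp. Qed.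

Lemma integral_xi i (f : R * R -> \bar R) : measurable_fun [set: R * R] f ->
  (forall v, 0 <= f v)%E -> (\int[P]_w f (xi i w) = \int[P]_w f (xi 0%N w))%E.
Proof.
move=> mf f0; have [_ Hid] := Hxi.
have h k : (\int[P]_w f (xi k w) = \int[distribution P (xi k)]_y f y)%E.
  by rewrite ge0_integral_distribution.
rewrite !h; apply: eq_measure_integral => A mA _; exact: Hid.
Qed.

Lemma Ex_xi i (psi : R * R -> R) : measurable_fun [set: R * R] psi ->
  E (fun w => psi (xi i w)) = E (fun w => psi (xi 0%N w)).
Proof.
move=> mpsi; have mpe : measurable_fun [set: R * R] (EFin \o psi) by exact/measurable_EFinP.
rewrite /Ex /Rintegral; congr fine; rewrite integralE [in RHS]integralE; congr (_ - _)%E.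
- have h := integral_xi i (measurable_funepos mpe) (fun v => funepos_ge0 _ v).
  by apply: etrans (etrans h _); apply: eq_integral => w _; rewrite !funeposE.
- have h := integral_xi i (measurable_funeneg mpe) (fun v => funeneg_ge0 _ v).
  by apply: etrans (etrans h _); apply: eq_integral => w _; rewrite !funenegE.
Qed.

Lemma L1_xi i (psi : R * R -> R) : measurable_fun [set: R * R] psi ->
  L1 P (fun w => psi (xi 0%N w)) -> L1 P (fun w => psi (xi i w)).
Proof.
move=> mpsi /integrableP[_ h0]; apply/integrableP; split.
  by apply/measurable_EFinP; apply: (measurableT_comp mpsi); exact: measurable_funP.
rewrite /= (@integral_xi i (fun v => `|(psi v)%:E|)%E)//.
by apply: measurableT_comp => //; exact/measurable_EFinP.
Qed.

Lemma le_1D_powR (a b x : R) : 0 <= x -> 0 < a <= b -> x `^ a <= 1 + x `^ b.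
Proof.
move=> x0 /andP[a0 ab]; have [x1|x1] := leP x 1.
  apply: (@le_trans _ _ 1); last by rewrite lerDl powR_ge0.
  by apply: powR_le1; [rewrite x0|exact: ltW].
apply: (@le_trans _ _ (x `^ b)); last by rewrite lerDr.
by apply: ler_powR => //; exact: ltW.
Qed.

Lemma powR_2norm_le (a x y : R) : 0 < a -> `|x + y| `^ a <= 2 `^ a * (`|x| `^ a + `|y| `^ a).
Proof.
move=> a0; have m0 : 0 <= Num.max `|x| `|y| by rewrite le_max normr_ge0.
apply: (@le_trans _ _ ((2 * Num.max `|x| `|y|) `^ a)).
  apply: ge0_ler_powR; rewrite ?nnegrE ?(ltW a0) ?mulr_ge0//.
  apply: (le_trans (ler_normD _ _)).
  rewrite -[2]/(1 + 1) mulrDl mul1r lerD// ?le_max lexx ?orbT//.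
rewrite powRM// ler_wpM2l ?powR_ge0//; by case: (leP `|x| `|y|) => _; [rewrite lerDr|rewrite lerDl]; exact: powR_ge0.
Qed.

Let p2d : 0 < 2 + delta. Proof. by have /andP[d0 _] := delta01; lra. Qed.

Lemma Mp_L1 l : L1 P (Mp l 0).
Proof.
have h := Mp_L1_powR Hxi Hst l HM; have /andP[d0 _] := delta01.
apply: (L1_le (g := fun w => 1 + Mp l 0 w `^ (2 + delta))); first exact: measT_Mp.
  move=> w; rewrite ger0_norm ?Mp_ge0// -[leLHS]powRr1 ?Mp_ge0//.
  by apply: le_1D_powR; rewrite ?Mp_ge0// ltr01/=; lra.
by apply: L1D => //; exact/bmL1/bmcst.
Qed.

Lemma Ex_Mp l : E (Mp l 0) = mu l.
Proof.
rewrite /Defs.mu unlock -[fine _]/(E (M law xi l 0)).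
by apply: Ex_ae_eq; [exact: measT_Mp|exact: measurable_M|exact: ae_Mp Hxi Hst l 0].
Qed.

Lemma Mc_powR0 l : L1 P (fun w => `|Mc l 0 w| `^ (2 + delta)).
Proof.
have h := Mp_L1_powR Hxi Hst l HM.
apply: (L1_le (g := fun w => 2 `^ (2 + delta) * (Mp l 0 w `^ (2 + delta) + `|mu l| `^ (2 + delta)))).
- apply: (measurableT_comp (measurable_powR _)).
  by apply: (measurableT_comp (@normr_measurable _ _)); exact: measT_Mc.
- move=> w; rewrite ger0_norm ?powR_ge0//.
  apply: (le_trans (powR_2norm_le _ _ p2d)).
  by rewrite normrN (ger0_norm (Mp_ge0 _ _ _ _ _)).
by apply: L1Z; apply: L1D => //; exact/bmL1/bmcst.
Qed.

Lemma Mc_powR l i : L1 P (fun w => `|Mc l i w| `^ (2 + delta)) /\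
  E (fun w => `|Mc l i w| `^ (2 + delta)) = E (fun w => `|Mc l 0 w| `^ (2 + delta)).
Proof.
pose f v := `|psi_Mc l v| `^ (2 + delta).
have mf : measurable_fun [set: R * R] f.
  apply: (measurableT_comp (measurable_powR _)).
  by apply: (measurableT_comp (@normr_measurable _ _)); exact: measurable_psi_Mc.
have e j : (fun w => `|Mc l j w| `^ (2 + delta)) = (fun w => f (xi j w)).
  by apply/funext => w; rewrite McE.
split; last exact: (etrans (congr1 E (e i)) (etrans (@Ex_xi i f mf) (esym (congr1 E (e 0%N))))).
by rewrite (e i); apply: (@L1_xi i f mf); rewrite -(e 0%N); exact: Mc_powR0.
Qed.

Lemma Mc_L1 l i : L1 P (Mc l i) /\ E (Mc l i) = 0.
Proof.
have e j : Mc l j = (fun w => psi_Mc l (xi j w)) by apply/funext => w; rewrite McE.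
have h0 : L1 P (Mc l 0) by apply: L1D; [exact: Mp_L1|exact/bmL1/bmcst].
split.
  by rewrite (e i); apply: (@L1_xi i _ (measurable_psi_Mc l)); rewrite -(e 0%N).
apply: (etrans (congr1 E (e i)) (etrans (@Ex_xi i _ (measurable_psi_Mc l)) (etrans (esym (congr1 E (e 0%N))) _))).
by rewrite /Mc ExB ?Excst ?Ex_Mp ?subrr//; [exact: Mp_L1|exact/bmL1/bmcst].
Qed.

Lemma Mc_sqr l i : L1 P (fun w => Mc l i w ^+ 2).
Proof.
have /andP[d0 _] := delta01.
apply: (L1_le (g := fun w => 1 + `|Mc l i w| `^ (2 + delta))).
- by apply: measurable_funX; exact: measT_Mc.
- move=> w; rewrite ger0_norm ?sqr_ge0// -real_normK ?num_real// -powR_mulrn//.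
  by apply: le_1D_powR => //; rewrite ltr0n/=; lra.
by apply: L1D; [exact/bmL1/bmcst|exact: (Mc_powR l i).1].
Qed.

Lemma Mc_mul l l' i : L1 P (fun w => Mc l i w * Mc l' i w) /\
  E (fun w => Mc l i w * Mc l' i w) = fine (covariance P (M law xi l 0) (M law xi l' 0)).
Proof.
have mM j j' : measurable_fun [set: T] (fun w => Mc l j w * Mc l' j' w).
  by apply: measurable_funM; exact: measT_Mc.
split.
  apply: (L1_le (g := fun w => Mc l i w ^+ 2 + Mc l' i w ^+ 2)) => //.
    by move=> w; rewrite ler_norml; apply/andP; split; nra.
  by apply: L1D; exact: Mc_sqr.
pose f v := psi_Mc l v * psi_Mc l' v.
have mf : measurable_fun [set: R * R] f by apply: measurable_funM; exact: measurable_psi_Mc.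
have e j : (fun w => Mc l j w * Mc l' j w) = (fun w => f (xi j w)).
  by apply/funext => w; rewrite !McE.
apply: (etrans (congr1 E (e i)) (etrans (@Ex_xi i f mf) (etrans (esym (congr1 E (e 0%N))) _))).
rewrite unlock.
transitivity (E (fun w => (M law xi l 0 w - mu l) * (M law xi l' 0 w - mu l'))); last by rewrite /Defs.mu unlock.
apply: Ex_ae_eq => //.
  by apply: measurable_funM; apply: measurable_funB => //; exact: measurable_M.
by apply: filterS2 (ae_Mp Hxi Hst l 0) (ae_Mp Hxi Hst l' 0) => w h1 h2; rewrite /Mc h1 h2.
Qed.

Lemma sigma_gt0 l : 0 < sigma l.
Proof.
have [_ /(_ l) /andP[V0 Voo] _ _ _] := Hst.
by rewrite sqrtr_gt0 fine_gt0// V0.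
Qed.

Lemma Mc_variance l i : E (fun w => Mc l i w ^+ 2) = sigma l ^+ 2.
Proof.
have [_ /(_ l) /andP[V0 Voo] _ _ _] := Hst.
rewrite sqr_sqrtr; last by rewrite fine_ge0// ltW.
by have [_ <-] := Mc_mul l l i.
Qed.

Lemma Mc_covariance i : E (fun w => Mc false i w * Mc true i w) = rho * sigma false * sigma true.
Proof.
have [_ ->] := Mc_mul false true i.
by rewrite /Defs.rho -mulrA divfK// mulf_neq0// gt_eqF// sigma_gt0.
Qed.

(** It equals [(sigma_1 - sigma_2)^2 + 2 (1 - rho) sigma_1 sigma_2], where one of
the two terms is positive. *)
Lemma difference_variance_gt0 :
  0 < sigma false ^+ 2 + sigma true ^+ 2 - 2 * (rho * sigma false * sigma true).
Proof.
have s1 := sigma_gt0 false; have s2 := sigma_gt0 true.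
have s12 := mulr_gt0 s1 s2.
have [_ _ _ _ [/andP[_ r1]|[r1 /eqP ss]]] := Hst.
  have := sqr_ge0 (sigma false - sigma true); nra.
rewrite r1 mul1r; have : 0 < (sigma false - sigma true) ^+ 2.
  by rewrite lt_neqAle sqr_ge0 andbT eq_sym sqrf_eq0 subr_eq0; apply/eqP.
lra.
Qed.

End CentredLogMeans.

(** * Linear part and remainder of the statistic *)

Lemma regroup (R : realType) (c b1 x1 y1 b2 x2 y2 : R) :
  c * (b1 * (x1 * y1) + b2 * (x2 * y2)) = c * (b1 * x1) * y1 + c * (b2 * x2) * y2.
Proof. by ring. Qed.

Lemma Ex_linear d (T : measurableType d) (R : realType) (P : probability T R)
  (a b : R) (f g : T -> R) : L1 P f -> L1 P g ->
  L1 P (fun w => a * f w + b * g w) /\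
  Ex P (fun w => a * f w + b * g w) = a * Ex P f + b * Ex P g.
Proof.
move=> f1 g1; have af := L1Z a f1; have bg := L1Z b g1.
by split; [exact: L1D af bg|rewrite (ExD af bg) (ExZ a f1) (ExZ b g1)].
Qed.

Lemma select_powR (R : realType) (x : bool) (u y a : R) : 0 < a ->
  `|x%:R * u * y| `^ a = x%:R * (`|u| `^ a * `|y| `^ a).
Proof.
move=> a0; case: x; first by rewrite !mul1r normrM powRM.
by rewrite !mul0r normr0 powR0 ?lt0r_neq0.
Qed.

Section LinearStatistic.
Context d (T : measurableType d) (R : realType) (P : probability T R).
Context (law : R.-pker R ~> nat) (xi : nat -> {RV P >-> (R * R)%type}).
Context (X : bool -> nat -> nat -> {RV P >-> nat}).
Hypotheses (Hxi : iid_environment xi) (HX : offspring_given_environment law xi X)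
  (Hst : standing_assumptions law xi X).
Local Notation E := (Ex P).
Local Notation "G .-meas f" := (measurable_fun [set: g_sigma_algebraType G] (f : g_sigma_algebraType G -> _)) (at level 2).
Local Notation past := (past xi X).
Local Notation Mp := (Mp law xi).
Local Notation Mc := (Mc law xi).
Local Notation Zp := (Zp X).
Local Notation lnW := (lnW law xi X).
Local Notation mu := (mu law xi).
Local Notation sigma := (sigma law xi).
Local Notation rho := (rho law xi).
Context (delta : R).
Hypotheses (delta01 : 0 < delta <= 1)
  (HM : ('E_P[(fun w => M law xi false 0 w `^ (2 + delta) + M law xi true 0 w `^ (2 + delta))%R]
    < +oo)%E).
Context (Cw s : R).
Hypotheses (Cw0 : 0 < Cw) (s01 : 0 < s < 1)
  (lnWb : forall l i n, (i <= n)%N ->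
    L1 P (fun w => (lnW l n w - lnW l i w) ^+ 2) /\
    E (fun w => (lnW l n w - lnW l i w) ^+ 2) <= (Cw * s ^+ i) ^+ 2).

Lemma past_lnW i l n : (n <= i)%N -> (past i).-meas (lnW l n).
Proof.
move=> ni; apply: measurable_funB.
  by apply: (meas_natR (fun j => ln j%:R)); exact: past_Zp.
apply: measurable_sum => g; apply: past_Mp.
by rewrite ltn_eqF// (leq_trans (ltn_ord g)).
Qed.

Lemma measT_lnW l n : measurable_fun [set: T] (lnW l n).
Proof. by apply: (meas_sub (@pastm _ _ _ _ xi X n)); exact: past_lnW. Qed.

Lemma lnW0 l w : lnW l 0 w = 0.
Proof. by rewrite /lnW /= ln1 big_ord0 subrr. Qed.

Lemma lnW_stop l i n : L1 P (fun w => (lnW l n w - lnW l (minn i n) w) ^+ 2) /\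
    E (fun w => (lnW l n w - lnW l (minn i n) w) ^+ 2) <= (Cw * s ^+ i) ^+ 2.
Proof.
have [ni|ni] := leqP i n; first exact: lnWb.
have -> : (fun w => (lnW l n w - lnW l n w) ^+ 2) = fun=> 0.
  by apply/funext => w; rewrite subrr expr0n.
by rewrite Excst sqr_ge0; split => //; exact/bmL1/bmcst.
Qed.

(* [uf] and [ut] stand for [1 / (n V)] and [- 1 / (k V)], or for their opposites *)
Context (n k : nat) (uf ut u0 a : R).
Hypotheses (u00 : 0 < u0) (a0 : 0 < a) (ufu : `|uf| <= u0) (utu : `|ut| <= u0)
  (nuf : n%:R * uf ^+ 2 <= a) (kut : k%:R * ut ^+ 2 <= a)
  (var1 : n%:R * uf ^+ 2 * sigma false ^+ 2 + k%:R * ut ^+ 2 * sigma true ^+ 2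
    + 2 * (minn n k)%:R * (uf * ut) * (rho * sigma false * sigma true) = 1).

Let K := (n + k)%N.
Let cf i : R := (i < n)%N%:R * uf.
Let ct i : R := (i < k)%N%:R * ut.
Let q : R := 2 + delta.
Let mq l := E (fun w => `|Mc l 0 w| `^ q).

Definition summand i (w : T) : R := cf i * Mc false i w + ct i * Mc true i w.
Definition remainder (w : T) : R := uf * lnW false n w + ut * lnW true k w.
(** Frozen at generation [i], the normalised populations do not involve the
environment of that generation nor any offspring number from it. *)
Definition stopped_remainder i (w : T) : R :=
  uf * lnW false (minn i n) w + ut * lnW true (minn i k) w.

Definition beta_bound : R := 2 `^ q * (a * u0 `^ delta) * (mq false + mq true + 1).
(** The sum of a geometric series in [s], which bounds the cost of all stopped
remainders together. *)
Definition b_bound : R := 2 * u0 * Cw / (1 - s).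

Let q0 : 0 < q. Proof. by rewrite /q; have /andP[d0 _] := delta01; lra. Qed.

Lemma sum_ltn (N : nat) (g : nat -> R) : (N <= K)%N ->
  \sum_(i < K) (i < N)%N%:R * g i = \sum_(i < N) g i.
Proof. by move=> NK; rewrite sum_ltn_minn (minn_idPr NK). Qed.

(** [ln Z_n] is the sum of the [M_i], [i < n], and of [ln W_n]. *)
Lemma statistic_decomposition w :
  \sum_(i < K) summand i w + remainder w =
  uf * (ln (Zp false n w)%:R - n%:R * mu false) + ut * (ln (Zp true k w)%:R - k%:R * mu true).
Proof.
have part l (u : R) (N : nat) : (N <= K)%N ->
    \sum_(i < K) (i < N)%N%:R * u * Mc l i w = u * (\sum_(i < N) Mp l i w - N%:R * mu l).
  move=> NK; transitivity (\sum_(i < K) (i < N)%N%:R * (u * Mc l i w)).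
    by apply: eq_bigr => i _; rewrite mulrA.
  rewrite (sum_ltn (fun i => u * Mc l i w))// -mulr_sumr; congr (_ * _).
  by rewrite sumrB sumr_const card_ord mulr_natl.
rewrite big_split/= (part false) ?leq_addr// (part true) ?leq_addl//.
have alg (u t m1 m2 S1 S2 L1 L2 : R) : u * (S1 - m1) + t * (S2 - m2) +
    (u * (L1 - S1) + t * (L2 - S2)) = u * (L1 - m1) + t * (L2 - m2) by ring.
exact: alg.
Qed.

Let psi i (v : R * R) : R := cf i * psi_Mc law xi false v + ct i * psi_Mc law xi true v.

Lemma summand_indep : indep_fam P K past summand.
Proof.
have mpsi i : measurable_fun [set: R * R] (psi i).
  by apply: measurable_funD; apply: measurable_funM => //; exact: measurable_psi_Mc.
have sE i : summand i = psi i \o xi i.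
  by apply/funext => w; rewrite /summand !McE.
have msum i : measurable_fun [set: T] (summand i).
  by apply: measurable_funD; apply: measurable_funM => //; exact: measT_Mc.
move=> i iK; split.
- exact: pastm.
- exact: msum.
- move=> A B sA mB; rewrite sE comp_preimage; apply: (past_indep Hxi HX sA).
  by rewrite -[X in measurable X]setTI; exact: mpsi.
- move=> j _ ji; apply: measurable_funD; apply: measurable_funM => //;
    by apply: measurable_funB => //; exact: past_Mp.
Qed.

Lemma summand_L1_mean i : L1 P (summand i) /\ E (summand i) = 0.
Proof.
have [f1 f0] := Mc_L1 Hxi Hst delta01 HM false i.
have [t1 t0] := Mc_L1 Hxi Hst delta01 HM true i.
have [h1 hE] := Ex_linear (cf i) (ct i) f1 t1.
by split; [exact: h1|rewrite /summand hE f0 t0 !mulr0 addr0].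
Qed.

Lemma summand_sqr i : L1 P (fun w => summand i w ^+ 2) /\
  E (fun w => summand i w ^+ 2) = cf i ^+ 2 * sigma false ^+ 2 + ct i ^+ 2 * sigma true ^+ 2
    + 2 * (cf i * ct i) * (rho * sigma false * sigma true).
Proof.
have f2 := Mc_sqr Hxi Hst delta01 HM false i.
have t2 := Mc_sqr Hxi Hst delta01 HM true i.
have [ft1 _] := Mc_mul Hxi Hst delta01 HM false true i.
have ftE := Mc_covariance Hxi Hst delta01 HM i.
have [h1 hE] := Ex_linear (cf i ^+ 2) (ct i ^+ 2) f2 t2.
have [g1 gE] := Ex_linear 1 (2 * (cf i * ct i)) h1 ft1.
have -> : (fun w => summand i w ^+ 2) = (fun w => 1 * (cf i ^+ 2 * Mc false i w ^+ 2 +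
    ct i ^+ 2 * Mc true i w ^+ 2) + 2 * (cf i * ct i) * (Mc false i w * Mc true i w)).
  by apply/funext => w; rewrite /summand; move: (Mc false i w) (Mc true i w) => y z; ring.
split; first exact: g1.
rewrite gE hE mul1r ftE.
by rewrite (Mc_variance Hxi Hst delta01 HM false) (Mc_variance Hxi Hst delta01 HM true).
Qed.

Lemma summand_variance : \sum_(i < K) E (fun w => summand i w ^+ 2) = 1.
Proof.
under eq_bigr do rewrite (summand_sqr _).2.
rewrite !big_split/= -!mulr_suml -mulr_sumr; apply: etrans var1.
have bb (x : bool) : x%:R ^+ 2 = x%:R :> R by case: x; rewrite ?expr1n ?expr0n.
have e1 : \sum_(i < K) cf i ^+ 2 = n%:R * uf ^+ 2.
  under eq_bigr do rewrite /cf exprMn bb.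
  by rewrite (sum_ltn (fun=> uf ^+ 2)) ?leq_addr// sumr_const card_ord mulr_natl.
have e2 : \sum_(i < K) ct i ^+ 2 = k%:R * ut ^+ 2.
  under eq_bigr do rewrite /ct exprMn bb.
  by rewrite (sum_ltn (fun=> ut ^+ 2)) ?leq_addl// sumr_const card_ord mulr_natl.
have e3 : \sum_(i < K) (cf i * ct i) = (minn n k)%:R * (uf * ut).
  have e4 (i : 'I_K) : cf i * ct i = (i < minn n k)%N%:R * (uf * ut).
    by rewrite /cf /ct mulrACA -natrM mulnb leq_min.
  under eq_bigr do rewrite e4.
  by rewrite (sum_ltn (fun=> uf * ut)) ?geq_min ?leq_addr// sumr_const card_ord mulr_natl.
by rewrite e1 e2 e3 [2 * (_ * (uf * ut))]mulrA.
Qed.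

Lemma coefficient_powR (N : nat) (u : R) : `|u| <= u0 -> N%:R * u ^+ 2 <= a ->
  N%:R * `|u| `^ q <= a * u0 `^ delta.
Proof.
move=> uu Nu; have [dd0 dd1] := andP delta01.
have [->|u1] := eqVneq u 0.
  rewrite normr0 powR0 ?gt_eqF// mulr0 mulr_ge0 ?powR_ge0//.
  by apply: le_trans Nu; rewrite mulr_ge0 ?sqr_ge0.
rewrite /q powRD ?normr_eq0 ?u1 ?implybT// powR_mulrn// real_normK ?num_real// mulrA.
apply: ler_pM => //; first by rewrite mulr_ge0 ?sqr_ge0.
by apply: ge0_ler_powR; rewrite ?nnegrE ?(ltW dd0) ?(ltW u00).
Qed.

Lemma summand_powR i : L1 P (fun w => `|summand i w| `^ q) /\
  E (fun w => `|summand i w| `^ q) <=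
    2 `^ q * ((i < n)%N%:R * (`|uf| `^ q * mq false) + (i < k)%N%:R * (`|ut| `^ q * mq true)).
Proof.
have [f1 fE] := Mc_powR Hxi Hst delta01 HM false i.
have [t1 tE] := Mc_powR Hxi Hst delta01 HM true i.
rewrite -/q in f1 fE t1 tE.
pose A1 := 2 `^ q * ((i < n)%N%:R * `|uf| `^ q).
pose A2 := 2 `^ q * ((i < k)%N%:R * `|ut| `^ q).
pose B w := A1 * `|Mc false i w| `^ q + A2 * `|Mc true i w| `^ q.
have [B1 BE] := Ex_linear A1 A2 f1 t1.
have pt w : `|summand i w| `^ q <= B w.
  apply: (le_trans (powR_2norm_le _ _ q0)); rewrite /cf /ct !(select_powR _ _ _ q0).
  by rewrite regroup lexx.
have L : L1 P (fun w => `|summand i w| `^ q).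
  apply: (L1_le (g := B)) => [|w|]; last exact: B1.
    apply: (measurableT_comp (measurable_powR _)).
    by apply: (measurableT_comp (@normr_measurable _ _)); exact: (L1m (summand_L1_mean i).1).
  by rewrite ger0_norm ?powR_ge0.
split; first exact: L.
apply: (le_trans (Ex_le L B1 pt)).
have BE' : E B = A1 * mq false + A2 * mq true.
  exact: (etrans BE (f_equal2 (fun y z => A1 * y + A2 * z) fE tE)).
by rewrite BE' regroup lexx.
Qed.

Lemma mq_ge0 l : 0 <= mq l.
Proof. by apply: Ex_ge0 => w; exact: powR_ge0. Qed.

Lemma coefficient_sum y z : 0 <= y -> 0 <= z ->
  \sum_(i < K) 2 `^ q * ((i < n)%N%:R * (`|uf| `^ q * y) + (i < k)%N%:R * (`|ut| `^ q * z))
  <= 2 `^ q * (a * u0 `^ delta) * (y + z + 1).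
Proof.
move=> y0 z0; rewrite -mulr_sumr big_split/=.
rewrite (sum_ltn (fun=> `|uf| `^ q * y)) ?leq_addr//.
rewrite (sum_ltn (fun=> `|ut| `^ q * z)) ?leq_addl//.
rewrite !sumr_const !card_ord -[_ *+ n]mulr_natl -[_ *+ k]mulr_natl.
rewrite -[leRHS]mulrA ler_wpM2l ?powR_ge0//.
rewrite [n%:R * _]mulrA [k%:R * _]mulrA.
have h1 := ler_wpM2r y0 (coefficient_powR ufu nuf).
have h2 := ler_wpM2r z0 (coefficient_powR utu kut).
apply: (le_trans (lerD h1 h2)); rewrite -mulrDr ler_wpM2l ?mulr_ge0 ?powR_ge0 ?(ltW a0)//.
by rewrite lerDl.
Qed.

Lemma summand_third : \sum_(i < K) E (fun w => `|summand i w| `^ q) <= beta_bound.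
Proof.
apply: (@le_trans _ _ (\sum_(i < K) 2 `^ q *
    ((i < n)%N%:R * (`|uf| `^ q * mq false) + (i < k)%N%:R * (`|ut| `^ q * mq true)))).
  by apply: ler_sum => i _; exact: (summand_powR i).2.
exact: coefficient_sum (mq_ge0 false) (mq_ge0 true).
Qed.

Lemma combination_sqr (f g : T -> R) c : 0 <= c -> measurable_fun [set: T] f ->
  measurable_fun [set: T] g ->
  L1 P (fun w => f w ^+ 2) -> L1 P (fun w => g w ^+ 2) ->
  E (fun w => f w ^+ 2) <= c ^+ 2 -> E (fun w => g w ^+ 2) <= c ^+ 2 ->
  L1 P (fun w => (uf * f w + ut * g w) ^+ 2) /\
  E (fun w => (uf * f w + ut * g w) ^+ 2) <= (2 * u0 * c) ^+ 2.
Proof.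
move=> c0 mf mg f2 g2 fc gc.
have [hf ht hu] := And3 ufu utu u00.
have uf2 : uf ^+ 2 <= u0 ^+ 2 by rewrite -[uf ^+ 2]real_normK ?num_real// lerXn2r ?nnegrE// ltW.
have ut2 : ut ^+ 2 <= u0 ^+ 2 by rewrite -[ut ^+ 2]real_normK ?num_real// lerXn2r ?nnegrE// ltW.
pose B w := 2 * u0 ^+ 2 * (f w ^+ 2 + g w ^+ 2).
have pt w : (uf * f w + ut * g w) ^+ 2 <= B w.
  have h1 := ler_wpM2r (sqr_ge0 (f w)) uf2; have h2 := ler_wpM2r (sqr_ge0 (g w)) ut2.
  have h3 := sqr_ge0 (uf * f w - ut * g w).
  rewrite /B; lra.
have B1 : L1 P B by apply: L1Z; exact: L1D.
have L : L1 P (fun w => (uf * f w + ut * g w) ^+ 2).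
  apply: L1_le B1 => [|w]; last by rewrite ger0_norm ?sqr_ge0.
  by apply: measurable_funX; apply: measurable_funD; exact: measurable_funM.
split; first exact: L.
apply: (le_trans (Ex_le L B1 pt)).
rewrite /B ExZ ?ExD//; last exact: L1D.
have := ler_wpM2l (sqr_ge0 u0) (lerD fc gc); lra.
Qed.

Lemma remainder_sqr : L1 P (fun w => remainder w ^+ 2) /\
  E (fun w => remainder w ^+ 2) <= b_bound ^+ 2.
Proof.
have /andP[s0 s1] := s01.
have sub l j : (fun w => lnW l j w ^+ 2) = (fun w => (lnW l j w - lnW l 0 w) ^+ 2).
  by apply/funext => w; rewrite lnW0 subr0.
have [f1 fE] := lnWb false (leq0n n); have [t1 tE] := lnWb true (leq0n k).
rewrite -sub expr0 mulr1 in f1 fE; rewrite -sub expr0 mulr1 in t1 tE.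
have [h1 h2] := combination_sqr (ltW Cw0) (measT_lnW false n) (measT_lnW true k) f1 t1 fE tE.
split; first exact: h1.
apply: (le_trans h2).
have h : 2 * u0 * Cw <= b_bound.
  rewrite /b_bound ler_peMr ?mulr_ge0 ?(ltW u00) ?(ltW Cw0)// invf_ge1 ?subr_gt0//.
  by rewrite lerBlDr lerDl ltW.
have c0 : 0 <= 2 * u0 * Cw by rewrite !mulr_ge0 ?(ltW u00) ?(ltW Cw0).
by rewrite lerXn2r// nnegrE// (le_trans c0).
Qed.

Lemma stopped_remainder_sqr i : L1 P (fun w => (remainder w - stopped_remainder i w) ^+ 2) /\
  E (fun w => (remainder w - stopped_remainder i w) ^+ 2) <= (2 * u0 * (Cw * s ^+ i)) ^+ 2.
Proof.
have /andP[s0 s1] := s01.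
have [f1 fE] := lnW_stop false i n; have [t1 tE] := lnW_stop true i k.
have -> : (fun w => (remainder w - stopped_remainder i w) ^+ 2) =
   (fun w => (uf * (lnW false n w - lnW false (minn i n) w) +
              ut * (lnW true k w - lnW true (minn i k) w)) ^+ 2).
  by apply/funext => w; rewrite /remainder /stopped_remainder; congr (_ ^+ 2); ring.
apply: combination_sqr => //.
- by rewrite mulr_ge0 ?exprn_ge0 ?ltW.
- by apply: measurable_funB; exact: measT_lnW.
- by apply: measurable_funB; exact: measT_lnW.
Qed.

Lemma geometric_sum_le N : \sum_(i < N) s ^+ i <= (1 - s)^-1.
Proof.
have /andP[s0 s1] := s01; have s1' : 0 < 1 - s by rewrite subr_gt0.
rewrite -[leRHS]mul1r ler_pdivlMr//.
suff -> : (\sum_(i < N) s ^+ i) * (1 - s) = 1 - s ^+ N by rewrite lerBlDr lerDl exprn_ge0// ltW.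
elim: N => [|N IH]; first by rewrite big_ord0 mul0r expr0 subrr.
by rewrite big_ord_recr/= mulrDl IH exprS; ring.
Qed.

Lemma linear_statistic_tail (x : R) (A : set T) : 0 <= x -> measurable A ->
  (forall w, x < \sum_(i < K) summand i w + remainder w -> A w) ->
  (forall w, A w -> x <= \sum_(i < K) summand i w + remainder w) ->
  `|fine (P A) - tailN x| <= Cnl R * (beta_bound + b_bound + b_bound ^+ 2) / (1 + x ^+ 2).
Proof.
have /andP[s0 s1] := s01; have s1' : 0 < 1 - s by rewrite subr_gt0.
have c0 : 0 <= 2 * u0 * Cw by rewrite !mulr_ge0 ?(ltW u00) ?(ltW Cw0).
have mrem : measurable_fun [set: T] remainder.
  apply: measurable_funD.
    exact: (measurable_funM (measurable_cst uf) (measT_lnW false n)).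
  exact: (measurable_funM (measurable_cst ut) (measT_lnW true k)).
have mstop i : (past i).-meas (stopped_remainder i).
  apply: measurable_funD.
    exact: (measurable_funM (measurable_cst uf) (past_lnW false (geq_minl i n))).
  exact: (measurable_funM (measurable_cst ut) (past_lnW true (geq_minl i k))).
have beta0 : 0 < beta_bound.
  by rewrite /beta_bound !mulr_gt0 ?powR_gt0// ltr_wpDl// addr_ge0 ?mq_ge0.
have b0 : 0 <= b_bound by rewrite /b_bound divr_ge0// ltW.
have di0 i : 0 <= 2 * u0 * (Cw * s ^+ i).
  by rewrite !mulr_ge0 ?exprn_ge0 ?(ltW u00) ?(ltW Cw0) ?(ltW s0).
have dsum : \sum_(i < K) 2 * u0 * (Cw * s ^+ i) <= b_bound.
  rewrite -!mulr_sumr mulrA /b_bound ler_wpM2l//; exact: geometric_sum_le.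
exact: (nonlinear_berry_esseen summand_indep delta01 beta0
  (fun i _ => (summand_L1_mean i).1) (fun i _ => (summand_sqr i).1)
  (fun i _ => (summand_powR i).1) (fun i _ => (summand_L1_mean i).2)
  summand_variance summand_third b0 mrem (fun i _ => mstop i)
  remainder_sqr.1 remainder_sqr.2 (fun i _ => di0 i)
  (fun i _ => (stopped_remainder_sqr i).1) (fun i _ => (stopped_remainder_sqr i).2)
  dsum).
Qed.

End LinearStatistic.

(** * The rate of convergence *)

Section Weights.
Context (R : realType).

Lemma common_lower_bound (x y z : R) : 0 < x -> 0 < y -> 0 < z ->
  exists c, [/\ 0 < c, c <= x, c <= y & c <= z].
Proof.
move=> x0 y0 z0; exists (Num.min x (Num.min y z)).
by rewrite !lt_min !ge_min x0 y0 z0 !lexx !orbT.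
Qed.

(** If [k <= n], the right-hand side is [(sf2 + st2 - 2 cov) / n] plus
[st2 (1/k - 1/n)]. *)
Lemma variance_lower (c sf2 st2 cov : R) (k n : nat) : (1 <= k)%N -> (1 <= n)%N ->
  c <= sf2 -> c <= st2 -> c <= sf2 + st2 - 2 * cov ->
  c / (minn k n)%:R <= n%:R^-1 * sf2 + k%:R^-1 * st2 - 2 * cov * ((minn k n)%:R / (k%:R * n%:R)).
Proof.
move=> k1 n1 cf ct cd.
have k0 : 0 < k%:R :> R by rewrite ltr0n.
have n0 : 0 < n%:R :> R by rewrite ltr0n.
have in0 : 0 <= (n%:R : R)^-1 by rewrite invr_ge0 ltW.
have ik0 : 0 <= (k%:R : R)^-1 by rewrite invr_ge0 ltW.
have [kn|/ltnW nk] := leqP k n.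
  have -> : k%:R / (k%:R * n%:R) = n%:R^-1 :> R by field; rewrite !gt_eqF.
  have d : (n%:R : R)^-1 <= k%:R^-1 by rewrite lef_pV2 ?posrE// ler_nat.
  nra.
have -> : n%:R / (k%:R * n%:R) = k%:R^-1 :> R by field; rewrite !gt_eqF.
have d : (k%:R : R)^-1 <= n%:R^-1 by rewrite lef_pV2 ?posrE// ler_nat.
nra.
Qed.

Lemma sqr_weight (eps v V2 n : R) : eps ^+ 2 = 1 -> v ^+ 2 = V2 -> 0 < n -> 0 < v ->
  (eps / (n * v)) ^+ 2 = (n ^+ 2 * V2)^-1.
Proof. by move=> e1 <- n0 v0; rewrite expr_div_n e1 exprMn div1r. Qed.

Lemma weight_bounds (c V2 u : R) (n N : nat) : (1 <= N)%N -> (N <= n)%N -> 0 < c ->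
  c / N%:R <= V2 -> u ^+ 2 = (n%:R ^+ 2 * V2)^-1 ->
  `|u| <= Num.sqrt (c^-1 / N%:R) /\ n%:R * u ^+ 2 <= c^-1.
Proof.
move=> N1 Nn c0 cV uE.
have N0 : 0 < N%:R :> R by rewrite ltr0n.
have NnR : N%:R <= n%:R :> R by rewrite ler_nat.
have n0 : 0 < n%:R :> R by exact: lt_le_trans NnR.
have cN : 0 < c / N%:R by exact: divr_gt0.
have V0 : 0 < V2 by exact: lt_le_trans cV.
have h : n%:R * u ^+ 2 <= c^-1.
  rewrite uE (_ : _ * _ = (n%:R * V2)^-1); last by field; rewrite !gt_eqF.
  rewrite lef_pV2 ?posrE ?mulr_gt0//; apply: (@le_trans _ _ (N%:R * V2)).
    by rewrite -ler_pdivrMl// mulrC.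
  by rewrite ler_wpM2r// ltW.
split => //; rewrite -sqrtr_sqr ler_wsqrtr//.
rewrite ler_pdivlMr//; apply: le_trans h.
by rewrite mulrC ler_wpM2r ?sqr_ge0.
Qed.

Lemma sqrt_powR (x a : R) : 0 <= x -> Num.sqrt x `^ a = x `^ (a / 2).
Proof. by move=> x0; rewrite -powR12_sqrt// -powRrM mulrC. Qed.

Lemma inv_nat_powR (N : nat) (delta : R) : (1 <= N)%N ->
  (N%:R^-1) `^ (delta / 2) = (N%:R `^ (delta / 2))^-1.
Proof. by move=> N1; rewrite -powR_inv1// -powRrM mulN1r powRN. Qed.

Lemma rate_terms (N : nat) (delta a : R) : (1 <= N)%N -> 0 < delta <= 1 -> 0 < a ->
  [/\ Num.sqrt (a / N%:R) `^ delta = a `^ (delta / 2) * (N%:R `^ (delta / 2))^-1,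
      Num.sqrt (a / N%:R) <= Num.sqrt a * (N%:R `^ (delta / 2))^-1 &
      Num.sqrt (a / N%:R) ^+ 2 <= a * (N%:R `^ (delta / 2))^-1].
Proof.
move=> N1 /andP[d0 d1] a0; have N0 : 0 < (N%:R : R)^-1 by rewrite invr_gt0 ltr0n.
have Ni : (N%:R : R)^-1 <= 1 by rewrite invf_le1 ?ltr0n// ler1n.
have aN : 0 <= a / N%:R by rewrite divr_ge0// ltW.
rewrite -inv_nat_powR//; split.
- by rewrite sqrt_powR// powRM// ltW.
- rewrite sqrtrM ?(ltW a0)// ler_wpM2l ?sqrtr_ge0// -powR12_sqrt ?(ltW N0)//.
  by apply: ger_powR; [rewrite N0|rewrite ler_pdivrMr// mulVf].
- rewrite sqr_sqrtr// ler_wpM2l ?(ltW a0)//.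
  by apply: ger1_powR; [rewrite N0|rewrite ler_pdivrMr// mul1r (le_trans d1)// ler1n].
Qed.

Lemma inv_1Dsqr_le (x e : R) : 0 < e <= 2 -> (1 + x ^+ 2)^-1 <= 2 * (1 + `|x| `^ e)^-1.
Proof.
move=> /andP[e0 e2]; have h : `|x| `^ e <= 1 + x ^+ 2.
  apply: (@le_trans _ _ (1 + `|x| `^ 2)); first by apply: le_1D_powR; rewrite ?e0.
  by rewrite powR_mulrn// real_normK ?num_real.
have p1 : 0 < 1 + `|x| `^ e by rewrite ltr_wpDr ?powR_ge0.
have p2 : 0 < 1 + x ^+ 2 by rewrite ltr_wpDr ?sqr_ge0.
rewrite -div1r ler_pdivrMr// mulrAC ler_pdivlMr// mul1r; have := sqr_ge0 x; lra.
Qed.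

Lemma collect_rate (m a A L r u h : R) : 0 <= L -> u <= r * h -> u ^+ 2 <= a * h ->
  m * (a * (A * h)) + L * u + (L * u) ^+ 2 <= (m * (a * A) + L * r + L ^+ 2 * a) * h.
Proof.
move=> L0 h1 h2; have := ler_wpM2l L0 h1; have := ler_wpM2l (sqr_ge0 L) h2.
rewrite exprMn; lra.
Qed.

Lemma weighted_variance (eps v n k N sf2 st2 cov : R) : eps ^+ 2 = 1 -> 0 < v ->
  0 < n -> 0 < k ->
  v ^+ 2 = n^-1 * sf2 + k^-1 * st2 - 2 * cov * (N / (k * n)) ->
  n * (eps / (n * v)) ^+ 2 * sf2 + k * (- eps / (k * v)) ^+ 2 * st2
    + 2 * N * (eps / (n * v) * (- eps / (k * v))) * cov = 1.
Proof.
move=> e1 v0 n0 k0 vE.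
have -> : n * (eps / (n * v)) ^+ 2 * sf2 + k * (- eps / (k * v)) ^+ 2 * st2
    + 2 * N * (eps / (n * v) * (- eps / (k * v))) * cov =
  eps ^+ 2 * (n^-1 * sf2 + k^-1 * st2 - 2 * cov * (N / (k * n))) / v ^+ 2.
  by field; rewrite !gt_eqF.
by rewrite e1 -vE mul1r divff// expf_neq0// gt_eqF.
Qed.

Lemma weighted_statistic (eps v n k x y mx my : R) : 0 < v -> 0 < n -> 0 < k ->
  eps / (n * v) * (x - n * mx) + - eps / (k * v) * (y - k * my) =
  eps * ((n^-1 * x - k^-1 * y - (mx - my)) / v).
Proof. by move=> v0 n0 k0; field; rewrite !gt_eqF. Qed.

Lemma tail_rate (K t b h y e : R) : 0 <= b -> 0 <= h -> t <= b * h -> 0 <= t -> 0 < e <= 2 ->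
  K * t / (1 + y ^+ 2) <= (2 * `|K| * b + 1) * h * (1 / (1 + `|y| `^ e)).
Proof.
move=> b0 h0 tb t0 e02; have g0 := inv_1Dsqr_le y e02.
have p0 : 0 <= (1 + y ^+ 2)^-1 by rewrite invr_ge0 addr_ge0 ?sqr_ge0.
have q0 : 0 <= (1 + `|y| `^ e)^-1 by rewrite invr_ge0 addr_ge0 ?powR_ge0.
have K0 : 0 <= `|K| * (b * h) by rewrite !mulr_ge0.
apply: (@le_trans _ _ (`|K| * (b * h) * (1 + y ^+ 2)^-1)).
  rewrite ler_wpM2r//; apply: (@le_trans _ _ (`|K| * t)).
    by rewrite ler_wpM2r// ler_norm.
  by rewrite ler_wpM2l.
apply: (le_trans (ler_wpM2l K0 g0)).
rewrite div1r mulrA ler_wpM2r//; have := mulr_ge0 (normr_ge0 K) b0; lra.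
Qed.

End Weights.

Theorem theorem2p2 (R : realType) (d : measure_display) (T : measurableType d)
    (P : probability T R)
    (law : R.-pker R ~> nat)
    (xi : nat -> {RV P >-> (R * R)%type})
    (X : bool -> nat -> nat -> {RV P >-> nat})
    (Hxi : iid_environment xi)
    (HX : offspring_given_environment law xi X)
    (Hst : standing_assumptions law xi X)
    (delta : R) (Hdelta : 0 < delta <= 1)
    (HM : ('E_P[(fun w => M law xi false 0 w `^ (2 + delta)
                       + M law xi true 0 w `^ (2 + delta))%R] < +oo)%E)
    (p : R) (Hp : 1 < p)
    (HZ : ('E_P[(fun w =>
             (Z X false 1 w)%:R `^ p / m law xi false 0 w `^ p
           + (Z X true 1 w)%:R `^ p / m law xi true 0 w `^ p)%R] < +oo)%E)
    (delta' : R) (Hdelta' : 0 < delta' < delta) :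
  exists C : R, 0 < C /\
    forall (k n : nat), (1 <= k)%N -> (1 <= n)%N -> forall x : R,
      `| fine (P [set w | Rstat law xi X k n w <= x]) - std_normal_cdf x |
      <= C / (minn k n)%:R `^ (delta / 2) * (1 / (1 + `|x| `^ (1 + delta'))).
Proof.
have [Cw [s [Cw0 s01 lnWb]]] := lnW_increment_both Hxi HX Hst Hdelta HM Hp HZ.
have /andP[d0 d1] := Hdelta; have /andP[d'0 d'd] := Hdelta'.
pose sf := sigma law xi false; pose st := sigma law xi true.
pose cov := rho law xi * sf * st.
have sf0 : 0 < sf := sigma_gt0 Hst false; have st0 : 0 < st := sigma_gt0 Hst true.
have D0 : 0 < sf ^+ 2 + st ^+ 2 - 2 * cov := difference_variance_gt0 Hst.
have [c [c0 cf ct cd]] : exists c, [/\ 0 < c, c <= sf ^+ 2, c <= st ^+ 2 &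
    c <= sf ^+ 2 + st ^+ 2 - 2 * cov].
  exact: common_lower_bound (exprn_gt0 2 sf0) (exprn_gt0 2 st0) D0.
pose a := c^-1; have a0 : 0 < a by rewrite invr_gt0.
pose u0 N := Num.sqrt (a / N%:R) : R.
have bE N : b_bound Cw s (u0 N) = 2 * Cw / (1 - s) * u0 N.
  by rewrite /b_bound; ring.
have [m m0 mE] : exists2 m, 0 <= m & forall u a', beta_bound law xi delta u a' = m * (a' * u `^ delta).
  exists (2 `^ (2 + delta) * (Ex P (fun w => `|Mc law xi false 0 w| `^ (2 + delta)) +
    Ex P (fun w => `|Mc law xi true 0 w| `^ (2 + delta)) + 1)).
    by rewrite mulr_ge0 ?powR_ge0// !addr_ge0// Ex_ge0// => w; exact: powR_ge0.
  by move=> u a'; rewrite /beta_bound mulrAC.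
have s1 : 0 < 1 - s by have /andP[_ s1] := s01; rewrite subr_gt0.
pose L := 2 * Cw / (1 - s); have L0 : 0 <= L by rewrite divr_ge0 ?mulr_ge0// ltW.
pose C1 := m * (a * a `^ (delta / 2)) + L * Num.sqrt a + L ^+ 2 * a.
have rate N : (1 <= N)%N -> beta_bound law xi delta (u0 N) a + b_bound Cw s (u0 N)
    + b_bound Cw s (u0 N) ^+ 2 <= C1 * (N%:R `^ (delta / 2))^-1.
  move=> N1; have [e1 e2 e3] := rate_terms N1 Hdelta a0.
  by rewrite mE e1 bE -/L /C1; exact: collect_rate.
have C10 : 0 <= C1.
  have h1 : 0 <= m * (a * a `^ (delta / 2)) by rewrite !mulr_ge0 ?powR_ge0// ltW.
  have h2 : 0 <= L * Num.sqrt a := mulr_ge0 L0 (sqrtr_ge0 a).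
  have h3 : 0 <= L ^+ 2 * a := mulr_ge0 (sqr_ge0 L) (ltW a0).
  exact: addr_ge0 (addr_ge0 h1 h2) h3.
exists (2 * `|Cnl R| * C1 + 1); split; first by rewrite ltr_wpDl// !mulr_ge0.
move=> k n k1 n1 x.
pose N := minn k n; have N1 : (1 <= N)%N by rewrite leq_min k1.
have k0 : 0 < k%:R :> R by rewrite ltr0n.
have n0 : 0 < n%:R :> R by rewrite ltr0n.
have h0 : 0 <= (N%:R `^ (delta / 2))^-1 :> R by rewrite invr_ge0 powR_ge0.
have cV : c / N%:R <= n%:R^-1 * sf ^+ 2 + k%:R^-1 * st ^+ 2 - 2 * cov * (N%:R / (k%:R * n%:R)).
  exact: variance_lower.
pose v := V law xi k n.
have VE : V law xi k n = Num.sqrt (n%:R^-1 * sf ^+ 2 + k%:R^-1 * st ^+ 2 - 2 * cov * (N%:R / (k%:R * n%:R))).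
  by rewrite /V /cov -/sf -/st -/N !mulrA.
have V0 : 0 < n%:R^-1 * sf ^+ 2 + k%:R^-1 * st ^+ 2 - 2 * cov * (N%:R / (k%:R * n%:R)).
  by apply: lt_le_trans cV; rewrite divr_gt0 ?ltr0n.
have v0 : 0 < v by rewrite /v VE sqrtr_gt0.
have vv : v ^+ 2 = n%:R^-1 * sf ^+ 2 + k%:R^-1 * st ^+ 2 - 2 * cov * (N%:R / (k%:R * n%:R)).
  by rewrite /v VE sqr_sqrtr// ltW.
pose Rp w : R := (n%:R^-1 * ln (Zp X false n w)%:R - k%:R^-1 * ln (Zp X true k w)%:R
  - (mu law xi false - mu law xi true)) / v.
(* the sign [eps] turns lower tails into upper ones *)
have tail eps y A : eps ^+ 2 = 1 -> 0 <= y -> measurable A ->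
    (forall w, y < eps * Rp w -> A w) -> (forall w, A w -> y <= eps * Rp w) ->
    `|fine (P A) - tailN y| <= (2 * `|Cnl R| * C1 + 1) / N%:R `^ (delta / 2) *
      (1 / (1 + `|y| `^ (1 + delta'))).
  move=> eps1 y0 mA A1 A2.
  have [uf1 uf2] := weight_bounds (u := eps / (n%:R * v)) N1 (geq_minr k n) c0 cV (sqr_weight eps1 vv n0 v0).
  have [ut1 ut2] := weight_bounds (u := - eps / (k%:R * v)) N1 (geq_minl k n) c0 cV
    (sqr_weight (etrans (sqrrN eps) eps1) vv k0 v0).
  have u00 : 0 < u0 N by rewrite sqrtr_gt0 divr_gt0// ltr0n.
  have var1 := weighted_variance eps1 v0 n0 k0 vv.
  rewrite /N minnC in var1.
  have stE w : \sum_(i < n + k) summand law xi n k (eps / (n%:R * v)) (- eps / (k%:R * v)) i w +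
      remainder law xi X n k (eps / (n%:R * v)) (- eps / (k%:R * v)) w = eps * Rp w.
    by rewrite statistic_decomposition; exact: weighted_statistic.
  have B1 w : y < \sum_(i < n + k) summand law xi n k (eps / (n%:R * v)) (- eps / (k%:R * v)) i w +
      remainder law xi X n k (eps / (n%:R * v)) (- eps / (k%:R * v)) w -> A w.
    by rewrite stE; exact: A1.
  have B2 w : A w -> y <= \sum_(i < n + k) summand law xi n k (eps / (n%:R * v)) (- eps / (k%:R * v)) i w +
      remainder law xi X n k (eps / (n%:R * v)) (- eps / (k%:R * v)) w.
    by rewrite stE; exact: A2.
  have := linear_statistic_tail Hxi HX Hst Hdelta HM Cw0 s01 lnWb u00 a0 uf1 ut1 uf2 ut2 var1
    y0 mA B1 B2.
  move=> /le_trans; apply; apply: tail_rate => //; first exact: rate.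
    have h1 : 0 <= beta_bound law xi delta (u0 N) a by rewrite mE !mulr_ge0 ?powR_ge0// ltW.
    have h2 : 0 <= b_bound Cw s (u0 N) by rewrite bE; exact: mulr_ge0 L0 (ltW u00).
    exact: addr_ge0 (addr_ge0 h1 h2) (sqr_ge0 _).
  by rewrite addr_gt0//= -[leRHS]/(1 + 1) lerD2l (le_trans (ltW d'd)).
have mRp : measurable_fun [set: T] Rp.
  have mln l j : measurable_fun [set: T] (fun w => ln (Zp X l j w)%:R : R).
    exact: (measT_natR (fun i => ln i%:R) (measT_Zp xi X l j)).
  apply: measurable_funM => //; apply: measurable_funB => //; apply: measurable_funB.
    exact: (measurable_funM (measurable_cst _) (mln false n)).
  exact: (measurable_funM (measurable_cst _) (mln true k)).
have mR : measurable_fun [set: T] (Rstat law xi X k n).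
  have mln l j : measurable_fun [set: T] (fun w => ln (Z X l j w)%:R : R).
    exact: (measT_natR (fun i => ln i%:R) (measT_Z xi X l j)).
  apply: measurable_funM => //; apply: measurable_funB => //; apply: measurable_funB.
    exact: (measurable_funM (measurable_cst _) (mln false n)).
  exact: (measurable_funM (measurable_cst _) (mln true k)).
have mle : measurable [set w | Rp w <= x] by exact: measurable_le_set.
(* the two versions of the processes agree almost surely *)
have -> : fine (P [set w | Rstat law xi X k n w <= x]) = fine (P [set w | Rp w <= x]).
  have mle' : measurable [set w | Rstat law xi X k n w <= x] by exact: measurable_le_set.
  rewrite -(Ex_indic P mle') -(Ex_indic P mle); apply: Ex_ae_eq; [exact: measurable_indic|exact: measurable_indic|].
  apply: filterS (ae_Zp Hxi HX Hst) => w hw; rewrite !indicE.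
  have memE (f : T -> R) : (w \in [set w0 | f w0 <= x]) = (f w <= x).
    by apply/idP/idP; rewrite inE.
  by rewrite !memE (_ : Rstat law xi X k n w = Rp w)// /Rstat /Rp !hw.
have [x0|x0] := leP 0 x.
  have mlt : measurable [set w | x < Rp w] by exact: measurable_lt_set.
  have := tail 1 x [set w | x < Rp w] (expr1n _ 2) x0 mlt.
  have -> : [set w | Rp w <= x] = ~` [set w | x < Rp w].
    by apply/seteqP; split => w /=; rewrite leNgt => /negP.
  rewrite probability_setC// fineB// ?fin_num_measure// /tailN.
  have alg (q z : R) : 1 - q - z = - (q - (1 - z)) by ring.
  by rewrite alg normrN; apply => w; rewrite mul1r//; exact: ltW.
have := tail (- 1) (- x) [set w | Rp w <= x] _ _ mle.
rewrite -PhiN opprK normrN => H; apply: H.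
- by rewrite sqrrN expr1n.
- by rewrite oppr_ge0 ltW.
- by move=> w; rewrite mulN1r ltrN2 => /ltW.
- by move=> w; rewrite mulN1r lerN2.
Qed.
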